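(* Let $k\geq 2$. For every $c>0$ and every $\gamma>c$ there exists a constant $C>0$ such that the following holds for all sufficiently large $n$. Let $p=p(n)\in[0,1]$ with $p\geq (k+\gamma)\log(n)/n$, let $d:=p(n-k)$, $\gamma_A:=C\sqrt{d}$ and $\gamma_\Delta:=C/\sqrt{d}$. Then with probability at least $1-n^{-c}$ the random complex $X=X^k(n,p)$ satisfies: (i) the largest $\binom{n-1}{k-1}$ eigenvalues of $A_{k-1}(X)$ lie in $[d-\gamma_A,d+\gamma_A]$, and the remaining $\binom{n-1}{k}$ eigenvalues lie in $[-\gamma_A,\gamma_A]$; (ii) $X$ is pure, the smallest $\binom{n-1}{k-1}$ eigenvalues of $\Delta^{\mathrm{up}}_{k-1}(X)$ are $0$, and the remaining $\binom{n-1}{k}$ eigenvalues lie in $[1-\gamma_\Delta,1+\gamma_\Delta]$; in particular $\tilde H^{k-1}(X;\mathbb{R})=0$. Moreover, statement (i) already holds (with probability at least $1-n^{-c}$) under the weaker assumption $p\geq \gamma\log(n)/n$.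
   Context: A simplicial complex $X$ has a linearly ordered vertex set; $X_i$ is its set of $i$-dimensional faces ($(i+1)$-element faces). For $F\in X_i$, $G\in X_{i-1}$ the incidence number is $[F:G]=(-1)^j$ if $G\subseteq F$ and $F\setminus G=\{v_j\}$ where $F=\{v_0<\dots<v_i\}$, and $[F:G]=0$ if $G\not\subseteq F$. For a $k$-dimensional complex, the degree $\deg(F)$ of a face is the number of $k$-faces containing it; $X$ is pure if every maximal face has dimension $k$. $C^{i}(X;\mathbb R)=\mathbb R^{X_i}$, the coboundary map is $(\delta_i f)(H)=\sum_{G\in X_i}[H:G]f(G)$, and $B^{i}(X)=\operatorname{im}\delta_{i-1}$. The generalized adjacency matrix $A_{k-1}(X)$ is the $X_{k-1}\times X_{k-1}$ matrix with $(A_{k-1})_{F,G}=[F:F\cap G]\,[G:F\cap G]$ if $|F\cap G|=k-1$ and $F\cup G\in X_k$, and $0$ otherwise. For pure $X$, with $D_{k-1}$ the diagonal matrix of degrees of $(k-1)$-faces, the normalized up-Laplacian is $\Delta^{\mathrm{up}}_{k-1}(X)=I-D_{k-1}^{-1}A_{k-1}(X)$; it is self-adjoint with respect to $\langle f,g\rangle=\sum_{F\in X_{k-1}}\deg(F)f(F)g(F)$ and has real eigenvalues. The Linial–Meshulam random complex $X^k(n,p)$ has vertex set $[n]$, contains every subset of $[n]$ of size at most $k$ as a face (complete $(k-1)$-skeleton), and contains each $(k+1)$-element subset of $[n]$ as a $k$-face independently with probability $p$. *)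

(* Defs.v *)
(* MathComp (finsets, matrices, char_poly) over the Stdlib real numbers R,
   which are equipped below with a MathComp realFieldType structure (so that
   ln, sqrt, Rpower from Stdlib and MathComp linear algebra can be combined). *)
From HB Require Import structures.
From Stdlib Require Import Reals Lra Psatz ClassicalEpsilon FunctionalExtensionality.
From mathcomp Require Import all_boot all_order all_algebra.
Set Implicit Arguments. Unset Strict Implicit. Unset Printing Implicit Defensive.
Import Order.TTheory GRing.Theory Num.Theory.

Definition Req_bool (x y : R) : bool := if Req_EM_T x y then true else false.
Lemma Req_boolP : Equality.axiom Req_bool.
Proof. move=> x y; rewrite /Req_bool; case: Req_EM_T => h; [exact: ReflectT|exact: ReflectF]. Qed.
HB.instance Definition _ := hasDecEq.Build R Req_boolP.

Definition R_find (P : pred R) (n : nat) : option R :=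
  match excluded_middle_informative (exists x, P x) with
  | left h => Some (proj1_sig (constructive_indefinite_description _ h))
  | right _ => None end.
Lemma R_find_correct P n x : R_find P n = Some x -> P x.
Proof. rewrite /R_find; case: excluded_middle_informative => // h [<-].
exact: proj2_sig (constructive_indefinite_description _ h). Qed.
Lemma R_find_complete (P : pred R) : (exists x, P x) -> exists n, R_find P n.
Proof. move=> h; exists 0%N; rewrite /R_find; case: excluded_middle_informative => //. Qed.
Lemma R_find_ext (P Q : pred R) : P =1 Q -> R_find P =1 R_find Q.
Proof. move=> h; have -> : P = Q by apply: functional_extensionality. by []. Qed.
HB.instance Definition _ := hasChoice.Build R R_find_correct R_find_complete R_find_ext.

Lemma R_addA : associative Rplus. Proof. move=> *; ring. Qed.
Lemma R_addC : commutative Rplus. Proof. move=> *; ring. Qed.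
Lemma R_add0 : left_id (IZR 0) Rplus. Proof. move=> *; ring. Qed.
Lemma R_addN : left_inverse (IZR 0) Ropp Rplus. Proof. move=> *; ring. Qed.
HB.instance Definition _ := GRing.isZmodule.Build R R_addA R_addC R_add0 R_addN.
Lemma R_mulA : associative Rmult. Proof. move=> *; ring. Qed.
Lemma R_mulC : commutative Rmult. Proof. move=> *; ring. Qed.
Lemma R_mul1 : left_id (IZR 1) Rmult. Proof. move=> *; ring. Qed.
Lemma R_mulDl : left_distributive Rmult Rplus. Proof. move=> *; ring. Qed.
Lemma R_10 : (IZR 1) != (IZR 0) :> R. Proof. apply/eqP; exact: R1_neq_R0. Qed.
HB.instance Definition _ := GRing.Zmodule_isComNzRing.Build R R_mulA R_mulC R_mul1 R_mulDl R_10.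
Definition R_inv (x : R) : R := if x == 0%R then 0%R else Rinv x.
Lemma R_mulVf (x : R) : x != 0%R -> (R_inv x * x = 1)%R.
Proof. move=> hx; rewrite /R_inv (negbTE hx); apply: Rinv_l => e; by rewrite e eqxx in hx. Qed.
Lemma R_inv0 : R_inv 0%R = 0%R. Proof. by rewrite /R_inv eqxx. Qed.
HB.instance Definition _ := GRing.ComNzRing_isField.Build R R_mulVf R_inv0.

Definition Rleb (x y : R) : bool := if Rle_dec x y then true else false.
Definition Rltb (x y : R) : bool := if Rlt_dec x y then true else false.
Lemma RlebP x y : reflect (Rle x y) (Rleb x y).
Proof. rewrite /Rleb; case: Rle_dec => h; [exact: ReflectT|exact: ReflectF]. Qed.
Lemma RltbP x y : reflect (Rlt x y) (Rltb x y).
Proof. rewrite /Rltb; case: Rlt_dec => h; [exact: ReflectT|exact: ReflectF]. Qed.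
Lemma R_le0_add x y : Rleb 0%R x -> Rleb 0%R y -> Rleb 0%R (x + y)%R.
Proof. move=> /RlebP h1 /RlebP h2; apply/RlebP; move: h1 h2.
change (Rle (IZR 0) x -> Rle (IZR 0) y -> Rle (IZR 0) (Rplus x y)); lra. Qed.
Lemma R_le0_mul x y : Rleb 0%R x -> Rleb 0%R y -> Rleb 0%R (x * y)%R.
Proof. move=> /RlebP h1 /RlebP h2; apply/RlebP; move: h1 h2.
change (Rle (IZR 0) x -> Rle (IZR 0) y -> Rle (IZR 0) (Rmult x y)); nra. Qed.
Lemma R_le0_anti x : Rleb 0%R x -> Rleb x 0%R -> x = 0%R.
Proof. move=> /RlebP h1 /RlebP h2; move: h1 h2.
change (Rle (IZR 0) x -> Rle x (IZR 0) -> x = IZR 0); lra. Qed.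
Lemma R_sub_ge0 x y : Rleb 0%R (y - x)%R = Rleb x y.
Proof. apply/idP/idP => /RlebP h; apply/RlebP; move: h.
- change (Rle (IZR 0) (Rplus y (Ropp x)) -> Rle x y); lra.
- change (Rle x y -> Rle (IZR 0) (Rplus y (Ropp x))); lra. Qed.
Lemma R_le0_total x : Rleb 0%R x || Rleb x 0%R.
Proof. case: (Rle_dec 0 x) => h; [by rewrite /Rleb; case: Rle_dec|]. 
apply/orP; right; apply/RlebP; change (Rle x (IZR 0)); lra. Qed.
Lemma R_normN x : Rabs (- x)%R = Rabs x. Proof. exact: Rabs_Ropp. Qed.
Lemma R_ge0_norm x : Rleb 0%R x -> Rabs x = x.
Proof. move/RlebP=> h; apply: Rabs_pos_eq; exact: h. Qed.
Lemma R_lt_def x y : Rltb x y = (y != x) && Rleb x y.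
Proof. apply/RltbP/andP. move=> h; split; [apply/eqP => e; subst; lra| apply/RlebP; lra].
case=> /eqP h /RlebP h'. lra. Qed.
HB.instance Definition _ := Num.IntegralDomain_isLeReal.Build R R_le0_add R_le0_mul R_le0_anti R_sub_ge0 R_le0_total R_normN R_ge0_norm R_lt_def.

Local Open Scope ring_scope.

(* [faces n m] : the m-element subsets of the vertex set, i.e. the
   (m-1)-dimensional faces of the complete simplex on n vertices. *)
Notation faces n m := {F : {set 'I_n} | #|F| == m}.

(* Incidence number [F:G]: (-1)^j if G \subset F, |F| = |G|+1 and
   F \ G = {v_j} where F = {v_0 < ... < v_i}; 0 otherwise.
   j = number of elements of F smaller than v. *)
Definition incidence (n : nat) (F G : {set 'I_n}) : R :=
  if (G \subset F) && (#|F| == #|G|.+1)%N then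
    match [pick v in F :\: G] with
    | Some v => (-1) ^+ #|[set u in F | (u < v)%N]|
    | None => 0
    end
  else 0.

(* A realisation of X^k(n,p) is determined by its set S of k-faces
   (S : {set faces n k.+1}); it has the complete (k-1)-skeleton. *)
Definition is_face (n k : nat) (S : {set faces n k.+1}) (F : {set 'I_n}) : Prop :=
  (#|F| <= k)%N \/ exists2 H, H \in S & val H = F.

Definition is_maximal_face (n k : nat) (S : {set faces n k.+1}) (F : {set 'I_n}) : Prop :=
  is_face S F /\ forall G, is_face S G -> F \subset G -> G = F.

Definition pure (n k : nat) (S : {set faces n k.+1}) : Prop :=
  forall F, is_maximal_face S F -> #|F| = k.+1.

Definition deg (n k : nat) (S : {set faces n k.+1}) (F : {set 'I_n}) : nat :=
  #|[set H in S | F \subset val H]|.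

Definition adj_entry (n k : nat) (S : {set faces n k.+1}) (F G : {set 'I_n}) : R :=
  if (#|F :&: G| == k.-1)%N && [exists H in S, val H == F :|: G] then
    incidence F (F :&: G) * incidence G (F :&: G)
  else 0.

Definition Nk (n k : nat) : nat := #|{: faces n k}|.

Definition adjacency_mx (n k : nat) (S : {set faces n k.+1}) : 'M[R]_(Nk n k) :=
  \matrix_(i, j) adj_entry S (val (@enum_val (faces n k) predT i))
                             (val (@enum_val (faces n k) predT j)).

Definition up_laplacian_mx (n k : nat) (S : {set faces n k.+1}) : 'M[R]_(Nk n k) :=
  \matrix_(i, j) ((i == j)%:R -
     ((deg S (val (@enum_val (faces n k) predT i)))%:R)^-1 * adjacency_mx S i j).

Definition eigenvalues_desc (N : nat) (M : 'M[R]_N) (lam : 'I_N -> R) : Prop :=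
  (forall i j : 'I_N, (i <= j)%N -> lam j <= lam i) /\
  char_poly M = \prod_(i < N) ('X - (lam i)%:P).

Definition eigenvalues_asc (N : nat) (M : 'M[R]_N) (lam : 'I_N -> R) : Prop :=
  (forall i j : 'I_N, (i <= j)%N -> lam i <= lam j) /\
  char_poly M = \prod_(i < N) ('X - (lam i)%:P).

Definition property_i (n k : nat) (S : {set faces n k.+1}) (d gA : R) : Prop :=
  exists lam, eigenvalues_desc (adjacency_mx S) lam /\
    forall i : 'I_(Nk n k),
      ((i < 'C(n.-1, k.-1))%N -> d - gA <= lam i <= d + gA) /\
      (~~ (i < 'C(n.-1, k.-1))%N -> - gA <= lam i <= gA).

Definition cohomology_top_vanishes (n k : nat) (S : {set faces n k.+1}) : Prop :=
  forall f : faces n k -> R,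
    (forall H, H \in S -> \sum_(G : faces n k) incidence (val H) (val G) * f G = 0) ->
    exists g : faces n k.-1 -> R,
      forall F : faces n k, f F = \sum_(G : faces n k.-1) incidence (val F) (val G) * g G.

Definition property_ii (n k : nat) (S : {set faces n k.+1}) (gD : R) : Prop :=
  pure S /\
  (exists lam, eigenvalues_asc (up_laplacian_mx S) lam /\
    forall i : 'I_(Nk n k),
      ((i < 'C(n.-1, k.-1))%N -> lam i = 0) /\
      (~~ (i < 'C(n.-1, k.-1))%N -> 1 - gD <= lam i <= 1 + gD)) /\
  cohomology_top_vanishes S.

(* Probability of an event E under the Linial-Meshulam model X^k(n,p):
   each (k+1)-subset is a k-face independently with probability p. *)
Definition LM_prob (n k : nat) (p : R) (E : {set faces n k.+1} -> Prop) : R :=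
  \sum_(S : {set faces n k.+1})
     (if excluded_middle_informative (E S)
      then p ^+ #|S| * (1 - p) ^+ (#|{: faces n k.+1}| - #|S|) else 0).
Arguments LM_prob : clear implicits.

(* Main.v *)
(** Write [A_S] for the adjacency matrix of the random complex, [A_K] for that of
    the complete complex and [M = A_S - p A_K].  Since [A_K + k] is the down
    Laplacian [delta delta^T], which is [n] times the projection onto the
    coboundaries, both statements reduce to [||M|| = O(sqrt d)]: (i) by min-max,
    and (ii) because the up Laplacian [D - A_S] kills coboundaries, so that
    [(D - d) g = M g] for every coboundary [g] and the coboundary part of a
    cochain orthogonal to the coboundaries for the degree-weighted inner product
    is small; the degrees are bounded below by a Chernoff bound.

    Garland's localisation writes the quadratic form of [M] as the sum of those
    of the centered adjacency matrices of the links of the [(k-2)]-faces, which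
    are random graphs.  For such a matrix the expected trace of a power [L] of
    order [p n] is a sum over closed walks using every edge at least twice.
    Grouping walks by the partition of the times they induce, this sum is at most
    [1 / p] times the number of such walks in a complete graph on [2 L] vertices,
    and that number is at most the expected trace of the [L]-th power of a
    [2 L x 2 L] random matrix with independent bounded mean-zero entries whose
    higher moments are at least [1].  The norm of the latter is [O(sqrt L)] by a
    union bound over integer vectors; Markov's inequality concludes.  *)
From HB Require Import structures.
Require Import Defs.
From Stdlib Require Import Reals FunctionalExtensionality ClassicalEpsilon.
From mathcomp Require Import all_boot all_order all_algebra.
From mathcomp Require Import complex zify ring lra.
Set Implicit Arguments. Unset Strict Implicit. Unset Printing Implicit Defensive.
Import Order.TTheory GRing.Theory Num.Theory.
Local Open Scope ring_scope.

(* Stdlib binds [R] and the arguments of [exp] and [ln] to its own scope. *)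
Bind Scope ring_scope with R.
Local Arguments exp x%_ring_scope.
Local Arguments ln x%_ring_scope.

(** * Spectral theory of real symmetric matrices *)

Section Spectral.
Variable F : rcfType.

(** At [p = (k + gamma) log n / n] some degrees may be only a small fraction of [d]. The estimate
    for the up Laplacian is therefore relative to the degrees and takes nothing from them but a
    lower bound [eps * d]. A small [eps] keeps the Chernoff exponent close to [d]; the union bound
    over [n^k] faces is where the term [k] in the hypothesis of (ii) comes from. A power [L] of
    order [p n >= gamma log n] lets a constant factor per step, [exp (- b)], beat the union bound
    over links and the factor [1 / p]; hence [C] depends on [c] and [gamma]. Walks of such length
    are hard to enumerate sharply, and the comparison avoids it: [2 L] vertices leave at least
    [L >= p n] choices for each new vertex of a walk, which pays for the factor [p n] of the sparse
    graph, while a matrix of size [2 L] is controlled by a net of [exp (O(L))] vectors. From the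
    Laplacian entries up to the final statement, [k] is the [k] of the theorem minus one: faces with
    [k.+1] vertices index the matrices. *)

Definition qform n (A : 'M[F]_n) (x : 'rV[F]_n) : F := (x *m A *m x^T) 0 0.
Definition sqnorm n (x : 'rV[F]_n) : F := (x *m x^T) 0 0.

Lemma sqnormE n (x : 'rV[F]_n) : sqnorm x = \sum_i x 0 i ^+ 2.
Proof. by rewrite /sqnorm mxE; apply: eq_bigr => i _; rewrite !mxE expr2. Qed.

Lemma sqnorm_ge0 n (x : 'rV[F]_n) : 0 <= sqnorm x.
Proof. by rewrite sqnormE sumr_ge0 // => i _; rewrite sqr_ge0. Qed.

Lemma sqnorm_eq0 n (x : 'rV[F]_n) : (sqnorm x == 0) = (x == 0).
Proof.
rewrite sqnormE psumr_eq0 => [|i _]; last exact: sqr_ge0.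
apply/allP/eqP => [x0|-> i _]; last by rewrite /= mxE expr0n eqxx.
apply/rowP => i; apply/eqP; rewrite mxE -sqrf_eq0.
by apply: (implyP (x0 i _)); rewrite ?mem_index_enum.
Qed.

Lemma sqnorm_gt0 n (x : 'rV[F]_n) : (0 < sqnorm x) = (x != 0).
Proof. by rewrite lt_def sqnorm_ge0 andbT sqnorm_eq0. Qed.

Lemma qformE n (A : 'M[F]_n) x : qform A x = \sum_i \sum_j x 0 i * A i j * x 0 j.
Proof.
rewrite /qform mxE exchange_big; apply: eq_bigr => j _.
by rewrite !mxE mulr_suml.
Qed.

Lemma qformN n (A : 'M[F]_n) x : qform (- A) x = - qform A x.
Proof. by rewrite /qform mulmxN mulNmx mxE. Qed.

(** A root over the algebraic closure [F[i]] gives a complex eigenvector [vr + i vi]; symmetry makes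
    the eigenvalue real, and then a nonzero one of [vr], [vi] is a real eigenvector. *)
Lemma symmetric_eigenvalue n (A : 'M[F]_n.+1) :
  A^T = A -> exists a, eigenvalue A a.
Proof.
move=> symA; pose B := map_mx (real_complex F) A.
have /closed_rootP [z] : size (char_poly B) != 1%N by rewrite size_char_poly.
rewrite -eigenvalue_root_char => /eigenvalueP [v vB v0].
pose vr := map_mx (@complex.Re F) v; pose vi := map_mx (@complex.Im F) v.
have [a [b zE]] : exists a b, z = Complex a b by case: z {vB} => a b; exists a, b.
have vBi i : \sum_j v 0 j * real_complex F (A j i) = z * v 0 i.
  have := congr1 (fun M : 'rV_n.+1 => M 0 i) vB; rewrite /= !mxE => <-.
  by apply: eq_bigr => j _; rewrite mxE.
have ReA i : (vr *m A) 0 i = a * vr 0 i - b * vi 0 i.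
  transitivity (complex.Re (\sum_j v 0 j * real_complex F (A j i))).
    rewrite mxE raddf_sum; apply: eq_bigr => j _; rewrite !mxE.
    by case: (v 0 j) => s t /=; rewrite mulr0 subr0.
  by rewrite vBi zE !mxE; case: (v 0 i).
have ImA i : (vi *m A) 0 i = a * vi 0 i + b * vr 0 i.
  transitivity (complex.Im (\sum_j v 0 j * real_complex F (A j i))).
    rewrite mxE raddf_sum; apply: eq_bigr => j _; rewrite !mxE.
    by case: (v 0 j) => s t /=; rewrite mulr0 add0r.
  by rewrite vBi zE !mxE; case: (v 0 i).
have ReE : vr *m A = a *: vr - b *: vi by apply/rowP => i; rewrite ReA !mxE.
have ImE : vi *m A = a *: vi + b *: vr by apply/rowP => i; rewrite ImA !mxE.
(* Evaluating [vr A vi^T] from both sides leaves [b (|vr|^2 + |vi|^2) = 0]. *)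
have b0 : b = 0.
  have sw : vr *m A *m vi^T = (vi *m A *m vr^T)^T.
    by rewrite !trmx_mul trmxK symA mulmxA.
  have := congr1 (fun M : 'M_1 => M 0 0) sw.
  rewrite ReE ImE mulmxBl mulmxDl -!scalemxAl !mxE.
  have -> : \sum_j vr 0 j * vi^T j 0 = \sum_j vi 0 j * vr^T j 0.
    by apply: eq_bigr => j _; rewrite !mxE mulrC.
  move=> /addrI E; have {E} : b * (sqnorm vr + sqnorm vi) = 0.
    by rewrite /sqnorm !mxE mulrDr -E addNr.
  move/eqP; rewrite mulf_eq0 => /orP [/eqP //|].
  rewrite paddr_eq0 ?sqnorm_ge0 // !sqnorm_eq0 => /andP[/eqP r0 /eqP i0].
  case/eqP: v0; apply/rowP => i; rewrite mxE.
  have := congr1 (fun M : 'rV_n.+1 => M 0 i) r0.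
  have := congr1 (fun M : 'rV_n.+1 => M 0 i) i0.
  by rewrite !mxE; case: (v 0 i) => s t /= -> ->.
rewrite b0 !scale0r ?subr0 ?addr0 in ReE ImE.
exists a; apply/eigenvalueP.
have [r0|] := eqVneq vr 0; last by exists vr.
exists vi => //; apply: contraNneq v0 => i0; apply/eqP/rowP => i; rewrite mxE.
have := congr1 (fun M : 'rV_n.+1 => M 0 i) r0.
have := congr1 (fun M : 'rV_n.+1 => M 0 i) i0.
by rewrite !mxE; case: (v 0 i) => s t /= -> ->.
Qed.

(* [Q] is the Householder reflection exchanging [e_0] and [v]. *)
Lemma unit_vector_reflection n (v : 'rV[F]_n.+1) : sqnorm v = 1 ->
  exists Q : 'M[F]_n.+1, [/\ Q^T = Q, Q *m Q = 1%:M & delta_mx 0 0 *m Q = v].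
Proof.
move=> v1; pose e : 'rV[F]_n.+1 := delta_mx 0 0.
have e1 : e *m e^T = 1%:M.
  by rewrite trmx_delta mul_delta_mx; apply/matrixP => i j; rewrite !mxE !ord1.
have v1' : v *m v^T = 1%:M.
  by apply/matrixP => i j; rewrite !ord1 [RHS]mxE; exact: v1.
pose w := v - e; have [w0|wn0] := eqVneq w 0.
  exists 1%:M; rewrite trmx1 mulmx1; split=> //.
  by rewrite mulmx1; move/eqP: w0; rewrite subr_eq0 => /eqP.
pose s := sqnorm w; have s0 : s != 0 by rewrite sqnorm_eq0.
have wwT : w *m w^T = s%:M.
  by apply/matrixP => i j; rewrite !ord1 [RHS]mxE.
pose t := (v *m e^T) 0 0.
have vet : v *m e^T = t%:M by apply/matrixP => i j; rewrite !ord1 [RHS]mxE.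
have evt : e *m v^T = t%:M by rewrite -[LHS]trmxK trmx_mul trmxK vet tr_scalar_mx.
have sE : s = 2 - 2 * t.
  have := congr1 (fun M : 'M_1 => M 0 0) wwT.
  rewrite /= /w linearB /= mulmxBr !mulmxBl v1' vet evt e1 !mxE /= !mulr1n => <-.
  ring.
have [W WE] : exists W, W = w^T *m w by exists (w^T *m w).
have WW : W *m W = s *: W.
  by rewrite WE !mulmxA -(mulmxA w^T w) wwT mul_mx_scalar -scalemxAl.
have symW : W^T = W by rewrite WE trmx_mul trmxK.
have eW : e *m W = (t - 1) *: w.
  rewrite WE mulmxA; suff -> : e *m w^T = (t - 1)%:M by rewrite mul_scalar_mx.
  by rewrite /w linearB /= mulmxBr e1 evt -raddfB.
exists (1%:M - (2 / s) *: W); split.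
- by rewrite linearB linearZ /= trmx1 symW.
- rewrite mulmxBl mul1mx mulmxBr mulmx1 -scalemxAl -scalemxAr WW !scalerA.
  by apply/matrixP => i j; rewrite !mxE; field.
- rewrite mulmxBr mulmx1 -scalemxAr -/e eW scalerA.
  have -> : 2 / s * (t - 1) = -1.
    have -> : t - 1 = - (s / 2) by rewrite sE; field.
    by field.
  by rewrite scaleN1r opprK /w addrC subrK.
Qed.

(** Deflation: conjugating by a reflection that carries [e_0] to a unit eigenvector makes the first
    row a multiple of [e_0], symmetry clears the first column, and the induction applies to the
    remaining block. *)
Theorem symmetric_spectral n (A : 'M[F]_n) : A^T = A ->
  exists (P : 'M[F]_n) (D : 'rV[F]_n),
    P *m P^T = 1%:M /\ A = P^T *m diag_mx D *m P.
Proof.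
elim: n A => [|n IHn] A symA.
  by exists 1%:M, 0; split; [|rewrite [LHS]flatmx0]; rewrite ?trmx1 ?mulmx1 ?flatmx0 // [RHS]flatmx0.
have [a /eigenvalueP [v0 v0A v0n0]] := symmetric_eigenvalue symA.
pose v := (Num.sqrt (sqnorm v0))^-1 *: v0.
have v1 : sqnorm v = 1.
  have h : 0 < sqnorm v0 by rewrite sqnorm_gt0.
  rewrite /sqnorm /v linearZ /= -scalemxAl -scalemxAr scalerA mxE -/(sqnorm v0).
  by rewrite -expr2 exprVn sqr_sqrtr ?sqnorm_ge0 // mulVf // gt_eqF.
have vA : v *m A = a *: v by rewrite -scalemxAl v0A !scalerA mulrC.
have [Q [symQ QQ eQ]] := unit_vector_reflection v1.
have [B BD] : exists B : 'M_(1 + n), B = Q *m A *m Q by exists (Q *m A *m Q).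
have symB : B^T = B by rewrite BD !trmx_mul symQ symA mulmxA.
have row0B : row 0 B = a *: delta_mx 0 0.
  by rewrite rowE BD !mulmxA eQ vA -scalemxAl -eQ -mulmxA QQ mulmx1.
pose B' := drsubmx B.
have BE : B = block_mx a%:M 0 0 B'.
  rewrite -[B]submxK; congr block_mx.
  - apply/matrixP => i j; rewrite !mxE !ord1 /=.
    have := congr1 (fun M : 'rV_(1 + n) => M 0 0) row0B.
    by rewrite !mxE eqxx mulr1 => <-; rewrite mulr1n; congr (B _ _); apply/val_inj.
  - apply/matrixP => i j; rewrite !mxE !ord1 /=.
    have := congr1 (fun M : 'rV_(1 + n) => M 0 (rshift 1 j)) row0B.
    rewrite !mxE mulr0 => E; rewrite -[RHS]E; congr (B _ _); exact/val_inj.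
  - apply/matrixP => i j; rewrite -symB !mxE !ord1 /=.
    have := congr1 (fun M : 'rV_(1 + n) => M 0 (rshift 1 i)) row0B.
    rewrite !mxE mulr0 => E; rewrite -[RHS]E; congr (B _ _); exact/val_inj.
have symB' : B'^T = B' by rewrite /B' trmx_drsub symB.
have [P [D [PP B'E]]] := IHn _ symB'.
pose P' : 'M_(1 + n) := block_mx 1%:M 0 0 P.
have PT : P'^T = block_mx 1%:M 0 0 P^T by rewrite /P' tr_block_mx trmx1 !trmx0.
have PPT : P' *m block_mx 1%:M 0 0 P^T = 1%:M.
  rewrite /P' mulmx_block !mulmx0 !mul0mx !mulmx1 PP.
  by rewrite !addr0 add0r -scalar_mx_block.
pose D' : 'rV_(1 + n) := row_mx a%:M D.
exists (P' *m Q), D'; split.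
  rewrite trmx_mul symQ mulmxA -(mulmxA P') QQ mulmx1.
  exact: etrans (congr1 (mulmx P') PT) PPT.
have BE' : B = P'^T *m diag_mx D' *m P'.
  have -> : diag_mx D' = block_mx a%:M 0 0 (diag_mx D).
    rewrite /D' diag_mx_row; congr block_mx.
    by apply/matrixP => i j; rewrite !ord1 !mxE eqxx.
  rewrite PT /P' !mulmx_block !mulmx0 !mul0mx !mulmx1 !mul1mx.
  by rewrite !(addr0, add0r, mul0mx) -B'E.
have -> : A = Q *m B *m Q by rewrite BD !mulmxA QQ mul1mx -mulmxA QQ mulmx1.
by rewrite BE' trmx_mul symQ !mulmxA.
Qed.

(* Intersect [U] with the span of the eigenvectors of eigenvalue [< t]. *)
Lemma courant_fischer_count n m (A P : 'M[F]_n) (D : 'rV[F]_n) (U : 'M[F]_(m, n)) t :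
  P *m P^T = 1%:M -> A = P^T *m diag_mx D *m P ->
  (forall x : 'rV_n, (x <= U)%MS -> t * sqnorm x <= qform A x) ->
  (\rank U <= #|[set i | (t <= D 0 i)%R]|)%N.
Proof.
move=> PP AE Ut; pose J := [set i | D 0 i < t].
pose Z : 'M[F]_(#|J|, n) := \matrix_(i, j) P (enum_val i) j.
have ZP : Z *m P^T = \matrix_(i, j) (enum_val i == j)%:R.
  apply/matrixP => i j; have := congr1 (fun M : 'M_n => M (enum_val i) j) PP.
  by rewrite !mxE => <-; apply: eq_bigr => l _; rewrite !mxE.
have ZZ : Z *m Z^T = 1%:M.
  apply/matrixP => i j; have := congr1 (fun M : 'M_(_, n) => M i (enum_val j)) ZP.
  rewrite !mxE (inj_eq enum_val_inj) => <-.
  by apply: eq_bigr => l _; rewrite !mxE.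
have rZ : \rank Z = #|J|.
  apply/eqP; rewrite eqn_leq rank_leq_row /=.
  by have := mxrankM_maxl Z Z^T; rewrite ZZ mxrank1.
have cJ : #|J| = (n - #|[set i | (t <= D 0 i)%R]|)%N.
  have := cardsC [set i | (t <= D 0 i)%R]; rewrite card_ord.
  have -> : J = ~: [set i | (t <= D 0 i)%R] by apply/setP => i; rewrite !inE ltNge.
  lia.
suff cap0 : \rank (U :&: Z)%MS = 0%N.
  have := mxrank_sum_cap U Z; rewrite cap0 addn0 rZ => E.
  have := rank_leq_col (U + Z)%MS.
  have : (#|[set i | (t <= D 0 i)%R]| <= n)%N by rewrite -[X in (_ <= X)%N]card_ord max_card.
  by move: E cJ; lia.
apply/eqP; rewrite mxrank_eq0; apply/eqP/row_matrixP => i; rewrite row0.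
set x := row i _.
have xU : (x <= U)%MS by rewrite (submx_trans (row_sub _ _)) // capmxSl.
have /submxP [y xE] : (x <= Z)%MS by rewrite (submx_trans (row_sub _ _)) // capmxSr.
apply/eqP; apply: contraT => xn0; have := Ut _ xU.
have nx : sqnorm x = \sum_i y 0 i ^+ 2.
  rewrite -sqnormE /sqnorm xE trmx_mul !mulmxA -(mulmxA y) ZZ mulmx1 //.
have qx : qform A x = \sum_i D 0 (enum_val i) * y 0 i ^+ 2.
  rewrite /qform AE xE trmx_mul.
  have -> : y *m Z *m (P^T *m diag_mx D *m P) *m (Z^T *m y^T) =
            y *m (Z *m P^T *m diag_mx D *m (Z *m P^T)^T) *m y^T.
    by rewrite trmx_mul trmxK !mulmxA.
  have -> : Z *m P^T *m diag_mx D *m (Z *m P^T)^T =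
            diag_mx (\row_i D 0 (enum_val i)).
    rewrite ZP; apply/matrixP => a b; rewrite mul_mx_diag !mxE.
    rewrite (bigD1 (enum_val a)) //= !mxE eqxx mul1r (inj_eq enum_val_inj) eq_sym.
    rewrite big1 ?addr0 ?mulr_natr // => l /negbTE la.
    by rewrite !mxE [_ == l]eq_sym la !mul0r.
  rewrite mul_mx_diag mxE; apply: eq_bigr => j _; rewrite !mxE; ring.
rewrite nx qx mulr_sumr leNgt; case/negP.
rewrite -subr_gt0 -sumrB.
have yn0 : exists j, y 0 j != 0.
  apply/existsP; apply: contraNT xn0; rewrite negb_exists => /forallP y0.
  rewrite xE; suff -> : y = 0 by rewrite mul0mx.
  by apply/rowP => j; rewrite mxE; apply/eqP; have := y0 j; rewrite negbK.
have [j yj] := yn0.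
have DJ l : D 0 (@enum_val _ (mem J) l) < t by have := enum_valP l; rewrite inE.
rewrite (bigD1 j) //= ltr_wpDr //.
  apply: sumr_ge0 => l _; rewrite -mulrBl mulr_ge0 ?sqr_ge0 // subr_ge0 ltW //.
by rewrite -mulrBl mulr_gt0 ?subr_gt0 // lt_def sqr_ge0 sqrf_eq0 yj.
Qed.

Lemma char_poly_conj n (A P Q : 'M[F]_n) :
  Q *m P = 1%:M -> char_poly (Q *m A *m P) = char_poly A.
Proof.
move=> QP; rewrite /char_poly /char_poly_mx !map_mxM.
set P' := map_mx _ P; set Q' := map_mx _ Q.
have Q'P' : Q' *m P' = 1%:M by rewrite -map_mxM QP map_mx1.
rewrite -{1}[X in X - _]mulmx1 -{1}Q'P' mulmxA -scalar_mxC -mulmxBl -mulmxBr.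
by rewrite !det_mulmx mulrAC -det_mulmx Q'P' det1 mul1r.
Qed.

Lemma char_poly_diagonalized n (A P : 'M[F]_n) (D : 'rV[F]_n) :
  P *m P^T = 1%:M -> A = P^T *m diag_mx D *m P ->
  char_poly A = \prod_i ('X - (D 0 i)%:P).
Proof.
move=> PP ->; rewrite char_poly_conj ?(mulmx1C PP) // /char_poly det_trig; last first.
  apply/is_trig_mxP => i j ij; rewrite !mxE.
  by rewrite (_ : i == j = false) ?mulr0n ?subr0 //; apply/eqP => E; rewrite E ltnn in ij.
by apply: eq_bigr => i _; rewrite !mxE eqxx !mulr1n.
Qed.

(** By the counting lemma [U] forces at least [b] eigenvalues to be [>= t1] and, through [- A], [V]
    forces at least [n - b] to be [<= t2]; sorting turns these counts into positions. *)
Theorem split_spectrum n m1 m2 b (A : 'M[F]_n) (U : 'M[F]_(m1, n)) (V : 'M[F]_(m2, n))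
    (lo t1 t2 hi : F) : A^T = A ->
  (b <= \rank U)%N -> (n - b <= \rank V)%N ->
  (forall x : 'rV_n, (x <= U)%MS -> t1 * sqnorm x <= qform A x) ->
  (forall x : 'rV_n, (x <= V)%MS -> qform A x <= t2 * sqnorm x) ->
  (forall x : 'rV_n, lo * sqnorm x <= qform A x <= hi * sqnorm x) ->
  exists lam : 'I_n -> F,
    [/\ forall i j : 'I_n, (i <= j)%N -> lam j <= lam i,
        char_poly A = \prod_(i < n) ('X - (lam i)%:P)
      & forall i : 'I_n, ((i < b)%N -> t1 <= lam i <= hi) /\
                         (~~ (i < b)%N -> lo <= lam i <= t2)].
Proof.
move=> symA bU bV Ut Vt lohi.
have [P [D [PP AE]]] := symmetric_spectral symA.
have cntU := leq_trans bU (courant_fischer_count PP AE Ut).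
have cntV : (n - b <= #|[set i | (D 0 i <= t2)%R]|)%N.
  apply: leq_trans bV _.
  have AEN : - A = P^T *m diag_mx (- D) *m P by rewrite AE linearN /= mulmxN mulNmx.
  have := @courant_fischer_count _ _ (- A) P (- D) V (- t2) PP AEN.
  move=> /(_ _)/leq_trans; apply; first by move=> x /Vt; rewrite qformN mulNr lerN2.
  by apply: subset_leq_card; apply/subsetP => i; rewrite !inE !mxE lerN2.
have Drange i : lo <= D 0 i <= hi.
  have /= := lohi (row i P).
  have -> : sqnorm (row i P) = 1.
    transitivity ((P *m P^T) i i); last by rewrite PP mxE eqxx.
    by rewrite /sqnorm !mxE; apply: eq_bigr => j _; rewrite !mxE.
  have -> : qform A (row i P) = D 0 i.
    rewrite /qform rowE AE trmx_mul !mulmxA -2!(mulmxA _ P P^T) PP !mulmx1.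
    rewrite trmx_delta -rowE -colE !mxE eqxx mulr1n //.
  by rewrite !mulr1.
pose s := sort (fun x y : F => y <= x) [seq D 0 i | i <- enum 'I_n].
have ss : sorted (fun x y : F => y <= x) s by apply: sort_sorted => x y; exact: le_total.
have pss : perm_eq s [seq D 0 i | i <- enum 'I_n] by rewrite perm_sort.
have szs : size s = n by rewrite (perm_size pss) size_map size_enum_ord.
have cnt (Q : pred F) : count Q s = #|[set i | Q (D 0 i)]|.
  rewrite (permP pss) count_map cardE /enum_mem size_filter.
  by rewrite count_filter; apply: eq_count => i /=; rewrite !inE ?andbT.
have mono (i j : 'I_n) : (i <= j)%N -> s`_j <= s`_i.
  move=> ij; apply: (sorted_leq_nth (leT := fun x y : F => y <= x)) => //.
  - by move=> x y z yx xz; exact: le_trans xz yx.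
  - by rewrite inE szs.
  - by rewrite inE szs.
have inD i : (i < n)%N -> exists j, s`_i = D 0 j.
  move=> lin; have : s`_i \in s by rewrite mem_nth ?szs.
  by rewrite (perm_mem pss) => /mapP [j _ ->]; exists j.
exists (fun i => s`_i); split=> //.
  rewrite (char_poly_diagonalized PP AE) -big_enum /= -(big_map (D 0) xpredT (fun x => 'X - x%:P)).
  have -> : \prod_(i < n) ('X - (s`_i)%:P) = \prod_(x <- s) ('X - x%:P).
    by rewrite (big_nth 0) szs big_mkord.
  by apply: perm_big; rewrite perm_sym.
move=> i; have [j sij] := inD _ (ltn_ord i); split => hi_b.
  (* A value below [t1] at place [i] of the decreasing list leaves at most [i] values [>= t1]. *)
  rewrite andbC sij; have /andP[_ ->] /= := Drange j; rewrite -sij leNgt; apply/negP => lt1.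
  have : (count (fun x => (t1 <= x)%R) s <= i)%N.
    rewrite -(cat_take_drop i s) count_cat.
    have -> : count (fun x => t1 <= x) (drop i s) = 0%N.
      apply/eqP; rewrite -leqn0 leqNgt -has_count; apply/negP => /(has_nthP 0) [l].
      rewrite size_drop szs nth_drop => ll; apply/negP; rewrite -ltNge.
      have iln : (i + l < n)%N by move: ll (ltn_ord i); lia.
      by apply: le_lt_trans lt1; apply: (mono i (Ordinal iln)); rewrite /= leq_addr.
    by rewrite addn0 (leq_trans (count_size _ _)) // size_take_min geq_minl.
  by rewrite cnt; move: cntU; lia.
rewrite sij; have /andP[-> _] /= := Drange j; rewrite -sij leNgt; apply/negP => lt2.
have : (count (fun x => (x <= t2)%R) s <= n - i.+1)%N.
  rewrite -(cat_take_drop i.+1 s) count_cat.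
  have -> : count (fun x => x <= t2) (take i.+1 s) = 0%N.
    apply/eqP; rewrite -leqn0 leqNgt -has_count; apply/negP => /(has_nthP 0) [l].
    rewrite size_take_min szs => ll; rewrite nth_take; last by move: ll; lia.
    apply/negP; rewrite -ltNge.
    have ln : (l < n)%N by move: ll; lia.
    by apply: lt_le_trans lt2 _; apply: (mono (Ordinal ln) i) => /=; move: ll; lia.
  by rewrite add0n (leq_trans (count_size _ _)) // size_drop szs.
by rewrite cnt; move: cntV hi_b (ltn_ord i); lia.
Qed.

Lemma trace_pow_diagonalized n L (A P : 'M[F]_n) (D : 'rV[F]_n) :
  P *m P^T = 1%:M -> A = P^T *m diag_mx D *m P ->
  \tr (A ^+ L) = \sum_i D 0 i ^+ L.
Proof.
move=> PP AE.
have AL : A ^+ L = P^T *m diag_mx (\row_i D 0 i ^+ L) *m P.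
  elim: L => [|L IH].
    rewrite expr0; have -> : diag_mx (\row_i D 0 i ^+ 0) = 1%:M.
      by apply/matrixP => i j; rewrite !mxE expr0.
    by rewrite mulmx1 (mulmx1C PP).
  rewrite exprS IH -[_ * _]/(_ *m _) AE !mulmxA -(mulmxA _ P P^T) PP mulmx1.
  rewrite -(mulmxA P^T) mulmx_diag; congr (_ *m diag_mx _ *m _).
  by apply/rowP => i; rewrite !mxE exprS.
by rewrite AL mxtrace_mulC mulmxA PP mul1mx mxtrace_diag; apply: eq_bigr => i _; rewrite mxE.
Qed.

Lemma qform_diagonalized n (A P : 'M[F]_n) (D : 'rV[F]_n) x :
  A = P^T *m diag_mx D *m P ->
  qform A x = \sum_i D 0 i * (x *m P^T) 0 i ^+ 2.
Proof.
move=> AE; rewrite /qform AE.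
have -> : x *m (P^T *m diag_mx D *m P) *m x^T = (x *m P^T) *m diag_mx D *m (x *m P^T)^T.
  by rewrite trmx_mul trmxK !mulmxA.
rewrite mul_mx_diag mxE; apply: eq_bigr => i _.
by rewrite [X in X * _ = _]mxE [X in _ * X = _]mxE; ring.
Qed.

Lemma sqnorm_orthogonal n (P : 'M[F]_n) (x : 'rV[F]_n) :
  P *m P^T = 1%:M -> sqnorm (x *m P^T) = sqnorm x.
Proof.
move=> PP; rewrite /sqnorm trmx_mul trmxK mulmxA -(mulmxA x) (mulmx1C PP).
by rewrite mulmx1.
Qed.

(** For even [L] the trace is a sum of nonnegative powers, so it dominates the [L]-th power of each
    eigenvalue. *)
Lemma qform_le_trace_pow n L (A : 'M[F]_n) (th : F) x :
  A^T = A -> ~~ odd L -> (0 < L)%N -> 0 <= th -> \tr (A ^+ L) <= th ^+ L ->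
  `|qform A x| <= th * sqnorm x.
Proof.
move=> symA evL L0 th0 trA; have [P [D [PP AE]]] := symmetric_spectral symA.
have Dth i : `|D 0 i| <= th.
  rewrite -(@ler_pXn2r _ L) ?nnegrE //; apply: le_trans trA.
  rewrite (trace_pow_diagonalized L PP AE) (bigD1 i) //= -normrX ger0_norm ?exprn_even_ge0 //.
  by rewrite lerDl sumr_ge0 // => j _; exact: exprn_even_ge0.
rewrite (qform_diagonalized x AE) -(sqnorm_orthogonal x PP) sqnormE mulr_sumr.
apply: le_trans (ler_norm_sum _ _ _) _; apply: ler_sum => i _.
by rewrite normrM [X in _ * X]ger0_norm ?sqr_ge0 // ler_wpM2r ?sqr_ge0.
Qed.

(** The converse estimate, taken at unit eigenvectors. Here [B] bounds the power of the form itself: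
    it will be a sum of exponentials over a net. *)
Lemma trace_pow_le n L (A : 'M[F]_n) (B : F) :
  A^T = A -> ~~ odd L ->
  (forall x, sqnorm x = 1 -> `|qform A x| ^+ L <= B) -> \tr (A ^+ L) <= n%:R * B.
Proof.
move=> symA evL bnd; have [P [D [PP AE]]] := symmetric_spectral symA.
rewrite (trace_pow_diagonalized L PP AE) -[n in n%:R]card_ord mulr_natl -sumr_const.
apply: ler_sum => i _; have PT : P^T *m P = 1%:M := mulmx1C PP.
have e1 : sqnorm (delta_mx 0 i *m P) = 1.
  rewrite -(sqnorm_orthogonal _ PP) -mulmxA PP mulmx1 sqnormE (bigD1 i) //= big1 => [|j /negbTE ji].
    by rewrite mxE !eqxx expr1n addr0.
  by rewrite mxE ji andbF expr0n.
have := bnd _ e1; rewrite (qform_diagonalized _ AE) -mulmxA PP mulmx1.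
rewrite (bigD1 i) //= big1 => [|j /negbTE ji]; last by rewrite mxE ji andbF expr0n mulr0.
by rewrite mxE !eqxx expr1n mulr1 addr0 -normrX ger0_norm ?exprn_even_ge0.
Qed.

End Spectral.

(** * Random subsets *)

Section RandomSubset.
Variables (K : realFieldType) (E : finType) (p : K).
Implicit Types (S : {set E}) (f g : {set E} -> K).

Definition weight S : K := \prod_(e : E) (if e \in S then p else 1 - p).
Definition expect f : K := \sum_(S : {set E}) weight S * f S.

(** The product form expresses independence; this form is the one in [LM_prob]. *)
Lemma weightE S : weight S = p ^+ #|S| * (1 - p) ^+ (#|E| - #|S|).
Proof.
rewrite /weight (bigID (mem S)) /=; congr (_ * _).
  by rewrite (eq_bigr (fun=> p)) => [|e ->] //; rewrite prodr_const.
rewrite (eq_bigr (fun=> 1 - p)) => [|e /negbTE ->] //; rewrite prodr_const.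
congr (_ ^+ _); have -> : (#|E| - #|S|)%N = #|~: S| by have := cardsC S; lia.
by apply: eq_card => e; rewrite !inE.
Qed.

(** Independence: expanding the right-hand product yields one term per subset. *)
Lemma expect_prod (g : E -> bool -> K) :
  expect (fun S => \prod_e g e (e \in S)) = \prod_e (p * g e true + (1 - p) * g e false).
Proof.
rewrite bigA_distr; apply: eq_big => [S|S _]; first by rewrite inE.
by rewrite /weight -big_split; apply: eq_bigr => e _ /=; case: (e \in S).
Qed.

Lemma eq_expect f g : f =1 g -> expect f = expect g.
Proof. by move=> fg; apply: eq_bigr => S _; rewrite fg. Qed.

Lemma expect1 : expect (fun=> 1) = 1.
Proof.
have := expect_prod (fun _ _ => 1); rewrite (eq_expect (g := fun=> 1)) => [->|S].
  by rewrite big1 // => e _; rewrite !mulr1 addrC subrK.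
by rewrite big1.
Qed.

Lemma expectZ c f : expect (fun S => c * f S) = c * expect f.
Proof. by rewrite /expect mulr_sumr; apply: eq_bigr => S _; rewrite mulrCA. Qed.

Lemma expectD f g : expect (fun S => f S + g S) = expect f + expect g.
Proof. by rewrite /expect -big_split; apply: eq_bigr => S _; rewrite mulrDr. Qed.

Lemma expect_sum (I : Type) (r : seq I) (P : pred I) (f : I -> {set E} -> K) :
  expect (fun S => \sum_(i <- r | P i) f i S) = \sum_(i <- r | P i) expect (f i).
Proof.
by rewrite /expect exchange_big; apply: eq_bigr => S _; rewrite mulr_sumr.
Qed.

Hypothesis p01 : 0 <= p <= 1.

Lemma weight_ge0 S : 0 <= weight S.
Proof.
have /andP[p0 p1] := p01; apply: prodr_ge0 => e _.
by case: ifP => // _; rewrite subr_ge0.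
Qed.

Lemma ler_expect f g : (forall S, f S <= g S) -> expect f <= expect g.
Proof. by move=> fg; apply: ler_sum => S _; rewrite ler_wpM2l ?weight_ge0. Qed.

Definition prob (P : pred {set E}) : K := expect (fun S => (P S)%:R).

Lemma probC P : prob P = 1 - prob (predC P).
Proof.
rewrite -[X in X - _]expect1 -[X in _ = _ - X]mul1r -mulNr -expectZ -expectD.
by apply: eq_expect => S /=; case: (P S); rewrite ?mulr0 ?mulr1 ?addr0 ?subrr.
Qed.

Lemma ler_prob (P Q : pred {set E}) : (forall S, P S -> Q S) -> prob P <= prob Q.
Proof. by move=> PQ; apply: ler_expect => S; rewrite ler_nat; have := PQ S; case: (P S) => // ->. Qed.

Lemma prob_exists (I : finType) (P : I -> pred {set E}) :
  prob (fun S => [exists i, P i S]) <= \sum_i prob (P i).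
Proof.
rewrite -expect_sum; apply: ler_expect => S.
case: existsP => [[i Pi]|_]; last by apply: sumr_ge0 => i _; rewrite ler0n.
by rewrite (bigD1 i) //= Pi lerDl sumr_ge0 // => j _; rewrite ler0n.
Qed.

Lemma prob_or (P Q : pred {set E}) : prob (fun S => P S || Q S) <= prob P + prob Q.
Proof.
rewrite -expectD; apply: ler_expect => S.
by case: (P S); case: (Q S); rewrite /= ?addr0 ?add0r // lerDl ler01.
Qed.

Lemma prob_markov (f : {set E} -> K) a : (forall S, 0 <= f S) -> 0 < a ->
  prob (fun S => a <= f S) <= expect f / a.
Proof.
move=> f0 a0; rewrite ler_pdivlMr // mulrC -expectZ; apply: ler_expect => S.
by case: (boolP (a <= f S)) => h; rewrite ?mulr1 ?mulr0.
Qed.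

End RandomSubset.

(** * Closed walks and traces *)

Section TraceWalks.
Variables (K : comPzRingType) (n : nat).
Implicit Types (M : 'M[K]_n).

Lemma sum_tuple_cons (T : finType) (G : nmodType) L (f : L.+1.-tuple T -> G) :
  \sum_t f t = \sum_x \sum_(t : L.-tuple T) f [tuple of x :: t].
Proof.
rewrite pair_big /=.
rewrite (reindex (fun q : T * L.-tuple T => [tuple of q.1 :: q.2])) //=.
exists (fun t : L.+1.-tuple T => (thead t, [tuple of behead t])) => [[x t] _|t _] /=.
  by congr (_, _); apply: val_inj.
by rewrite -tuple_eta.
Qed.

Fixpoint path_weight M (x : 'I_n) (s : seq 'I_n) (y : 'I_n) : K :=
  if s is z :: s' then M x z * path_weight M z s' y else M x y.

Lemma mulmx_pow_paths M L i j :
  (M ^+ L.+1) i j = \sum_(t : L.-tuple 'I_n) path_weight M i t j.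
Proof.
elim: L i => [|L IH] i.
  rewrite expr1 (big_pred1 [tuple]) //= => t; apply/esym/eqP.
  by apply: val_inj; rewrite (tuple0 t).
rewrite exprS -[_ * _]/(_ *m _) mxE sum_tuple_cons; apply: eq_bigr => x _.
by rewrite IH mulr_sumr.
Qed.

Lemma path_weight_prod M x s y :
  path_weight M x s y =
  \prod_(k < (size s).+1) M (nth x (x :: s) k) (nth y (rcons s y) k).
Proof.
elim: s x => [|z s IH] x /=; first by rewrite big_ord1.
rewrite big_ord_recl /= IH; congr (_ * _); apply: eq_bigr => k _ /=.
congr (M _ _); apply: set_nth_default => /=; exact: ltn_ord.
Qed.

Lemma trace_pow_walks M L :
  \tr (M ^+ L.+1) =
  \sum_(t : L.+1.-tuple 'I_n) \prod_(k < L.+1) M (tnth t k) (tnth t (ordS k)).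
Proof.
rewrite /mxtrace sum_tuple_cons; apply: eq_bigr => x _.
rewrite mulmx_pow_paths; apply: eq_bigr => t _.
rewrite path_weight_prod size_tuple; apply: eq_bigr => k _.
rewrite !(tnth_nth x) /=; congr (M _ _).
rewrite nth_rcons size_tuple; case: ltngtP => kL.
- by rewrite modn_small ?ltnS.
- by have := ltn_ord k; rewrite ltnS leqNgt kL.
- by rewrite kL modnn.
Qed.

End TraceWalks.

Lemma eq_set2 (T : finType) (a b c d : T) :
  ([set a; b] == [set c; d]) = (a == c) && (b == d) || (a == d) && (b == c).
Proof.
apply/eqP/orP => [E|[/andP[/eqP -> /eqP ->]|/andP[/eqP -> /eqP ->]]] //; last by rewrite setUC.
have Ha : (a == c) || (a == d) by have := set21 a b; rewrite E !inE.
have Hb : (b == c) || (b == d) by have := set22 a b; rewrite E !inE.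
have Hc : (c == a) || (c == b) by have := set21 c d; rewrite -E !inE.
have Hd : (d == a) || (d == b) by have := set22 c d; rewrite -E !inE.
have [ac|ac] := eqVneq a c.
  case/orP: Hb => [bc|->]; last by left.
  right; rewrite bc andbT; move: Hd; rewrite (eqP bc) -ac orbb eq_sym => ->; by [].
right; move: Ha Hc; rewrite (negbTE ac) [c == a]eq_sym (negbTE ac) /= => -> cb.
by rewrite eq_sym cb.
Qed.

(** * Closed walks up to relabelling of their vertices *)

Section Walks.
Variable L : nat.

Section Def.
Variable V : finType.
Implicit Types (u : L.-tuple V).

Definition walk_edge u (t : 'I_L) : {set V} := [set tnth u t; tnth u (ordS t)].
Definition edge_mult u (e : {set V}) : nat := #|[set t | walk_edge u t == e]|.
(** The walks that survive in the expected trace of a matrix with zero diagonal and centered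
    entries: an edge used once contributes a vanishing first moment. *)
Definition good_walk u : bool :=
  [forall t, (tnth u t != tnth u (ordS t)) && (1 < edge_mult u (walk_edge u t))%N].
Definition walk_verts u : {set V} := [set tnth u t | t : 'I_L].
Definition walk_edges u : {set {set V}} := [set walk_edge u t | t : 'I_L].

Lemma index_tnth_lt u t : (index (tnth u t) u < L)%N.
Proof. by rewrite -[X in (_ < X)%N](size_tuple u) index_mem mem_tnth. Qed.

(* The kernel of a walk, encoded by sending each time to the first time at which
   the same vertex is visited. *)
Definition walk_kernel u : L.-tuple 'I_L := [tuple Ordinal (index_tnth_lt u t) | t < L].

Lemma tnth_kernel u t : tnth u (tnth (walk_kernel u) t) = tnth u t.
Proof.
by rewrite tnth_mktuple (tnth_nth (tnth u t)) /= nth_index // mem_tnth.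
Qed.

Lemma kernel_eq u s t :
  (tnth (walk_kernel u) s == tnth (walk_kernel u) t) = (tnth u s == tnth u t).
Proof.
apply/eqP/eqP => [E|E]; first by rewrite -tnth_kernel E tnth_kernel.
by apply: val_inj; rewrite !tnth_mktuple /= E.
Qed.

End Def.

Section SameKernel.
Variables (V W : finType) (u : L.-tuple V) (w : L.-tuple W).
Hypothesis uw : forall s t, (tnth u s == tnth u t) = (tnth w s == tnth w t).

Lemma walk_edge_eq s t : (walk_edge u s == walk_edge u t) = (walk_edge w s == walk_edge w t).
Proof. by rewrite /walk_edge !eq_set2 !uw. Qed.

Lemma good_walk_eq : good_walk u = good_walk w.
Proof.
apply: eq_forallb => t; rewrite uw; congr (_ && (1 < _)%N).
by apply: eq_card => s; rewrite !inE walk_edge_eq.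
Qed.

Lemma walk_kernel_eq : walk_kernel u = walk_kernel w.
Proof.
apply: eq_from_tnth => t; rewrite !tnth_mktuple; apply: val_inj => /=.
have idx (X : finType) (x : L.-tuple X) :
    index (tnth x t) x = find (fun s => tnth x s == tnth x t) (enum 'I_L).
  rewrite /index -{1}(map_tnth_enum x) find_map.
  by apply: eq_find => s /=; rewrite ?inE.
by rewrite !idx; apply: eq_find => s; exact: uw.
Qed.

End SameKernel.

Lemma good_walk_kernel (V : finType) (u : L.-tuple V) : good_walk (walk_kernel u) = good_walk u.
Proof. by apply: good_walk_eq => s t; exact: kernel_eq. Qed.

Lemma walk_kernelK (V : finType) (u : L.-tuple V) : walk_kernel (walk_kernel u) = walk_kernel u.
Proof. by apply: walk_kernel_eq => s t; exact: kernel_eq. Qed.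

Lemma card_verts_kernel (V : finType) (u : L.-tuple V) :
  #|walk_verts (walk_kernel u)| = #|walk_verts u|.
Proof.
have -> : walk_verts u = tnth u @: walk_verts (walk_kernel u).
  rewrite /walk_verts -imset_comp; apply: eq_imset => t /=.
  by rewrite tnth_kernel.
rewrite card_in_imset // => _ _ /imsetP[s _ ->] /imsetP[t _ ->].
by rewrite !tnth_kernel => E; apply/eqP; rewrite kernel_eq E.
Qed.

(** When [x] is a kernel, [walk_verts x] is the set of first-visit times, and a walk with kernel [x]
    is determined by its values there. *)
Lemma card_same_kernel_le (V : finType) (x : L.-tuple 'I_L) :
  (#|[set u : L.-tuple V | walk_kernel u == x]| <= #|V| ^ #|walk_verts x|)%N.
Proof.
pose A := {t : 'I_L | t \in walk_verts x}.
pose r (u : L.-tuple V) : {ffun A -> V} := [ffun t => tnth u (val t)].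
have -> : (#|V| ^ #|walk_verts x|)%N = #|{ffun A -> V}|.
  by rewrite card_ffun card_sig; congr (_ ^ _)%N; apply: eq_card.
rewrite -(@card_in_imset _ _ r); first exact: max_card.
move=> u v; rewrite !inE => /eqP ux /eqP vx E; apply: eq_from_tnth => t.
have xA : tnth x t \in walk_verts x by apply: imset_f.
have := congr1 (fun f : {ffun A -> V} => f (Sub (tnth x t) xA)) E.
by rewrite !ffunE /= -{1}ux -vx !tnth_kernel.
Qed.

Lemma ffact_ge r m : (m <= L)%N -> (L <= r)%N -> ((r - L) ^ m <= r ^_ m)%N.
Proof.
elim: m => [|m IH] mL Lr; first by rewrite expn0 ffactn0.
rewrite expnSr ffactnSr leq_mul ?IH ?(ltnW mL) //; lia.
Qed.

(** Injective assignments of vertices to the first-visit times give distinct walks with kernel [x];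
    their number is a falling factorial with at most [L] factors. *)
Lemma card_same_kernel_ge (W : finType) (x : L.-tuple 'I_L) :
  walk_kernel x = x -> (L <= #|W|)%N ->
  ((#|W| - L) ^ #|walk_verts x| <= #|[set w : L.-tuple W | walk_kernel w == x]|)%N.
Proof.
move=> xx LW; apply: leq_trans (ffact_ge _ LW) _.
  by rewrite -[X in (_ <= X)%N]card_ord max_card.
pose A := {t : 'I_L | t \in walk_verts x}.
have xA t : tnth x t \in walk_verts x by apply: imset_f.
have cA : #|walk_verts x| = #|{: A}| by rewrite card_sig; apply: eq_card.
rewrite cA -card_inj_ffuns.
pose r (g : {ffun A -> W}) : L.-tuple W := [tuple g (Sub (tnth x t) (xA t)) | t < L].
rewrite -(@card_in_imset _ _ r).
  apply: subset_leq_card; apply/subsetP => w0 /imsetP[g gi ->].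
  move: gi; rewrite !inE => /injectiveP gi; apply/eqP; rewrite -[RHS]xx; apply: walk_kernel_eq => s t.
  by rewrite !tnth_mktuple (inj_eq gi) -val_eqE.
move=> g h _ _ E; apply/ffunP => -[a aA].
case/imsetP: (aA) => t _ at_; have := congr1 (fun w => tnth w t) E.
rewrite !tnth_mktuple; congr (_ = _); congr (_ _); apply: val_inj => /=; by rewrite at_.
Qed.

(* Walks are grouped by kernel; a kernel with [m] vertices is realised by at most
   [#|V| ^ m] walks in [V], and by at least [(#|W| - L) ^ m] walks in [W]. *)
Lemma sum_good_walks_le (K : realFieldType) (V W : finType) (p : K) :
  0 <= p -> (L <= #|W|)%N -> p * #|V|%:R <= (#|W| - L)%:R ->
  \sum_(u : L.-tuple V) (good_walk u)%:R * p ^+ #|walk_verts u| <=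
  \sum_(w : L.-tuple W) (good_walk w)%:R.
Proof.
move=> p0 LW pV.
rewrite (partition_big (@walk_kernel V) xpredT) //= [leRHS](partition_big (@walk_kernel W) xpredT) //=.
apply: ler_sum => x _.
have [/eqP xx|xx] := boolP (walk_kernel x == x); last first.
  rewrite !big_pred0 // => u; apply/eqP => ux; case/eqP: xx; by rewrite -ux walk_kernelK.
have -> : \sum_(u : L.-tuple V | walk_kernel u == x) (good_walk u)%:R * p ^+ #|walk_verts u| =
   (good_walk x)%:R * (p ^+ #|walk_verts x| * #|[set u : L.-tuple V | walk_kernel u == x]|%:R).
  rewrite mulrA mulr_natr -sumr_const.
  rewrite [RHS](eq_bigl (fun u => walk_kernel u == x)) => [|u]; last by rewrite inE.
  by apply: eq_bigr => u /eqP ux; rewrite -ux good_walk_kernel card_verts_kernel.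
have -> : \sum_(w : L.-tuple W | walk_kernel w == x) (good_walk w)%:R =
   (good_walk x)%:R * #|[set w : L.-tuple W | walk_kernel w == x]|%:R :> K.
  rewrite mulr_natr -sumr_const.
  rewrite [RHS](eq_bigl (fun u => walk_kernel u == x)) => [|u]; last by rewrite inE.
  by apply: eq_bigr => u /eqP ux; rewrite -ux good_walk_kernel.
rewrite ler_wpM2l ?ler0n //.
apply: (@le_trans _ _ ((#|W| - L) ^ #|walk_verts x|)%:R); last first.
  by rewrite ler_nat card_same_kernel_ge.
apply: (@le_trans _ _ (p ^+ #|walk_verts x| * (#|V| ^ #|walk_verts x|)%:R)).
  by rewrite ler_wpM2l ?exprn_ge0 // ler_nat card_same_kernel_le.
rewrite !natrX -exprMn; apply: lerXn2r; rewrite ?nnegrE ?mulr_ge0 ?ler0n //.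
Qed.

End Walks.

(** Induction from the front: if [x] does not recur later, the edge joining it to the next vertex
    does not recur either. *)
Lemma card_verts_le (T : finType) (x : T) (s : seq T) :
  (#|[set y in x :: s]| <= #|[set:: pairmap (fun a b => [set a; b]) x s]|.+1)%N.
Proof.
elim: s x => [|y s IH] x /=.
  by rewrite (_ : [set y in [:: x]] = [set x]) ?cards1 //; apply/setP => y; rewrite !inE.
set E := pairmap _ _ _.
have -> : [set z in [:: x, y & s]] = x |: [set z in y :: s] by apply/setP => z; rewrite !inE.
have -> : [set:: [set x; y] :: E] = [set x; y] |: [set:: E] by apply/setP => z; rewrite !inE.
rewrite !cardsU1; case: (boolP (x \in _)) => xs /=.
  by rewrite add0n (leq_trans (IH y)) // ltnS leq_addl.
suff -> : [set x; y] \notin [set:: E] by rewrite !add1n ltnS IH.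
rewrite inE; apply: contraNN xs => /(nthP set0) [j]; rewrite size_pairmap => si.
rewrite (nth_pairmap y) // => E'; have := set21 x y; rewrite -E' !inE.
case/orP => /eqP ->.
  by rewrite -in_cons mem_nth //= ltnS ltnW.
by rewrite orbC mem_nth.
Qed.

Lemma card_walk_verts_le (V : finType) L (u : L.+1.-tuple V) :
  (#|walk_verts u| <= #|walk_edges u|.+1)%N.
Proof.
case: (tupleP u) => x s.
apply: leq_trans (leq_trans (card_verts_le x s) _).
  apply: subset_leq_card; apply/subsetP => _ /imsetP[t _ ->].
  by rewrite inE mem_tnth.
rewrite ltnS; apply: subset_leq_card; apply/subsetP => e; rewrite inE => /(nthP set0) [j].
rewrite size_pairmap size_tuple => si; rewrite (nth_pairmap x) ?size_tuple // => <-.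
have jL : (j < L.+1)%N by rewrite ltnW ?ltnS.
apply/imsetP; exists (Ordinal jL) => //; rewrite /walk_edge !(tnth_nth x) /=.
by rewrite modn_small ?ltnS.
Qed.

(** Both images are in bijection with the set [D] of representatives of least rank of the common
    fibres. *)
Lemma card_imset_fibres (T A B : finType) (f : T -> A) (g : T -> B) :
  (forall s t, (f s == f t) = (g s == g t)) ->
  #|[set f t | t : T]| = #|[set g t | t : T]|.
Proof.
move=> fg; pose D := [set t | [forall s, (f s == f t) ==> (enum_rank t <= enum_rank s)%N]].
have fib (C : finType) (h : T -> C) : (forall s t, (f s == f t) = (h s == h t)) ->
    #|[set h t | t : T]| = #|D|.
  move=> fh; have -> : [set h t | t : T] = h @: D.
    apply/setP => c; apply/imsetP/imsetP => [[t _ ->]|[t _ ->]]; last by exists t.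
    have [s /eqP fs min] := @arg_minnP _ t (fun s => f s == f t) (fun s => enum_rank s) (eqxx _).
    exists s; last by apply/eqP; rewrite -fh fs.
    rewrite inE; apply/forallP => r; apply/implyP => /eqP fr; apply: min; by rewrite fr fs.
  rewrite card_in_imset // => s t; rewrite !inE => /forallP Ds /forallP Dt /eqP.
  rewrite -fh => fst; apply: enum_rank_inj; apply: val_inj; apply/eqP; rewrite eqn_leq.
  by rewrite (implyP (Ds t)) 1?eq_sym // (implyP (Dt s)).
by rewrite (fib _ f) // (fib _ g).
Qed.

(** * Expected traces of matrices with independent entries *)

Section CenteredMatrix.
Variables (K : realFieldType) (n : nat) (E : finType) (p : K) (h : bool -> K).
Variables (ed : 'I_n -> 'I_n -> E) (adm : rel 'I_n).
Hypothesis adm_neq : forall u v, adm u v -> u != v.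
Hypothesis ed_eq : forall u v u' v', adm u v -> adm u' v' ->
  (ed u v == ed u' v') = ([set u; v] == [set u'; v']).

(** One family covers both matrices that are compared: for a link, [h b = b - p] and [adm] asks for
    distinct vertices outside the face; for the comparison matrix, [h] is [skew_value] and [adm] is
    inequality. The label [ed u v] names the random element that decides the entry. *)
Definition entry_mx (S : {set E}) : 'M[K]_n :=
  \matrix_(u, v) if adm u v then h (ed u v \in S) else 0.

Definition moment (c : nat) : K := p * h true ^+ c + (1 - p) * h false ^+ c.

Definition adm_walk L (u : L.-tuple 'I_n) := [forall t, adm (tnth u t) (tnth u (ordS t))].
Definition edge_count L (u : L.-tuple 'I_n) (e : E) :=
  #|[set t | ed (tnth u t) (tnth u (ordS t)) == e]|.

Lemma expect_walk L (u : L.-tuple 'I_n) :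
  expect p (fun S => \prod_(t < L) entry_mx S (tnth u t) (tnth u (ordS t))) =
  if adm_walk u then \prod_e moment (edge_count u e) else 0.
Proof.
case: ifP => [/forallP au|/negbT].
  rewrite -(expect_prod p (fun e b => h b ^+ edge_count u e)); apply: eq_expect => S.
  rewrite (partition_big (fun t => ed (tnth u t) (tnth u (ordS t))) xpredT) //=.
  apply: eq_bigr => e _; rewrite -prodr_const.
  rewrite [RHS](eq_bigl (fun t => ed (tnth u t) (tnth u (ordS t)) == e)) => [|t]; last by rewrite inE.
  by apply: eq_bigr => t /eqP <-; rewrite mxE au.
rewrite negb_forall => /existsP[t nt]; rewrite /expect big1 // => S _.
by rewrite (bigD1 t) //= mxE (negbTE nt) mul0r mulr0.
Qed.

Lemma edge_count_mult L (u : L.-tuple 'I_n) t : adm_walk u ->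
  edge_count u (ed (tnth u t) (tnth u (ordS t))) = edge_mult u (walk_edge u t).
Proof. by move=> /forallP au; apply: eq_card => s; rewrite !inE ed_eq. Qed.

Lemma edge_count_gt0 L (u : L.-tuple 'I_n) e : (0 < edge_count u e)%N ->
  exists t, e = ed (tnth u t) (tnth u (ordS t)).
Proof. by rewrite card_gt0 => /set0Pn[t]; rewrite inE => /eqP <-; exists t. Qed.

Lemma good_walk_count L (u : L.-tuple 'I_n) : adm_walk u ->
  good_walk u = [forall e, edge_count u e != 1%N].
Proof.
move=> au; have /forallP au' := au; apply/forallP/forallP => [gu e|ce t].
  have [e0|/edge_count_gt0[t ->]] := posnP (edge_count u e); first by rewrite e0.
  by rewrite edge_count_mult //; have /andP[_] := gu t; case: edge_mult => [|[]].
rewrite adm_neq //= -edge_count_mult //.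
have := ce (ed (tnth u t) (tnth u (ordS t))).
have : (0 < edge_count u (ed (tnth u t) (tnth u (ordS t))))%N.
  by rewrite card_gt0; apply/set0Pn; exists t; rewrite inE.
by case: edge_count => [|[]].
Qed.

Lemma card_edge_count L (u : L.-tuple 'I_n) : adm_walk u ->
  #|[set e | (0 < edge_count u e)%N]| = #|walk_edges u|.
Proof.
move=> au; have /forallP au' := au.
have -> : [set e | (0 < edge_count u e)%N] =
    [set ed (tnth u t) (tnth u (ordS t)) | t : 'I_L].
  apply/setP => e; rewrite inE; apply/idP/imsetP => [/edge_count_gt0[t ->]|[t _ ->]].
    by exists t.
  by rewrite card_gt0; apply/set0Pn; exists t; rewrite inE.
by apply: card_imset_fibres => s t; rewrite ed_eq.
Qed.

Hypothesis mom1 : moment 1 = 0.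

Lemma expect_walk_bad L (u : L.-tuple 'I_n) : ~~ good_walk u ->
  expect p (fun S => \prod_(t < L) entry_mx S (tnth u t) (tnth u (ordS t))) = 0.
Proof.
move=> bu; rewrite expect_walk; case: ifP => // au.
move: bu; rewrite good_walk_count // negb_forall => /existsP[e]; rewrite negbK => /eqP e1.
by rewrite (bigD1 e) //= e1 mom1 mul0r.
Qed.

(** A closed walk has at most one vertex more than it has edges; the extra factor [p] pays for that
    one, so that a factor [p] per edge becomes a factor [p] per vertex. *)
Lemma expect_trace_le L : 0 <= p <= 1 -> (forall c, (1 < c)%N -> `|moment c| <= p) ->
  p * expect p (fun S => \tr (entry_mx S ^+ L.+1)) <=
  \sum_(u : L.+1.-tuple 'I_n) (good_walk u)%:R * p ^+ #|walk_verts u|.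
Proof.
move=> /andP[p0 p1] momc.
rewrite (@eq_expect _ _ _ _ (fun S => \sum_(u : L.+1.-tuple 'I_n)
   \prod_(t < L.+1) entry_mx S (tnth u t) (tnth u (ordS t)))); last first.
  by move=> S; rewrite trace_pow_walks.
rewrite expect_sum mulr_sumr; apply: ler_sum => u _.
case: (boolP (good_walk u)) => gu; last by rewrite expect_walk_bad ?mulr0 ?mul0r.
rewrite mul1r expect_walk; case: ifP => au; last by rewrite mulr0 exprn_ge0.
apply: (@le_trans _ _ (p * p ^+ #|walk_edges u|)); last first.
  rewrite -exprS; apply: ler_wiXn2l => //; exact: card_walk_verts_le.
rewrite ler_wpM2l // -card_edge_count // -prodr_const [leRHS]big_mkcond /=.
apply: le_trans (ler_norm _) _; rewrite normr_prod; apply: ler_prod => e _.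
rewrite normr_ge0 inE /=; case: posnP => [->|c0].
  by rewrite /moment !expr0 !mulr1 addrC subrK normr1.
apply: momc; move: gu; rewrite good_walk_count // => /forallP/(_ e).
by move: c0; case: edge_count => [|[]].
Qed.

(** A good walk may use an edge an odd number of times, three or more, so the odd moments have to be
    large as well; symmetric signs would annihilate such walks. *)
Lemma expect_trace_ge L : (forall u v, adm u v = (u != v)) ->
  moment 0 = 1 -> (forall c, (1 < c)%N -> 1 <= moment c) ->
  \sum_(u : L.+1.-tuple 'I_n) (good_walk u)%:R <=
  expect p (fun S => \tr (entry_mx S ^+ L.+1)).
Proof.
move=> admE mom0 momc.
rewrite (@eq_expect _ _ _ _ (fun S => \sum_(u : L.+1.-tuple 'I_n)
   \prod_(t < L.+1) entry_mx S (tnth u t) (tnth u (ordS t)))); last first.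
  by move=> S; rewrite trace_pow_walks.
rewrite expect_sum; apply: ler_sum => u _.
case: (boolP (good_walk u)) => gu; last by rewrite expect_walk_bad.
have au : adm_walk u.
  by apply/forallP => t; rewrite admE; have /forallP/(_ t)/andP[] := gu.
rewrite expect_walk au; apply: (big_ind (fun x => 1 <= x)) => // [x y x1 y1|e _].
  by rewrite -[1]mulr1 ler_pM.
have [->|c0] := posnP (edge_count u e); first by rewrite mom0.
apply: momc; move: gu; rewrite good_walk_count // => /forallP/(_ e).
by move: c0; case: edge_count => [|[]].
Qed.

End CenteredMatrix.

(** * The comparison matrix *)

Lemma continuity_horner (q : {poly R}) : continuity (fun x => q.[x]).
Proof.
elim/poly_ind: q => [|q c IH].
  rewrite (_ : (fun x => _) = (fun=> 0)); first exact: continuity_const.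
  by apply: functional_extensionality => x; rewrite horner0.
rewrite (_ : (fun x => _) = ((fun x => q.[x]) * id + (fun=> c))%F); last first.
  by apply: functional_extensionality => x; rewrite hornerMXaddC.
apply: continuity_plus; last exact: continuity_const.
apply: continuity_mult => //; exact: (derivable_continuous _ derivable_id).
Qed.

(** The spectral theorem is over a real closed field, for its square roots and for the closure
    [F[i]]. *)
Lemma R_real_closed : Num.real_closed_axiom R.
Proof.
move=> q a b ab /andP[qa qb].
have /RlebP qq : q.[a] * q.[b] <= 0 := mulr_le0_ge0 qa qb.
have /RlebP ab' := ab.
have [x [[ax xb] qx]] := IVT_cor _ _ _ (continuity_horner q) ab' qq.
exists x; last by apply/eqP.
by apply/andP; split; apply/RlebP.
Qed.

HB.instance Definition _ := Num.RealField_isClosed.Build R R_real_closed.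

Lemma INRE m : INR m = m%:R.
Proof. by elim: m => // m IH; rewrite S_INR IH -natr1. Qed.

Lemma R_floor (x : R) : 0 <= x -> exists m : nat, m%:R <= x < m.+1%:R.
Proof.
move=> x0; have [N /Rgt_lt/RltbP xN] := INR_unbounded x.
have exN : exists N : nat, x < N%:R by exists N; rewrite -INRE.
have := ex_minnP exN; case=> [[|m] xm min]; first by rewrite ltNge x0 in xm.
exists m; rewrite xm andbT leNgt; apply/negP => /min; by rewrite ltnn.
Qed.

Lemma expRD (x y : R) : exp (x + y) = exp x * exp y.
Proof. exact: exp_plus. Qed.

Lemma expR0 : exp 0 = 1.
Proof. exact: exp_0. Qed.

Lemma expR_gt0 (x : R) : 0 < exp x.
Proof. by apply/RltbP; exact: exp_pos. Qed.

Lemma expR_ge1Dx (x : R) : 1 + x <= exp x.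
Proof. by apply/RlebP; exact: exp_ineq1_le. Qed.

Lemma ler_expR (x y : R) : x <= y -> exp x <= exp y.
Proof.
move=> xy; rewrite -[y](subrK x) addrC expRD ler_peMr ?(ltW (expR_gt0 _)) //.
by apply: le_trans (expR_ge1Dx _); rewrite lerDl subr_ge0.
Qed.

Lemma expR_sum (I : Type) (r : seq I) (P : pred I) (f : I -> R) :
  exp (\sum_(i <- r | P i) f i) = \prod_(i <- r | P i) exp (f i).
Proof. by apply: (big_morph exp expRD expR0). Qed.

Lemma expRM_natr (x : R) m : exp (x * m%:R) = exp x ^+ m.
Proof.
elim: m => [|m IH]; first by rewrite mulr0 expR0.
by rewrite -natr1 mulrDr mulr1 expRD IH exprSr.
Qed.

Lemma expRN (x : R) : exp (- x) = (exp x)^-1.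
Proof.
have := expRD x (- x); rewrite subrr expR0 => E.
by rewrite -[RHS]mulr1 E mulKf // gt_eqF ?expR_gt0.
Qed.

(** For [x <= 1/2], [exp x <= 1 / (1 - x) <= 1 + x + 2 x^2]; beyond that, [x <= 2 x^2] suffices. *)
Lemma expR_le_quad (x : R) : exp x <= x + exp (2 * x ^+ 2).
Proof.
have [xh|xh] := lerP x (2^-1).
  apply: (@le_trans _ _ (x + (1 + 2 * x ^+ 2))); last by rewrite lerD2l expR_ge1Dx.
  have x1 : 0 < 1 - x by lra.
  rewrite -[exp x]invrK -expRN; apply: (@le_trans _ _ (1 - x)^-1).
    by rewrite lef_pV2 ?posrE ?expR_gt0 //; exact: expR_ge1Dx.
  rewrite -[(1 - x)^-1]mul1r ler_pdivrMr //.
  have -> : (x + (1 + 2 * x ^+ 2)) * (1 - x) = 1 + x ^+ 2 * (1 - 2 * x) by ring.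
  by rewrite lerDl mulr_ge0 ?sqr_ge0 //; lra.
have x0 : 0 <= x by lra.
apply: (@le_trans _ _ (exp (2 * x ^+ 2))); last by rewrite lerDr.
apply: ler_expR; have : 0 <= x * (2 * x - 1) by rewrite mulr_ge0 //; lra.
by rewrite expr2; lra.
Qed.

(* With probability [1/3] for [true] the mean vanishes and all higher moments are at
   least [1], so that every good walk contributes at least [1] to the expected trace. *)
Definition skew_value (b : bool) : R := if b then 2 else -1.

Lemma skew_moment c : moment (3^-1) skew_value c = (2 ^+ c + 2 * (-1) ^+ c) / 3.
Proof. by rewrite /moment /skew_value; field. Qed.

Lemma skew_moment_ge1 c : (1 < c)%N -> 1 <= moment (3^-1) skew_value c.
Proof.
move=> c1; rewrite skew_moment ler_pdivlMr //; case: c c1 => [|[|[|c]]] // _.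
  by rewrite sqrrN expr1n; lra.
have two : 8%:R <= 2 ^+ c.+3 :> R.
  by rewrite -natrX ler_nat (@leq_exp2l 2 3).
have : -1 <= (-1) ^+ c.+3 :> R by rewrite -signr_odd; case: odd => /=; lra.
lra.
Qed.

(* [e ^ x <= x + e ^ (2 x ^ 2)] turns the vanishing mean into a Gaussian bound. *)
Lemma skew_subgaussian (E : finType) (w : E -> R) :
  expect (3^-1) (fun S : {set E} => exp (\sum_e w e * skew_value (e \in S))) <=
  exp (8 * \sum_e w e ^+ 2).
Proof.
rewrite (@eq_expect _ _ _ _ (fun S => \prod_e exp (w e * skew_value (e \in S)))); last first.
  by move=> S; rewrite expR_sum.
rewrite (expect_prod _ (fun e b => exp (w e * skew_value b))) mulr_sumr expR_sum.
apply: ler_prod => e _; rewrite /skew_value; apply/andP; split.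
  by rewrite addr_ge0 // mulr_ge0 ?(ltW (expR_gt0 _)) //; lra.
have e1 := expR_le_quad (w e * 2); have e2 := expR_le_quad (w e * -1).
have f1 : exp (2 * (w e * 2) ^+ 2) <= exp (8 * w e ^+ 2) by apply: ler_expR; rewrite !expr2; nra.
have f2 : exp (2 * (w e * -1) ^+ 2) <= exp (8 * w e ^+ 2) by apply: ler_expR; rewrite !expr2; nra.
lra.
Qed.

(** * Integer net and norm of the comparison matrix *)

Section Net.
Variable r : nat.
Hypothesis r0 : (0 < r)%N.

Notation coord := (bool * 'I_(4 * r).+1)%type.
Definition coord_val (c : coord) : R := (-1) ^+ c.1 * (c.2 : nat)%:R.
(** Integer vectors of squared length at most [4 r], in sign and magnitude. A magnitude never
    exceeds its square, so the cap [4 * r] in [coord] excludes none of them; zero is represented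
    twice, which only enlarges the count. *)
Definition net : {set {ffun 'I_r -> coord}} :=
  [set a : {ffun 'I_r -> coord} | (\sum_j ((a j).2 : nat) ^ 2 <= 4 * r)%N].

Lemma sum_half_pow m : \sum_(i < m) (2^-1 : R) ^+ i <= 2.
Proof.
have -> : \sum_(i < m) (2^-1 : R) ^+ i = 2 - 2 * 2^-1 ^+ m.
  elim: m => [|m IH]; first by rewrite big_ord0 expr0; ring.
  by rewrite big_ord_recr /= IH exprS; field.
by rewrite gerBl mulr_ge0 // exprn_ge0 // invr_ge0.
Qed.

(** A net vector has [sum |a_j| <= sum a_j^2 <= 4 r], hence weight [wt >= 1]; the total weight
    factors over the coordinates and is at most [16^r * 4^r]. *)
Lemma card_net : #|net|%:R <= 64 ^+ r :> R.
Proof.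
pose wt (a : {ffun 'I_r -> coord}) : R := 2 ^+ (4 * r) * \prod_j 2^-1 ^+ ((a j).2 : nat).
have wt0 a : 0 <= wt a by rewrite mulr_ge0 ?exprn_ge0 // prodr_ge0 // => j _; rewrite exprn_ge0 // invr_ge0.
apply: (@le_trans _ _ (\sum_a wt a)).
  rewrite -sum1_card natr_sum big_mkcond /=; apply: ler_sum => a _; case: ifP => // an.
  rewrite /wt -expr_sum exprVn ler_pdivlMr ?exprn_gt0 // mul1r; apply: ler_weXn2l; first by lra.
  move: an; rewrite inE; apply: leq_trans; apply: leq_sum => j _.
  by case: (nat_of_ord _) => // m; rewrite -mulnn leq_pmulr.
rewrite /wt -mulr_sumr -(bigA_distr_bigA (fun (j : 'I_r) (c : coord) => (2^-1 : R) ^+ (c.2 : nat))) /=.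
rewrite prodr_const card_ord exprM -exprMn; apply: lerXn2r; rewrite ?nnegrE //.
  by rewrite mulr_ge0 ?exprn_ge0 // sumr_ge0 // => c _; rewrite exprn_ge0 // invr_ge0.
have -> : \sum_(c : coord) (2^-1 : R) ^+ (c.2 : nat) = 2 * \sum_(i < (4 * r).+1) (2^-1 : R) ^+ i.
  rewrite -(pair_bigA _ (fun (b : bool) (i : 'I_(4 * r).+1) => (2^-1 : R) ^+ i)).
  by rewrite big_bool /= mulr2n mulrDl mul1r.
have := sum_half_pow (4 * r).+1; set t := \sum_(_ < _) _; rewrite -natrX => h.
have -> : (2 ^ 4)%N = 16%N by []; lra.
Qed.

(** The magnitude is rounded up or down, whichever does not decrease the linear function with slope
    [c]. The inequality holds without error term, so no approximation error has to be absorbed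
    later. *)
Lemma round_coord (z c : R) : exists (s : bool) (m : nat),
  c * z <= c * ((-1) ^+ s * m%:R) /\ m%:R ^+ 2 <= 2 * z ^+ 2 + 2.
Proof.
pose s := z < 0; have zs : z = (-1) ^+ s * `|z| by exact: numEsign.
have [m0 /andP[m0l m0u]] := R_floor (normr_ge0 z).
have z2 : z ^+ 2 = `|z| ^+ 2 by rewrite real_normK ?num_real.
have n0 := normr_ge0 z.
have ex (m : nat) : m%:R <= `|z| + 1 -> m%:R ^+ 2 <= 2 * z ^+ 2 + 2.
  move=> mz; rewrite z2; apply: (@le_trans _ _ ((`|z| + 1) ^+ 2)).
    by apply: lerXn2r; rewrite ?nnegrE //; lra.
  have := sqr_ge0 (`|z| - 1); rewrite !expr2; lra.
have [cs|cs] := lerP 0 (c * (-1) ^+ s).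
  exists s, m0.+1; split; last by apply: ex; rewrite -natr1; lra.
  by rewrite {1}zs !mulrA ler_wpM2l // ltW.
exists s, m0; split; last by apply: ex; lra.
by rewrite {1}zs !mulrA ler_wnM2l // ltW.
Qed.

(** The coordinatewise bounds [2 z_j^2 + 2] add up to [2 r + 2 r], whence the radius of the net. *)
Lemma round_vector (z c : 'I_r -> R) : \sum_j z j ^+ 2 = r%:R ->
  exists2 a, a \in net & \sum_j c j * z j <= \sum_j c j * coord_val (a j).
Proof.
move=> zr.
have ex j : exists q : coord, c j * z j <= c j * coord_val q /\ (q.2 : nat)%:R ^+ 2 <= 2 * z j ^+ 2 + 2.
  have [s [m [h1 h2]]] := round_coord (z j) (c j).
  have zj : z j ^+ 2 <= r%:R.
    by rewrite -zr (bigD1 j) //= lerDl sumr_ge0 // => i _; rewrite sqr_ge0.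
  have mr : (m < (4 * r).+1)%N.
    have : (m ^ 2 <= 2 * r + 2)%N by rewrite -(ler_nat R) natrX natrD natrM; lra.
    by rewrite -mulnn; nia.
  by exists (s, Ordinal mr).
have [a /all_and2 [a1 a2]] := fin_all_exists ex.
exists (finfun a); last by apply: ler_sum => j _; rewrite ffunE.
rewrite inE -(ler_nat R) natr_sum.
apply: (@le_trans _ _ (\sum_j (2 * z j ^+ 2 + 2))).
  by apply: ler_sum => j _; rewrite ffunE natrX.
rewrite big_split /= -mulr_sumr zr sumr_const card_ord -[2 *+ r]mulr_natr.
by rewrite -mulrDr -natrD -natrM ler_nat; lia.
Qed.

Definition net_form (Y : 'M[R]_r) (a b : {ffun 'I_r -> coord}) : R :=
  \sum_u \sum_v coord_val (a u) * Y u v * coord_val (b v).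

(** The unit vector is scaled to length [sqrt r], where integer rounding costs only a constant
    factor. The form is linear in each argument separately, so the two copies of the vector are
    rounded one after the other, possibly to different net points; the sign [e] goes into the first
    copy. *)
Lemma qform_le_net_form (Y : 'M[R]_r) x : sqnorm x = 1 ->
  exists a b, [/\ a \in net, b \in net & r%:R * `|qform Y x| <= net_form Y a b].
Proof.
move=> x1; pose q := qform Y x; pose e : R := (-1) ^+ (q < 0)%R.
have eq : `|q| = e * q by rewrite /e -normrEsign.
pose sr := Num.sqrt (r%:R : R); have sr2 : sr ^+ 2 = r%:R by rewrite sqr_sqrtr ?ler0n.
pose z v := sr * x 0 v.
have zr : \sum_v z v ^+ 2 = r%:R.
  by under eq_bigr do rewrite exprMn; rewrite -mulr_sumr -sqnormE x1 mulr1.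
have ezr : \sum_v (e * z v) ^+ 2 = r%:R.
  by rewrite -zr; apply: eq_bigr => v _; rewrite exprMn sqrr_sign mul1r.
have [a an ha] := round_vector (fun u => \sum_v Y u v * z v) ezr.
have [b bn hb] := round_vector (fun v => \sum_u coord_val (a u) * Y u v) zr.
exists a, b; split=> //.
have -> : r%:R * `|qform Y x| = \sum_u (\sum_v Y u v * z v) * (e * z u).
  rewrite -/q eq /q qformE -sr2 !mulr_sumr; apply: eq_bigr => u _.
  rewrite !mulr_sumr mulr_suml; apply: eq_bigr => v _; rewrite /z expr2; ring.
apply: le_trans ha _.
have -> : \sum_j (\sum_v Y j v * z v) * coord_val (a j) =
          \sum_v (\sum_u coord_val (a u) * Y u v) * z v.
  under eq_bigr do rewrite mulr_suml; rewrite exchange_big; apply: eq_bigr => v _.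
  rewrite mulr_suml; apply: eq_bigr => u _; ring.
apply: le_trans hb _; rewrite /net_form exchange_big; apply: ler_sum => v _.
by rewrite mulr_suml.
Qed.

Definition pair_edge (u v : 'I_r) := if (u < v)%N then (u, v) else (v, u).

Lemma pair_edge_eq u v u' v' : u != v -> u' != v' ->
  (pair_edge u v == pair_edge u' v') = ([set u; v] == [set u'; v']).
Proof.
rewrite eq_set2 /pair_edge => uv u'v'.
case: (ltngtP u v) uv => [uv _|uv _|/val_inj ->]; last by rewrite eqxx.
  case: (ltngtP u' v') u'v' => [uv' _|uv' _|/val_inj ->]; last by rewrite eqxx.
    rewrite xpair_eqE; apply/idP/orP => [->|[//|/andP[/eqP uE /eqP vE]]]; first by left.
    by move: uv uv'; rewrite uE vE => /ltnW; rewrite leqNgt => /negbTE ->.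
  rewrite xpair_eqE; apply/idP/orP => [->|[/andP[/eqP uE /eqP vE]|//]]; first by right.
  by move: uv uv'; rewrite uE vE => /ltnW; rewrite leqNgt => /negbTE ->.
case: (ltngtP u' v') u'v' => [uv' _|uv' _|/val_inj ->]; last by rewrite eqxx.
  rewrite xpair_eqE andbC; apply/idP/orP => [->|[/andP[/eqP uE /eqP vE]|//]]; first by right.
  by move: uv uv'; rewrite uE vE => /ltnW; rewrite leqNgt => /negbTE ->.
rewrite xpair_eqE andbC; apply/idP/orP => [->|[//|/andP[/eqP uE /eqP vE]]]; first by left.
by move: uv uv'; rewrite uE vE => /ltnW; rewrite leqNgt => /negbTE ->.
Qed.

Definition skew_mx (T : {set 'I_r * 'I_r}) : 'M[R]_r :=
  entry_mx skew_value pair_edge (fun u v => u != v) T.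

Lemma skew_mx_sym T : (skew_mx T)^T = skew_mx T.
Proof.
apply/matrixP => u v; rewrite !mxE eq_sym; case: ifP => // uv.
suff -> : pair_edge v u = pair_edge u v by [].
by apply/eqP; rewrite pair_edge_eq // 1?eq_sym // setUC.
Qed.

Definition upper_coef (a b : {ffun 'I_r -> coord}) (e : 'I_r * 'I_r) : R :=
  if (e.1 < e.2)%N then coord_val (a e.1) * coord_val (b e.2) else 0.

(** The entries above the diagonal are the independent ones, so the form splits into two sums over
    them, with [a] and [b] exchanged. *)
Lemma net_form_skew T a b : net_form (skew_mx T) a b =
  \sum_e upper_coef a b e * skew_value (e \in T) +
  \sum_e upper_coef b a e * skew_value (e \in T).
Proof.
rewrite /upper_coef.
have sumE (f : 'I_r * 'I_r -> R) : \sum_e f e = \sum_u \sum_v f (u, v).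
  by rewrite pair_bigA; apply: eq_bigr => -[].
rewrite !sumE /=.
rewrite [X in _ = _ + X]exchange_big -big_split; apply: eq_bigr => u _ /=.
rewrite -big_split; apply: eq_bigr => v _ /=; rewrite mxE /pair_edge.
case: (ltngtP u v) => uv.
- by rewrite (_ : u != v) ?mul0r ?addr0; [ring|apply: contraTneq uv => ->; rewrite ltnn].
- by rewrite (_ : u != v) ?mul0r ?add0r; [ring|apply: contraTneq uv => ->; rewrite ltnn].
- by rewrite (val_inj uv) eqxx /= !mul0r mulr0 mul0r addr0.
Qed.

Lemma net_sum_sqr a : a \in net -> \sum_j coord_val (a j) ^+ 2 <= 4 * r%:R.
Proof.
rewrite inE -(ler_nat R) natr_sum natrM; apply: le_trans; apply: ler_sum => j _.
by rewrite /coord_val exprMn sqrr_sign mul1r natrX.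
Qed.

(** The two halves of the form use the same random entries; [x y <= (x^2 + y^2) / 2] separates their
    exponentials at the price of doubling the coefficients. The constant is [8 * 4 * 4 * 4]. *)
Lemma expect_net_form a b (lam : R) : a \in net -> b \in net -> lam ^+ 2 = r%:R^-1 ->
  expect 3^-1 (fun T => exp (lam * net_form (skew_mx T) a b)) <= exp (512 * r%:R).
Proof.
move=> an bn lam2.
pose w c c' e := 2 * lam * upper_coef c c' e.
have wle c c' : c \in net -> c' \in net ->
    expect 3^-1 (fun T : {set 'I_r * 'I_r} => exp (\sum_e w c c' e * skew_value (e \in T))) <=
    exp (512 * r%:R).
  move=> cn c'n; apply: le_trans (skew_subgaussian _) _; apply: ler_expR.
  have : \sum_e w c c' e ^+ 2 <= 4 * lam ^+ 2 * (4 * r%:R * (4 * r%:R)).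
    apply: (@le_trans _ _ (4 * lam ^+ 2 * ((\sum_j coord_val (c j) ^+ 2) * (\sum_j coord_val (c' j) ^+ 2)))).
      rewrite big_distrlr /= pair_bigA mulr_sumr; apply: ler_sum => e _.
      rewrite /w /upper_coef; case: ifP => _; first by rewrite le_eqVlt; apply/orP; left; apply/eqP; ring.
      rewrite mulr0 expr0n /=; apply: mulr_ge0; apply: mulr_ge0; rewrite ?sqr_ge0 //.
    apply: ler_wpM2l; first by apply: mulr_ge0; rewrite ?sqr_ge0.
    apply: ler_pM; rewrite ?net_sum_sqr //.
      by apply: sumr_ge0 => j _; rewrite sqr_ge0.
    by apply: sumr_ge0 => j _; rewrite sqr_ge0.
  rewrite lam2 => h; have -> : 512 * r%:R = 8 * (4 * r%:R^-1 * (4 * r%:R * (4 * r%:R))) :> R.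
    by field; rewrite pnatr_eq0 -lt0n.
  by rewrite ler_wpM2l.
apply: (@le_trans _ _ (expect 3^-1 (fun T : {set 'I_r * 'I_r} =>
    2^-1 * exp (\sum_e w a b e * skew_value (e \in T)) +
    2^-1 * exp (\sum_e w b a e * skew_value (e \in T))))).
  apply: ler_expect => [|T]; first by lra.
  have split_w c c' : \sum_e w c c' e * skew_value (e \in T) =
     (lam * \sum_e upper_coef c c' e * skew_value (e \in T)) * 2%:R.
    by rewrite mulr_sumr mulr_suml; apply: eq_bigr => e _; rewrite /w; ring.
  rewrite net_form_skew mulrDr expRD !split_w !expRM_natr.
  set x := exp _; set y := exp _; have := sqr_ge0 (x - y); rewrite !expr2; lra.
have half (x y z : R) : x <= z -> y <= z -> 2^-1 * x + 2^-1 * y <= z by lra.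
by rewrite expectD !expectZ; apply: half; exact: wle.
Qed.

End Net.

(** With [r = 2 L], the pairs of net points number at most [64^(2 r) = (64^4)^L], and each has
    exponential moment at most [exp (512 r) = (exp 1024)^L]. *)
Definition walk_const : R := 64 ^+ 4 * exp 1024.

Lemma walk_const_ge1 : 1 <= walk_const.
Proof.
rewrite /walk_const mulr_ege1 //; first by rewrite exprn_ege1 //; lra.
by rewrite -[leLHS]expR0; apply: ler_expR; rewrite ler0n.
Qed.

(** The largest value of the form is replaced by the sum [B] of exponentials over all pairs of net
    points, whose expectation is at most the number of pairs times one subgaussian bound. *)
Theorem sum_good_walks_bound l : ~~ odd l.+1 ->
  \sum_(u : l.+1.-tuple 'I_(2 * l.+1)) (good_walk u)%:R <=
  (2 * l.+1)%:R * (walk_const * Num.sqrt (2 * l.+1)%:R) ^+ l.+1 :> R.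
Proof.
move=> evL; set r := (2 * l.+1)%N; have r0 : (0 < r)%N by [].
apply: le_trans (@expect_trace_ge _ r _ 3^-1 skew_value (@pair_edge r) (fun u v => u != v) _ _ _ l _ _ _) _ => //.
- exact: pair_edge_eq.
- by rewrite skew_moment; field.
- by rewrite skew_moment; field.
- exact: skew_moment_ge1.
pose sr := Num.sqrt (r%:R : R); have sr0 : 0 < sr by rewrite sqrtr_gt0 ltr0n.
have sr2 : sr ^+ 2 = r%:R by rewrite sqr_sqrtr ?ler0n.
pose B T := \sum_(a in net r) \sum_(b in net r) exp (sr^-1 * net_form (skew_mx T) a b).
have pt T : \tr (skew_mx T ^+ l.+1) <= r%:R * (sr ^+ l.+1 * B T).
  apply: trace_pow_le => [|//|x x1]; first exact: skew_mx_sym.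
  have [a [b [an bn hab]]] := qform_le_net_form r0 (skew_mx T) x1.
  set q := `|_| in hab *; have q0 : 0 <= q by exact: normr_ge0.
  (* With [L = l.+1 <= r], [q / sr <= sr q / L <= exp (sr q / L)]; the claim is the [L]-th power of
     this. *)
  have h1 : q ^+ l.+1 <= sr ^+ l.+1 * exp (sr * q).
    have -> : q = sr * (q / sr) by rewrite mulrC divfK ?gt_eqF.
    rewrite exprMn ler_wpM2l ?exprn_ge0 ?(ltW sr0) //.
    have -> : sr * (sr * (q / sr)) = (sr * q / l.+1%:R) * l.+1%:R.
      by rewrite divfK ?pnatr_eq0 //; congr (_ * _); rewrite mulrC divfK ?gt_eqF.
    rewrite expRM_natr; apply: lerXn2r; rewrite ?nnegrE ?divr_ge0 ?(ltW (expR_gt0 _)) ?(ltW sr0) //.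
    apply: le_trans (expR_ge1Dx _); apply: (@le_trans _ _ (sr * q / l.+1%:R)); last by rewrite lerDr.
    rewrite ler_pdivrMr // (_ : _ * sr = q * (sr ^+ 2 / l.+1%:R)); last by rewrite expr2; ring.
    rewrite sr2 ler_peMr // ler_pdivlMr ?ltr0n // mul1r.
    by rewrite ler_nat /r; lia.
  apply: le_trans h1 _; rewrite ler_wpM2l ?exprn_ge0 ?(ltW sr0) //.
  have h2 : exp (sr * q) <= exp (sr^-1 * net_form (skew_mx T) a b).
    apply: ler_expR; by rewrite ler_pdivlMl // mulrA -expr2 sr2.
  apply: le_trans h2 _; rewrite /B (bigD1 a) //= (bigD1 b) //=.
  rewrite -addrA lerDl addr_ge0 //; first by apply: sumr_ge0 => i _; rewrite ltW ?expR_gt0.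
  by apply: sumr_ge0 => i _; apply: sumr_ge0 => j _; rewrite ltW ?expR_gt0.
apply: (@le_trans _ _ (expect 3^-1 (fun T => r%:R * (sr ^+ l.+1 * B T)))).
  by apply: ler_expect => [|T]; [lra|exact: pt].
rewrite expectZ expectZ ler_wpM2l ?ler0n // exprMn mulrC ler_wpM2r ?exprn_ge0 ?(ltW sr0) //.
rewrite /B expect_sum.
apply: (@le_trans _ _ (\sum_(a in net r) \sum_(b in net r) exp (512 * r%:R))).
  apply: ler_sum => a an; rewrite expect_sum; apply: ler_sum => b bn.
  by apply: expect_net_form => //; rewrite exprVn sr2.
have e0 : 0 <= exp (512 * r%:R) by rewrite ltW ?expR_gt0.
have cn := card_net r.
rewrite !sumr_const -mulrnA -[leLHS]mulr_natr natrM.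
apply: (@le_trans _ _ (exp (512 * r%:R) * (64 ^+ r * 64 ^+ r))).
  by rewrite ler_wpM2l // ler_pM.
rewrite /walk_const exprMn mulrC; apply: ler_pM; rewrite ?mulr_ge0 ?exprn_ge0 //.
  by rewrite -exprD -exprM /r (_ : (2 * l.+1 + 2 * l.+1 = 4 * l.+1)%N) //; lia.
rewrite -expRM_natr; apply: ler_expR; rewrite /r natrM; lra.
Qed.

(** * Incidence numbers and Laplacians *)

Section Incidence.
Variable n : nat.
Implicit Types (F G H s : {set 'I_n}) (u v w : 'I_n).

Lemma incidence_setU1 v s : v \notin s ->
  incidence (v |: s) s = (-1) ^+ #|[set u in s | (u < v)%N]|.
Proof.
move=> vs; rewrite /incidence subsetUr cardsU1 vs add1n eqxx /=.
case: pickP => [w|/(_ v)]; last by rewrite !inE eqxx vs.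
rewrite !inE => /andP[/negbTE ws]; rewrite ws orbF => /eqP ->.
congr (_ ^+ _); apply: eq_card => u; rewrite !inE.
by case: eqVneq => [->|//] /=; rewrite ltnn andbF.
Qed.

Lemma incidence_neq0 F s : incidence F s != 0 -> exists2 v, v \notin s & F = v |: s.
Proof.
rewrite /incidence; case: ifP => [/andP[sF /eqP cF] _|_]; last by rewrite eqxx.
have : #|F :\: s| = 1%N by rewrite cardsD (setIidPr sF) cF subSnn.
move/eqP/cards1P => [v Fs]; exists v.
  by have := set11 v; rewrite -Fs inE => /andP[].
by rewrite -Fs setUC -{1}(setIidPr sF) setID.
Qed.

Lemma incidence_subset F s : s \subset F -> #|F| = #|s|.+1 -> incidence F s != 0.
Proof.
move=> sF cF; rewrite /incidence sF cF eqxx /=.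
case: pickP => [v _|F0]; first by rewrite signr_eq0.
have : #|F :\: s| = 0%N by apply: eq_card0.
by rewrite cardsD (setIidPr sF) cF subSnn.
Qed.

Lemma incidence_sqr v s : v \notin s -> incidence (v |: s) s ^+ 2 = 1.
Proof. by move=> vs; rewrite incidence_setU1 // sqrr_sign. Qed.

(** Inserting [u] moves [v] up by one place exactly when [u < v]. *)
Lemma incidence_setU2 u v s : u != v -> u \notin s -> v \notin s ->
  incidence (v |: (u |: s)) (u |: s) = (-1) ^+ (u < v)%N * incidence (v |: s) s.
Proof.
move=> uv us vs; have vus : v \notin u |: s by rewrite !inE negb_or eq_sym uv.
rewrite !incidence_setU1 // -exprD; congr (_ ^+ _).
have -> : [set w in u |: s | (w < v)%N] =
    [set w in [set u] | (w < v)%N] :|: [set w in s | (w < v)%N].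
  by apply/setP => w; rewrite !inE andb_orl.
rewrite cardsU.
have -> : [set w in [set u] | (w < v)%N] :&: [set w in s | (w < v)%N] = set0.
  apply/setP => w; rewrite !inE; case: eqVneq => //= ->.
  by rewrite (negbTE us) andbF.
rewrite cards0 subn0; congr (_ + _)%N; case: ltnP => uv'.
  rewrite (_ : [set w in [set u] | (w < v)%N] = [set u]) ?cards1 //.
  by apply/setP => w; rewrite !inE; case: eqVneq => //= ->.
rewrite (_ : [set w in [set u] | (w < v)%N] = set0) ?cards0 //.
by apply/setP => w; rewrite !inE; case: eqVneq => //= ->; rewrite ltnNge uv'.
Qed.

Lemma sign_ltn_neq u v : u != v -> (-1) ^+ (u < v)%N * (-1) ^+ (v < u)%N = -1 :> R.
Proof.
move=> uv; have /orP[h|h] : (u < v)%N || (v < u)%N by rewrite -neq_ltn.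
  by rewrite h ltnNge (ltnW h) /= expr1 expr0 mulr1.
by rewrite h ltnNge (ltnW h) /= expr1 expr0 mul1r.
Qed.

(** Adding [u] and [v] in the two orders differs by a sign; this sign makes the off-diagonal part of
    the up Laplacian minus the adjacency matrix. *)
Lemma incidence_square u v s : u != v -> u \notin s -> v \notin s ->
  incidence (v |: (u |: s)) (u |: s) * incidence (v |: (u |: s)) (v |: s) =
  - (incidence (u |: s) s * incidence (v |: s) s).
Proof.
move=> uv us vs; rewrite incidence_setU2 // setUCA incidence_setU2 // 1?eq_sym //.
rewrite mulrACA sign_ltn_neq // mulN1r mulrC //.
Qed.

Lemma sum_incidence_up m s (phi : {set 'I_n} -> R) : #|s| = m ->
  \sum_(F : {set 'I_n} | #|F| == m.+1) incidence F s * phi F =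
  \sum_(u | u \notin s) incidence (u |: s) s * phi (u |: s).
Proof.
move=> cs; pose A := [set u | u \notin s].
rewrite (bigID (mem [set u |: s | u in A])) /= [X in _ + X]big1 ?addr0; last first.
  move=> F /andP[_ /imsetP Fn]; have [->|] := eqVneq (incidence F s) 0; first by rewrite mul0r.
  by case/incidence_neq0 => v vs Fv; case: Fn; exists v; rewrite ?inE.
transitivity (\sum_(F in [set u |: s | u in A]) incidence F s * phi F).
  apply: eq_bigl => F; apply/andP/idP => [[]//|FA]; split=> //.
  by case/imsetP: FA => u; rewrite inE => us ->; rewrite cardsU1 us cs.
rewrite big_imset /=; first by apply: eq_bigl => u; rewrite inE.
move=> u v; rewrite !inE => us vs E.
have := setU11 u s; rewrite E !inE => /orP[/eqP //|]; by rewrite (negbTE us).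
Qed.

(** Between [s] and a face [s] plus [u, v] lie only [u |: s] and [v |: s], which contribute with
    opposite signs. *)
Lemma coboundary_sqr0 m H s : #|s| = m ->
  \sum_(G : {set 'I_n} | #|G| == m.+1) incidence H G * incidence G s = 0.
Proof.
move=> cs; under eq_bigr do rewrite mulrC.
rewrite (sum_incidence_up (incidence H) cs).
have [|none] := altP (@existsP _ (fun u => (u \notin s) && (incidence H (u |: s) != 0))).
  case=> u /andP[us /incidence_neq0 [v vus HE]].
  have [vu vs] : v != u /\ v \notin s by move: vus; rewrite !inE negb_or => /andP[].
  rewrite (bigD1 u) //= (bigD1 v) ?vs //= big1 ?addr0.
    rewrite HE incidence_setU2 // 1?eq_sym // setUCA incidence_setU2 //.
    set a := incidence (u |: s) s; set b := incidence (v |: s) s.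
    have := sign_ltn_neq vu.
    set e := _ ^+ _; set e' := _ ^+ _ => ee.
    have e'e : e' = - e.
      have : e ^+ 2 = 1 by rewrite /e sqrr_sign.
      by move=> e2; rewrite -[e']mul1r -e2 expr2 -mulrA ee mulrN1.
    rewrite e'e; ring.
  move=> w /andP[/andP[ws wu] wv]; have [->|] := eqVneq (incidence H (w |: s)) 0; first by rewrite mulr0.
  case/incidence_neq0 => x _ HE'; have : w \in H by rewrite HE' !inE eqxx orbT.
  by rewrite HE !inE (negbTE wv) (negbTE wu) (negbTE ws).
rewrite big1 // => u us; move: none; rewrite negb_exists => /forallP/(_ u).
by rewrite us /= negbK => /eqP ->; rewrite mulr0.
Qed.

Lemma sum_faces m (phi : {set 'I_n} -> R) :
  \sum_(F : faces n m) phi (val F) = \sum_(F : {set 'I_n} | #|F| == m) phi F.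
Proof.
rewrite [RHS](reindex_omap (val : faces n m -> _) insub) => [|F cF].
  by apply: eq_bigl => F; rewrite (valP F) valK eqxx.
by rewrite insubT.
Qed.

Lemma sum_incidence_sqr_down m F : #|F| = m.+1 ->
  \sum_(s : {set 'I_n} | #|s| == m) incidence F s ^+ 2 = m.+1%:R.
Proof.
move=> cF; transitivity (\sum_(s in [set B : {set 'I_n} | (B \subset F) && (#|B| == m)]) (1 : R)).
  rewrite big_mkcond [RHS]big_mkcond /=; apply: eq_bigr => s _; rewrite inE.
  case: eqP => cs; last by rewrite andbF.
  rewrite andbT; case: ifP => sF.
    have /incidence_neq0 [v vs ->] : incidence F s != 0; last exact: incidence_sqr.
    by apply: incidence_subset; rewrite ?cF ?cs.
  by rewrite /incidence sF /= expr0n.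
rewrite sumr_const cards_draws cF; congr (_ *+ _).
by rewrite -bin_sub ?leqnSn // subSnn bin1.
Qed.

Lemma sum_incidence_sqr_up m F : #|F| = m ->
  \sum_(H : {set 'I_n} | #|H| == m.+1) incidence H F ^+ 2 = (n - m)%:R.
Proof.
move=> cF; under eq_bigr do rewrite expr2.
rewrite (sum_incidence_up (fun H => incidence H F) cF).
rewrite (eq_bigr (fun=> 1)) => [|u uF]; last by rewrite -expr2 incidence_sqr.
rewrite sumr_const; congr (_ *+ _).
have -> : #|[pred u | u \notin F]| = #|~: F| by apply: eq_card => u; rewrite !inE.
by have := cardsC F; rewrite cF card_ord; lia.
Qed.

End Incidence.
Lemma setI_U1 (T : finType) (u v : T) (s : {set T}) : u != v -> u \notin s -> v \notin s ->
  (u |: s) :&: (v |: s) = s.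
Proof.
move=> uv us vs; rewrite -setUIl; have -> : [set u] :&: [set v] = set0; last by rewrite set0U.
by apply/setP => w; rewrite !inE; case: eqVneq => //= ->; rewrite (negbTE uv).
Qed.

Section LaplacianEntries.
Variables (n k : nat).
Implicit Types (F G H s : {set 'I_n}) (S : {set faces n k.+2}).

Definition in_complex S H := [exists H' in S, val H' == H].

Lemma incidence_pair_eq F G s : #|F| = k.+1 -> F != G ->
  incidence F s != 0 -> incidence G s != 0 ->
  exists u v, [/\ u != v, u \notin s, v \notin s & F = u |: s /\ G = v |: s].
Proof.
move=> cF FG /incidence_neq0 [u us Fu] /incidence_neq0 [v vs Gv].
exists u, v; split=> //; apply: contraNneq FG => uv; by rewrite Fu Gv uv.
Qed.

Lemma card_setI_lt F G : #|F| = k.+1 -> #|G| = k.+1 -> F != G -> (#|F :&: G| <= k)%N.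
Proof.
move=> cF cG FG; rewrite leqNgt; apply: contraNN FG => lt.
have FG : F :&: G = F.
  by apply/eqP; rewrite eqEcard subsetIl cF.
have GF : F :&: G = G.
  by apply/eqP; rewrite eqEcard subsetIr cG.
by rewrite -FG GF.
Qed.

(** For distinct faces only [s = F :&: G] contributes. Summing over all [s] is what lets the form
    split over links; the diagonal is cut out by hand, since every facet of [F] would contribute
    there. *)
Lemma adj_entryE S F G : #|F| = k.+1 -> #|G| = k.+1 ->
  adj_entry S F G =
  \sum_(s : {set 'I_n} | #|s| == k) incidence F s * incidence G s *
     (if F == G then 0 else (in_complex S (F :|: G))%:R).
Proof.
move=> cF cG; rewrite /adj_entry -/(in_complex S _) /=.
have [<-|FG] := eqVneq F G.
  rewrite setIid cF /= (_ : (k.+1 == k) = false) //=; last by apply/eqP; lia.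
  by rewrite big1 // => s _; rewrite mulr0.
case: ifP => [/andP[cI iS]|nI].
  rewrite (bigD1 (F :&: G)) //= iS mulr1 big1 ?addr0 // => s /andP[cs sI].
  have [->|Fs] := eqVneq (incidence F s) 0; first by rewrite !mul0r.
  have [->|Gs] := eqVneq (incidence G s) 0; first by rewrite mulr0 mul0r.
  have [u [v [uv us vs [Fu Gv]]]] := incidence_pair_eq cF FG Fs Gs.
  by rewrite Fu Gv setI_U1 // eqxx in sI.
rewrite big1 // => s cs.
have [->|Fs] := eqVneq (incidence F s) 0; first by rewrite !mul0r.
have [->|Gs] := eqVneq (incidence G s) 0; first by rewrite mulr0 mul0r.
have [u [v [uv us vs [Fu Gv]]]] := incidence_pair_eq cF FG Fs Gs.
by move: nI; rewrite Fu Gv setI_U1 // cs /= => ->; rewrite mulr0.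
Qed.

Lemma deg_sum S F : #|F| = k.+1 -> (deg S F)%:R = \sum_(H in S) incidence (val H) F ^+ 2.
Proof.
move=> cF; rewrite /deg -sum1_card natr_sum big_mkcond [RHS]big_mkcond /=.
apply: eq_bigr => H _; rewrite inE; case: ifP => //= HS; first case: ifP.
- case/andP: HS => -> FH; move=> _.
  have /incidence_neq0 [v vs ->] : incidence (val H) F != 0; last by rewrite incidence_sqr.
  by apply: incidence_subset; rewrite // (eqP (valP H)) cF.
- by case/andP: HS => ->.
- case: ifP => // HS'; rewrite HS' /= in HS.
  by rewrite /incidence HS /= expr0n.
Qed.

(** The identity [D - A = delta^T delta], entry by entry: a top face above two distinct faces is
    their union, and the sign comes from [incidence_square]. *)
Lemma up_laplacian_entry S F G : #|F| = k.+1 -> #|G| = k.+1 ->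
  (deg S F)%:R * (F == G)%:R - adj_entry S F G =
  \sum_(H in S) incidence (val H) F * incidence (val H) G.
Proof.
move=> cF cG; have [<-|FG] := eqVneq F G.
  rewrite mulr1 deg_sum // /adj_entry setIid cF (_ : (k.+1 == k.+1.-1) = false) /=; last by apply/eqP; lia.
  by rewrite subr0; apply: eq_bigr => H _; rewrite expr2.
rewrite mulr0 sub0r.
have onlyH (H : faces n k.+2) : incidence (val H) F != 0 -> incidence (val H) G != 0 ->
    [/\ val H = F :|: G, #|F :&: G| = k &
     incidence (val H) F * incidence (val H) G =
     - (incidence F (F :&: G) * incidence G (F :&: G))].
  move=> HF HG.
  have [u uF HEF] := incidence_neq0 HF; have [v vG HEG] := incidence_neq0 HG.
  have HU : val H = F :|: G.
    apply/eqP; rewrite eqEcard; apply/andP; split; last first.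
      by apply: subset_leq_card; rewrite subUset {1}HEF HEG !subsetUr.
    rewrite HEF; apply/subsetP => w; rewrite !inE => /orP[/eqP ->|->] //.
    have := setU11 u F; rewrite -HEF HEG !inE => /orP[/eqP uv|->]; last by rewrite orbT.
    exfalso; move/negP: FG; apply; apply/eqP.
    have : u |: F = u |: G by rewrite -HEF HEG uv.
    move/(congr1 (fun X => X :\ u)); rewrite !setU1K // uv //.
  have cI : #|F :&: G| = k.
    have := cardsU F G; rewrite -HU (eqP (valP H)) cF cG.
    have := card_setI_lt cF cG FG; lia.
  split=> //; have uv : u != v.
    apply: contraNneq FG => uv; have : u |: F = u |: G by rewrite -HEF HEG uv.
    by move/(congr1 (fun X => X :\ u)); rewrite !setU1K // => [->|] //; rewrite uv.
  set s := F :&: G.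
  have uG : u \in G by move: (setU11 u F); rewrite -HEF HEG !inE (negbTE uv).
  have vF : v \in F by move: (setU11 v G); rewrite -HEG HEF !inE eq_sym (negbTE uv).
  have us : u \notin s by rewrite inE (negbTE uF).
  have vs : v \notin s by rewrite inE (negbTE vG) andbF.
  have Fs : F = v |: s.
    apply/eqP; rewrite eq_sym eqEcard cardsU1 vs cI cF add1n leqnn andbT.
    by rewrite subUset sub1set vF subsetIl.
  have Gs : G = u |: s.
    apply/eqP; rewrite eq_sym eqEcard cardsU1 us cI cG add1n leqnn andbT.
    by rewrite subUset sub1set uG subsetIr.
  rewrite HEF {1 2 3}Fs Gs incidence_square // 1?eq_sym // -Fs -Gs //.
rewrite /adj_entry /= -/(in_complex S _).
have zero (H : faces n k.+2) : (incidence (val H) F == 0) || (incidence (val H) G == 0) ->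
   incidence (val H) F * incidence (val H) G = 0.
  by case/orP => /eqP ->; rewrite ?mul0r ?mulr0.
case: ifP => [/andP[/eqP cI /exists_inP [H HS /eqP HE]]|nI].
  rewrite (bigD1 H) //= big1 ?addr0.
    have cases : (incidence (val H) F != 0) /\ (incidence (val H) G != 0).
      have cH := eqP (valP H); rewrite /= in cH.
      by split; apply: incidence_subset; rewrite ?cH ?cF ?cG // HE ?subsetUl ?subsetUr.
    by have [_ _ ->] := onlyH _ cases.1 cases.2.
  move=> H' /andP[H'S H'H]; apply: zero; apply/norP => -[HF HG].
  have [HE' _ _] := onlyH _ HF HG; case/eqP: H'H; apply: val_inj; by rewrite HE HE'.
rewrite oppr0 big1 // => H HS; apply: zero; apply/norP => -[HF HG].
have [HE cI _] := onlyH _ HF HG; move/negP: nI; apply; rewrite cI eqxx /=.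
by apply/exists_inP; exists H => //; apply/eqP.
Qed.

End LaplacianEntries.

(** * Coboundaries and links *)

Lemma bigD1_single (I : finType) (i : I) (f : I -> R) :
  (forall j, j != i -> f j = 0) -> \sum_j f j = f i.
Proof. by move=> f0; rewrite (bigD1 i) //= big1 ?addr0. Qed.

(** In a rank factorisation [P = C R], idempotence gives [R C = 1], whose trace is the rank. *)
Lemma mxrank_idempotent (F : numFieldType) m (P : 'M[F]_m) :
  P *m P = P -> (\rank P)%:R = \tr P.
Proof.
move=> PP; rewrite -{2}(mulmx_base P) mxtrace_mulC.
suff -> : row_base P *m col_base P = 1%:M by rewrite mxtrace1.
have : col_base P *m (row_base P *m col_base P) *m row_base P = col_base P *m 1%:M *m row_base P.
  by rewrite mulmx1 mulmxA -[LHS]mulmxA !mulmx_base PP.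
move/(row_free_inj (row_base_free P)).
have /row_fullP [Q QC] := col_base_full P.
by move/(congr1 (mulmx Q)); rewrite (mulmxA Q) QC mul1mx mulmx1 QC.
Qed.

Section FaceMatrices.
Variable n : nat.

Definition face m (i : 'I_(Nk n m)) : {set 'I_n} := val (@enum_val (faces n m) predT i).

Lemma card_face m (i : 'I_(Nk n m)) : #|face i| = m.
Proof. exact: eqP (valP (@enum_val (faces n m) predT i)). Qed.

Lemma face_inj m : injective (@face m).
Proof. by move=> i j /val_inj /enum_val_inj. Qed.

Lemma sum_face m (phi : {set 'I_n} -> R) :
  \sum_(i < Nk n m) phi (face i) = \sum_(F : {set 'I_n} | #|F| == m) phi F.
Proof. by rewrite -sum_faces (big_enum_val (A := {: faces n m})). Qed.

Lemma Nk_binom m : Nk n m = 'C(n, m).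
Proof.
rewrite /Nk card_sig -[n in 'C(n, _)]card_ord -cardsT -cards_draws.
by apply: eq_card => F; rewrite !inE subsetT.
Qed.

Variable k : nat.
Notation N := (Nk n k.+1).
Notation N' := (Nk n k).
Implicit Types (S : {set faces n k.+2}).

Definition cob_mx : 'M[R]_(N, N') := \matrix_(i, j) incidence (face i) (face j).
Definition deg_mx S : 'M[R]_N := diag_mx (\row_i (deg S (face i))%:R).
(** The coboundary to the faces of [S], padded by zero rows so that its size does not depend on
    [S]. *)
Definition up_mx S : 'M[R]_(Nk n k.+2, N) :=
  \matrix_(h, i) if @enum_val (faces n k.+2) predT h \in S then incidence (face h) (face i) else 0.

Lemma deg_sub_adjacency S : deg_mx S - adjacency_mx S = (up_mx S)^T *m up_mx S.
Proof.
apply/matrixP => i j; rewrite !mxE.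
transitivity ((deg S (face i))%:R * (face i == face j)%:R - adj_entry S (face i) (face j)).
  by congr (_ - _); rewrite (inj_eq (@face_inj _)) mulr_natr.
rewrite up_laplacian_entry ?card_face // big_mkcond (big_enum_val (A := {: faces n k.+2})).
by apply: eq_bigr => h _; rewrite !mxE /face /=; case: ifP; rewrite ?mulr0.
Qed.

Lemma up_mx_cob S : up_mx S *m cob_mx = 0.
Proof.
apply/matrixP => h j; rewrite !mxE; case: (boolP (@enum_val (faces n k.+2) predT h \in S)) => hS.
  rewrite -[RHS](coboundary_sqr0 (face h) (card_face j)).
  rewrite -(sum_face k.+1 (fun G => incidence (face h) G * incidence G (face j))).
  by apply: eq_bigr => i _; rewrite !mxE hS.
by rewrite big1 // => i _; rewrite !mxE (negbTE hS) mul0r.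
Qed.

Lemma adjacency_cob S : adjacency_mx S *m cob_mx = deg_mx S *m cob_mx.
Proof.
apply/eqP; rewrite eq_sym -subr_eq0 -mulmxBl deg_sub_adjacency.
by rewrite -mulmxA up_mx_cob mulmx0.
Qed.

Lemma adjacency_sym S : (adjacency_mx S)^T = adjacency_mx S.
Proof.
have E : adjacency_mx S = deg_mx S - (up_mx S)^T *m up_mx S.
  by rewrite -deg_sub_adjacency opprB addrC subrK.
by rewrite E linearB /= tr_diag_mx trmx_mul trmxK.
Qed.

Lemma in_complex_full (s F G : {set 'I_n}) : #|s| = k -> #|F| = k.+1 -> F != G ->
  incidence F s != 0 -> incidence G s != 0 ->
  in_complex (setT : {set faces n k.+2}) (F :|: G).
Proof.
move=> cs cF FG Fs Gs.
have [u [v [uv us vs [Fu Gv]]]] := incidence_pair_eq cF FG Fs Gs.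
have cH : #|F :|: G| == k.+2.
  rewrite Fu Gv setUACA setUid cardsU cards2 uv cs.
  have -> : [set u; v] :&: s = set0; last by rewrite cards0.
  apply/setP => w; rewrite !inE; case: eqP => [->|_]; first by rewrite (negbTE us) andbF.
  by case: eqP => [->|]; rewrite ?(negbTE vs).
by apply/exists_inP; exists (Sub (F :|: G) cH); rewrite ?inE.
Qed.

Lemma adj_entry_centered S (p : R) (F G : {set 'I_n}) : #|F| = k.+1 -> #|G| = k.+1 ->
  adj_entry S F G - p * adj_entry (setT : {set faces n k.+2}) F G =
  \sum_(s : {set 'I_n} | #|s| == k) incidence F s * incidence G s *
    (if F == G then 0 else (in_complex S (F :|: G))%:R - p).
Proof.
move=> cF cG; rewrite !adj_entryE // mulr_sumr -sumrB; apply: eq_bigr => s /eqP cs.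
case: ifP => [_|/negbT FG]; first by rewrite !mulr0 subr0.
have [->|Fs] := eqVneq (incidence F s) 0; first by rewrite !mul0r mulr0 subr0.
have [->|Gs] := eqVneq (incidence G s) 0; first by rewrite !(mulr0, mul0r) subr0.
by rewrite (in_complex_full cs cF FG Fs Gs) mulr1 mulrBr [p * _]mulrC.
Qed.

Lemma adjacency_full :
  adjacency_mx (setT : {set faces n k.+2}) = cob_mx *m cob_mx^T - (k.+1%:R)%:M.
Proof.
apply/matrixP => i j; rewrite !mxE -/(face i) -/(face j) adj_entryE ?card_face //.
have -> : \sum_j0 cob_mx i j0 * cob_mx^T j0 j =
   \sum_(s : {set 'I_n} | #|s| == k) incidence (face i) s * incidence (face j) s.
  rewrite -(sum_face k (fun s => incidence (face i) s * incidence (face j) s)).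
  by apply: eq_bigr => l _; rewrite !mxE.
have [<-|ij] := eqVneq i j.
  rewrite eqxx big1 => [|s _]; last by rewrite mulr0.
  under eq_bigr do rewrite -expr2.
  by rewrite sum_incidence_sqr_down ?card_face // mulr1n subrr.
rewrite mulr0n subr0 (inj_eq (@face_inj _)) (negbTE ij); apply: eq_bigr => s /eqP cs.
have [->|Fs] := eqVneq (incidence (face i) s) 0; first by rewrite !mul0r.
have [->|Gs] := eqVneq (incidence (face j) s) 0; first by rewrite !(mulr0, mul0r).
by rewrite (in_complex_full cs _ _ Fs Gs) ?card_face ?mulr1 // (inj_eq (@face_inj _)).
Qed.

Lemma deg_full : deg_mx setT = ((n - k.+1)%:R)%:M.
Proof.
apply/matrixP => i j; rewrite !mxE; congr (_ *+ _).
rewrite deg_sum ?card_face //.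
rewrite (eq_bigl xpredT) => [|H]; last by rewrite inE.
by rewrite (sum_faces k.+2 (fun H => incidence H (face i) ^+ 2)) sum_incidence_sqr_up ?card_face.
Qed.

Hypothesis kn : (k.+1 <= n)%N.

Definition cob_proj : 'M[R]_N := n%:R^-1 *: (cob_mx *m cob_mx^T).

Let n0 : n%:R != 0 :> R. Proof. by rewrite pnatr_eq0 -lt0n (leq_trans _ kn). Qed.

Lemma proj_sym : cob_proj^T = cob_proj.
Proof. by rewrite /cob_proj linearZ /= trmx_mul trmxK. Qed.

(** On coboundaries the adjacency matrix of the complete complex, which is
    [delta delta^T - (k + 1)], agrees with its degree matrix [n - k - 1]; hence [delta delta^T] acts
    on them as [n]. *)
Lemma proj_cob : cob_proj *m cob_mx = cob_mx.
Proof.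
have := adjacency_cob setT; rewrite adjacency_full deg_full mulmxBl !mul_scalar_mx => /eqP.
rewrite subr_eq -scalerDl -natrD subnK // => /eqP E.
by rewrite /cob_proj -scalemxAl E scalerA mulVf // scale1r.
Qed.

Lemma proj_idem : cob_proj *m cob_proj = cob_proj.
Proof. by rewrite {2}/cob_proj -scalemxAr mulmxA proj_cob. Qed.

Lemma adjacency_fullE :
  adjacency_mx (setT : {set faces n k.+2}) = n%:R *: cob_proj - (k.+1%:R)%:M.
Proof. by rewrite adjacency_full /cob_proj scalerA divff // scale1r. Qed.

(** The trace is read off the diagonal of [delta delta^T], all of whose ['C(n, k.+1)] entries are
    [k + 1]. *)
Lemma rank_proj : \rank cob_proj = 'C(n.-1, k).
Proof.
apply/eqP; rewrite -(eqr_nat R) mxrank_idempotent ?proj_idem // /cob_proj mxtraceZ.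
have -> : \tr (cob_mx *m cob_mx^T) = (k.+1 * 'C(n, k.+1))%:R.
  rewrite -Nk_binom mulnC natrM mulr_natl -[Nk _ _ in RHS]card_ord -sumr_const /mxtrace.
  apply: eq_bigr => i _; rewrite mxE -[RHS](sum_incidence_sqr_down (card_face i)).
  rewrite -(sum_face k (fun s => incidence (face i) s ^+ 2)).
  by apply: eq_bigr => j _; rewrite !mxE expr2.
by rewrite -mul_bin_diag natrM mulrA mulVf // mul1r.
Qed.

Lemma rank_proj_compl : \rank (1%:M - cob_proj) = (N - 'C(n.-1, k))%N.
Proof.
have E : (1%:M - cob_proj) *m (1%:M - cob_proj) = 1%:M - cob_proj.
  by rewrite mulmxBl mul1mx mulmxBr mulmx1 proj_idem subrr subr0.
have rN : ('C(n.-1, k) <= N)%N by rewrite -rank_proj rank_leq_row.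
apply/eqP; rewrite -(eqr_nat R) mxrank_idempotent // linearB /= mxtrace1.
by rewrite -mxrank_idempotent ?proj_idem // rank_proj natrB.
Qed.

Lemma rank_cob : \rank cob_mx^T = 'C(n.-1, k).
Proof.
rewrite mxrank_tr; apply/eqP; rewrite eqn_leq; apply/andP; split.
  by rewrite -rank_proj -{1}proj_cob mxrankM_maxl.
rewrite -rank_proj /cob_proj mxrank_scale_nz ?invr_eq0 //; exact: mxrankM_maxl.
Qed.

(** All links live on the full vertex set, with zero rows and columns at the vertices of [s]. *)
Definition link_mx S (p : R) (s : {set 'I_n}) : 'M[R]_n :=
  \matrix_(u, v) if [&& u != v, u \notin s & v \notin s]
                 then (in_complex S ([set u; v] :|: s))%:R - p else 0.

(* Garland's localisation: the quadratic form on [k]-faces is the sum of the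
   quadratic forms of the links of the faces [s] one dimension below. *)
Lemma garland_bound S (p th : R) : 
  (forall s : {set 'I_n}, #|s| = k ->
     forall x, `|qform (link_mx S p s) x| <= th * sqnorm x) ->
  forall x, `|qform (adjacency_mx S - p *: adjacency_mx setT) x| <= k.+1%:R * th * sqnorm x.
Proof.
move=> links x.
pose f (F : {set 'I_n}) := \sum_i x 0 i * (face i == F)%:R.
have fE i : f (face i) = x 0 i.
  rewrite /f (bigD1_single (i := i)) ?eqxx ?mulr1 // => j /negbTE ji.
  by rewrite (inj_eq (@face_inj _)) ji mulr0.
(* The cochain localised at [s]; the incidence signs absorbed here turn the signed adjacency into
   the unsigned one of the link. *)
pose y (s : {set 'I_n}) : 'rV[R]_n :=
  \row_u if u \notin s then incidence (u |: s) s * f (u |: s) else 0.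
pose g (F G : {set 'I_n}) : R := if F == G then 0 else (in_complex S (F :|: G))%:R - p.
have quad : qform (adjacency_mx S - p *: adjacency_mx setT) x =
    \sum_(s : {set 'I_n} | #|s| == k) qform (link_mx S p s) (y s).
  have ent i j : (adjacency_mx S - p *: adjacency_mx setT) i j =
      \sum_(s : {set 'I_n} | #|s| == k) incidence (face i) s * incidence (face j) s * g (face i) (face j).
    by rewrite !mxE -/(face i) -/(face j) adj_entry_centered ?card_face.
  rewrite qformE.
  transitivity (\sum_(s : {set 'I_n} | #|s| == k)
     \sum_(i < N) \sum_(j < N) incidence (face i) s * (incidence (face j) s * (f (face i) * f (face j) * g (face i) (face j)))).
    rewrite [RHS]exchange_big /=; apply: eq_bigr => i _.
    rewrite [RHS]exchange_big /=; apply: eq_bigr => j _.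
    rewrite ent mulr_sumr mulr_suml; apply: eq_bigr => s _; rewrite !fE; ring.
  apply: eq_bigr => s /eqP cs.
  rewrite (sum_face k.+1 (fun F => \sum_(j < N) incidence F s * (incidence (face j) s * (f F * f (face j) * g F (face j))))).
  under eq_bigr do rewrite -mulr_sumr (sum_face k.+1 (fun G => incidence G s * (f _ * f G * g _ G))).
  rewrite (sum_incidence_up (fun F => \sum_(G : {set 'I_n} | #|G| == k.+1) incidence G s * (f F * f G * g F G)) cs).
  under eq_bigr do rewrite (sum_incidence_up (fun G => f _ * f G * g _ G) cs).
  rewrite qformE big_mkcond /=; apply: eq_bigr => u _; rewrite !mxE.
  case: (boolP (u \notin s)) => us; last by rewrite big1 // => v _; rewrite !mul0r.
  rewrite mulr_sumr big_mkcond /=; apply: eq_bigr => v _; rewrite !mxE us /=.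
  case: (boolP (v \notin s)) => vs; last by rewrite !mulr0.
  rewrite andbT /g; have -> : (u |: s) :|: (v |: s) = [set u; v] :|: s.
    by rewrite setUACA setUid.
  have -> : (u |: s == v |: s) = (u == v).
    apply/eqP/eqP => [E|->] //; have := setU11 u s; rewrite E !inE (negbTE us) orbF.
    by move/eqP.
  by case: eqP => _ /=; ring.
(* Each face has [k + 1] facets, so its coordinate is counted [k + 1] times. *)
have normy : \sum_(s : {set 'I_n} | #|s| == k) sqnorm (y s) = k.+1%:R * sqnorm x.
  transitivity (\sum_(s : {set 'I_n} | #|s| == k) \sum_(F : {set 'I_n} | #|F| == k.+1) incidence F s ^+ 2 * f F ^+ 2).
    apply: eq_bigr => s /eqP cs; rewrite sqnormE.
    under [RHS]eq_bigr do rewrite expr2 -mulrA.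
    rewrite (sum_incidence_up (fun F => incidence F s * f F ^+ 2) cs) [RHS]big_mkcond /=.
    by apply: eq_bigr => u _; rewrite mxE; case: ifP => _; rewrite ?expr0n //; ring.
  rewrite exchange_big /= sqnormE mulr_sumr.
  transitivity (\sum_(F : {set 'I_n} | #|F| == k.+1) k.+1%:R * f F ^+ 2).
    by apply: eq_bigr => F /eqP cF; rewrite -mulr_suml sum_incidence_sqr_down.
  by rewrite -(sum_face k.+1 (fun F => k.+1%:R * f F ^+ 2)); apply: eq_bigr => i _; rewrite fE.
rewrite quad -mulrA [th * _]mulrC mulrA -normy mulr_suml.
apply: le_trans (ler_norm_sum _ _ _) _; apply: ler_sum => s /eqP cs.
by rewrite mulrC; exact: links.
Qed.

End FaceMatrices.

(** * Spectra from an operator norm bound *)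

Section Forms.
Variable F : rcfType.

Definition bform n (A : 'M[F]_n) (x y : 'rV[F]_n) : F := (x *m A *m y^T) 0 0.

Lemma qformD n (A B : 'M[F]_n) x : qform (A + B) x = qform A x + qform B x.
Proof. by rewrite /qform mulmxDr mulmxDl mxE. Qed.

Lemma qformZ n a (A : 'M[F]_n) x : qform (a *: A) x = a * qform A x.
Proof. by rewrite /qform -scalemxAr -scalemxAl mxE. Qed.

Lemma qform_scalar n (a : F) (x : 'rV[F]_n) : qform a%:M x = a * sqnorm x.
Proof. by rewrite /qform mul_mx_scalar -scalemxAl mxE. Qed.

Lemma bform_sym n (A : 'M[F]_n) x y : A^T = A -> bform A x y = bform A y x.
Proof.
move=> symA; rewrite /bform -[LHS]/((_ : 'M_1) 0 0) -[in LHS](trmxK (x *m A *m y^T)) mxE.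
by rewrite !trmx_mul trmxK symA mulmxA.
Qed.

Lemma qform_add n (A : 'M[F]_n) x y : A^T = A ->
  qform A (x + y) = qform A x + qform A y + 2 * bform A x y.
Proof.
move=> symA; have := bform_sym x y symA.
rewrite /qform /bform linearD /= mulmxDl mulmxDr !mulmxDl !mxE => E; rewrite -E; ring.
Qed.

Lemma sqnormZ n a (x : 'rV[F]_n) : sqnorm (a *: x) = a ^+ 2 * sqnorm x.
Proof. by rewrite /sqnorm linearZ /= -scalemxAl -scalemxAr !mxE mulrA expr2. Qed.

Lemma sqnorm_scalar1 n (x : 'rV[F]_n) : sqnorm x = qform 1%:M x.
Proof. by rewrite qform_scalar mul1r. Qed.

Lemma qform_opp n (A : 'M[F]_n) x : qform A (- x) = qform A x.
Proof. by rewrite /qform linearN /= mulNmx mulNmx mulmxN opprK. Qed.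

Lemma bformZl n (A : 'M[F]_n) a x y : bform A (a *: x) y = a * bform A x y.
Proof. by rewrite /bform -!scalemxAl mxE. Qed.

Lemma bformNr n (A : 'M[F]_n) x y : bform A x (- y) = - bform A x y.
Proof. by rewrite /bform linearN /= mulmxN mxE. Qed.

(** Polarisation: the forms at [t x + y] and [t x - y] are compared. The free weight [t] balances
    vectors of unequal length. *)
Lemma bform_bound n (A : 'M[F]_n) (K t : F) x y : A^T = A ->
  (forall z, `|qform A z| <= K * sqnorm z) ->
  2 * t * - bform A x y <= K * (t ^+ 2 * sqnorm x + sqnorm y).
Proof.
move=> symA bnd; pose u := t *: x.
have h1 := bnd (u + y); have h2 := bnd (u - y).
rewrite !ler_norml in h1 h2.
move: h1 h2; rewrite !sqnorm_scalar1 !qform_add ?trmx1 // !qform_opp !bformNr.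
rewrite -!sqnorm_scalar1 /u !bformZl sqnormZ.
set a := qform A _; set b := qform A y; set c := bform 1%:M _ _; set e := bform A x y.
move=> /andP[h1 _] /andP[_ h2]; lra.
Qed.

End Forms.

Lemma sub_idempotent (F : fieldType) m n (P : 'M[F]_n) (x : 'M[F]_(m, n)) :
  P *m P = P -> (x <= P)%MS -> x *m P = x.
Proof. by move=> PP /submxP [y ->]; rewrite -mulmxA PP. Qed.

Section Deterministic.
Variables (n k : nat) (S : {set faces n k.+2}) (p K : R).
Hypothesis kn : (k.+1 <= n)%N.
Hypothesis p01 : 0 <= p <= 1.
Hypothesis K0 : 0 < K.

Local Notation A := (adjacency_mx S).
Local Notation AK := (adjacency_mx (setT : {set faces n k.+2})).
Local Notation Pi := (cob_proj n k).
Local Notation M := (A - p *: AK).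
Local Notation d := (p * (n%:R - k.+1%:R)).
Hypothesis Mbound : forall x, `|qform M x| <= K * sqnorm x.

Lemma qform_adjacency x :
  qform A x = qform M x + p * (n%:R * qform Pi x - k.+1%:R * sqnorm x).
Proof.
transitivity (qform (M + p *: AK) x); first by rewrite subrK.
rewrite qformD [qform (p *: _) _]qformZ adjacency_fullE //; congr (_ + p * _).
by rewrite qformD qformZ qformN qform_scalar.
Qed.

Lemma qform_proj x : qform Pi x = sqnorm (x *m Pi).
Proof.
by rewrite /qform /sqnorm trmx_mul proj_sym mulmxA -[x *m Pi *m Pi]mulmxA proj_idem.
Qed.

Lemma qform_proj_range x : 0 <= qform Pi x <= sqnorm x.
Proof.
rewrite qform_proj sqnorm_ge0 /=.
have -> : sqnorm x = sqnorm (x *m Pi) + sqnorm (x - x *m Pi).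
  rewrite -qform_proj /sqnorm linearB /= mulmxBl !mulmxBr trmx_mul proj_sym.
  rewrite !mulmxA -[x *m Pi *m Pi]mulmxA proj_idem // subrr subr0 /qform !mxE; ring.
by rewrite lerDl sqnorm_ge0.
Qed.

(** The test spaces are the coboundaries and their orthogonal complement. The form of [A] is that of
    [M] plus [p n |Pi x|^2 - p (k + 1) |x|^2]; the last two terms give exactly [d |x|^2] on
    coboundaries and cost at most [(k + 1) |x|^2] on the complement. *)
Lemma property_i_bound (gA : R) : K + k.+1%:R <= gA -> property_i S d gA.
Proof.
move=> gAK; have /andP[p0 p1] := p01.
have kn' : k.+1%:R <= n%:R :> R by rewrite ler_nat.
have k0 : 0 <= k.+1%:R :> R by rewrite ler0n.
have [lam [dec cp bnds]] : exists lam : 'I_(Nk n k.+1) -> R,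
    [/\ forall i j : 'I_(Nk n k.+1), (i <= j)%N -> lam j <= lam i,
        char_poly A = \prod_(i < Nk n k.+1) ('X - (lam i)%:P)
      & forall i : 'I_(Nk n k.+1), ((i < 'C(n.-1, k))%N -> d - gA <= lam i <= d + gA) /\
                         (~~ (i < 'C(n.-1, k))%N -> - gA <= lam i <= gA)].
  have scal (x : 'rV_(Nk n k.+1)) : K * sqnorm x + k.+1%:R * sqnorm x <= gA * sqnorm x.
    by rewrite -mulrDl ler_wpM2r ?sqnorm_ge0.
  have pk (x : 'rV_(Nk n k.+1)) : 0 <= p * (k.+1%:R * sqnorm x) <= k.+1%:R * sqnorm x.
    by rewrite mulr_ge0 ?mulr_ge0 ?sqnorm_ge0 //= ler_piMl ?mulr_ge0 ?sqnorm_ge0.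
  apply: (@split_spectrum _ _ _ _ _ A Pi (1%:M - Pi)).
  - exact: adjacency_sym.
  - by rewrite rank_proj.
  - by rewrite rank_proj_compl.
  - move=> x xP; have := Mbound x; rewrite ler_norml => /andP[lb _].
    rewrite qform_adjacency qform_proj sub_idempotent ?proj_idem //.
    have := scal x; have := pk x; set q := qform M x in lb *; set s := sqnorm x in lb *.
    have -> : p * (n%:R * s - k.+1%:R * s) = d * s by ring.
    move=> /andP[h1 h2] h3; rewrite mulrBl; lra.
  - move=> x /submxP[y xE]; have := Mbound x; rewrite ler_norml => /andP[_ ub].
    rewrite qform_adjacency qform_proj.
    have -> : x *m Pi = 0 by rewrite xE -mulmxA mulmxBl mul1mx proj_idem // subrr mulmx0.
    rewrite {1}/sqnorm mul0mx mxE mulr0 sub0r.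
    have := scal x; have := pk x; move=> /andP[h1 h2] h3; rewrite mulrN; lra.
  - move=> x; have := Mbound x; rewrite ler_norml => /andP[lb ub].
    have /andP[q0 q1] := qform_proj_range x.
    rewrite qform_adjacency; have := scal x; have := pk x => /andP[h1 h2] h3.
    set q := qform Pi x in q0 q1 *.
    have h4 : 0 <= p * (n%:R * q) by rewrite mulr_ge0 ?mulr_ge0.
    have h5 : p * (n%:R * q) <= p * (n%:R * sqnorm x) by rewrite ler_wpM2l ?ler_wpM2l.
    have h6 : p * (n%:R * sqnorm x) = d * sqnorm x + p * (k.+1%:R * sqnorm x) by ring.
    rewrite mulrBr mulrDl mulNr; apply/andP; split; lra.
by exists lam.
Qed.

Hypothesis d0 : 0 < d.
Variable delta : R.
Hypothesis delta0 : 0 < delta.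
Hypothesis degS : forall F : {set 'I_n}, #|F| = k.+1 -> delta <= (deg S F)%:R.

Local Notation eta := ((K + k.+1%:R + K ^+ 2 / d) / delta).
Local Notation D := (deg_mx S).
Local Notation N := (Nk n k.+1).
Local Notation cob := (cob_mx n k).

Lemma tr_deg_mx : D^T = D. Proof. exact: tr_diag_mx. Qed.

Lemma tr_cob_deg : cob^T *m A = cob^T *m D.
Proof.
by have := congr1 trmx (adjacency_cob S); rewrite !trmx_mul adjacency_sym tr_deg_mx.
Qed.

(* For a coboundary [g], [g D = g A] and [g AK = (n - k - 1) g], hence [d |g|^2 = - <g M, f>]
   when [g] is the projection of [f]. *)
Lemma proj_small f : f *m D *m cob = 0 -> d * sqnorm (f *m Pi) <= K ^+ 2 / d * sqnorm f.
Proof.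
move=> fD; set g := f *m Pi.
have gD : g *m A = g *m D.
  by rewrite /g /cob_proj -!scalemxAr -!scalemxAl !mulmxA -2!(mulmxA _ cob^T) tr_cob_deg.
have gAK : g *m AK = (n%:R - k.+1%:R) *: g.
  rewrite adjacency_fullE // mulmxBr -scalemxAr /g -mulmxA proj_idem // mul_mx_scalar.
  by rewrite -scalerBl.
have gf : (g *m f^T) 0 0 = sqnorm g.
  by rewrite -qform_proj /g /qform.
have gDf : (g *m D *m f^T) 0 0 = 0.
  have : f *m D *m g^T = 0.
    rewrite /g trmx_mul proj_sym /cob_proj -scalemxAl -scalemxAr !mulmxA fD.
    by rewrite !mul0mx scaler0.
  move/(congr1 trmx); rewrite trmx_mul trmxK trmx_mul tr_deg_mx trmx0 mulmxA => ->.
  by rewrite mxE.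
have bE : - bform M g f = d * sqnorm g.
  rewrite /bform; have -> : g *m M *m f^T = g *m D *m f^T - d *: (g *m f^T).
    by rewrite mulmxBr mulmxBl -scalemxAr gD gAK scalerA -scalemxAl.
  by rewrite mxE gDf add0r mxE mxE gf opprK.
have symM : M^T = M by rewrite linearB linearZ /= !adjacency_sym.
(* With the weight [d / K] the term in [|g|^2] on the right is half of the left-hand side and is
   absorbed. *)
have := bform_bound (d / K) g f symM Mbound.
rewrite bE => h; have {}h : d * sqnorm g * (d / K) <= K * sqnorm f.
  move: h; have -> : K * ((d / K) ^+ 2 * sqnorm g + sqnorm f) =
     d * sqnorm g * (d / K) + K * sqnorm f by field; rewrite gt_eqF.
  by rewrite -mulrA [d / K * _]mulrC mulr_natl mulr2n lerD2l.
have -> : K ^+ 2 / d * sqnorm f = K * sqnorm f / (d / K).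
  by move: d0; set dd := d => dd0; field; rewrite !gt_eqF.
by rewrite ler_pdivlMr ?divr_gt0.
Qed.

(** * The up Laplacian in symmetric form *)

Definition half_deg : 'M[R]_N := diag_mx (\row_i Num.sqrt (deg S (face i))%:R).
Definition half_deg_inv : 'M[R]_N := diag_mx (\row_i (Num.sqrt (deg S (face i))%:R)^-1).

Lemma deg_gt0 (i : 'I_N) : 0 < (deg S (face i))%:R :> R.
Proof. by apply: lt_le_trans delta0 (degS _); rewrite card_face. Qed.

Lemma sqrt_deg_neq0 (i : 'I_N) : Num.sqrt (deg S (face i))%:R != 0 :> R.
Proof. by rewrite gt_eqF // sqrtr_gt0 deg_gt0. Qed.

Lemma half_degK : half_deg *m half_deg_inv = 1%:M.
Proof.
rewrite mulmx_diag -diag_const_mx; congr diag_mx; apply/rowP => i; rewrite !mxE.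
by rewrite divff ?sqrt_deg_neq0.
Qed.

Lemma half_deg_invK : half_deg_inv *m half_deg = 1%:M.
Proof. exact: mulmx1C half_degK. Qed.

Lemma half_deg_sqr : half_deg *m half_deg = D.
Proof.
rewrite mulmx_diag; congr diag_mx; apply/rowP => i; rewrite !mxE -expr2.
by rewrite sqr_sqrtr ?ler0n.
Qed.

(** [up_laplacian_mx] is self-adjoint for the degree-weighted product; conjugation by the square
    roots of the degrees gives this symmetric matrix with the same characteristic polynomial. A
    cochain [f] corresponds to [f *m half_deg]. *)
Definition sym_laplacian : 'M[R]_N := 1%:M - half_deg_inv *m A *m half_deg_inv.

Lemma sym_laplacian_sym : sym_laplacian^T = sym_laplacian.
Proof.
by rewrite /sym_laplacian linearB /= trmx1 !trmx_mul tr_diag_mx adjacency_sym mulmxA.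
Qed.

Lemma up_laplacianE : up_laplacian_mx S = half_deg_inv *m sym_laplacian *m half_deg.
Proof.
rewrite /sym_laplacian mulmxBr mulmx1 mulmxBl half_deg_invK !mulmxA.
rewrite -(mulmxA _ half_deg_inv half_deg) half_deg_invK mulmx1.
have -> : half_deg_inv *m half_deg_inv = diag_mx (\row_i (deg S (face i))%:R^-1).
  rewrite mulmx_diag; congr diag_mx; apply/rowP => i; rewrite !mxE -invfM -expr2.
  by rewrite sqr_sqrtr ?ler0n.
by rewrite mul_diag_mx; apply/matrixP => i j; rewrite !mxE.
Qed.

Lemma qform_sym_laplacian (f : 'rV[R]_N) :
  qform sym_laplacian (f *m half_deg) = sqnorm (f *m half_deg) - qform A f.
Proof.
rewrite /sym_laplacian qformD qform_scalar mul1r qformN; congr (_ - _).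
rewrite /qform !mulmxA -(mulmxA f) half_degK mulmx1 trmx_mul tr_diag_mx.
by rewrite !mulmxA -(mulmxA _ half_deg_inv half_deg) half_deg_invK mulmx1.
Qed.

Lemma sqnorm_half_deg (f : 'rV[R]_N) : sqnorm (f *m half_deg) = qform D f.
Proof.
by rewrite /sqnorm /qform trmx_mul tr_diag_mx !mulmxA -(mulmxA f) half_deg_sqr.
Qed.

Lemma sqnorm_half_deg_ge (f : 'rV[R]_N) : delta * sqnorm f <= sqnorm (f *m half_deg).
Proof.
rewrite !sqnormE mulr_sumr; apply: ler_sum => i _.
rewrite mul_mx_diag !mxE exprMn sqr_sqrtr ?ler0n // mulrC ler_wpM2l ?sqr_ge0 //.
by apply: degS; rewrite card_face.
Qed.

Lemma sym_laplacian_ge0 x : 0 <= qform sym_laplacian x.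
Proof.
have -> : x = (x *m half_deg_inv) *m half_deg by rewrite -mulmxA half_deg_invK mulmx1.
set f := x *m _; rewrite qform_sym_laplacian sqnorm_half_deg -qformN -qformD.
rewrite deg_sub_adjacency /qform mulmxA -mulmxA -[up_mx S *m _]trmxK trmx_mul trmxK.
exact: (sqnorm_ge0 (f *m (up_mx S)^T)).
Qed.

(** The hypothesis is orthogonality to the coboundaries in the weighted product. The form of [A] is
    that of [M], plus [d |Pi f|^2], which is at most [K^2 / d |f|^2], minus at most [(k + 1) |f|^2];
    dividing by [delta] passes to the weighted norm. *)
Lemma adjacency_small f : f *m D *m cob = 0 ->
  `|qform A f| <= eta * sqnorm (f *m half_deg).
Proof.
move=> fD; have /andP[p0 p1] := p01.
have := Mbound f; rewrite qform_adjacency qform_proj !ler_norml => /andP[lb ub].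
have g := proj_small fD; have /andP[g0 g1] := qform_proj_range f; rewrite qform_proj in g0 g1.
have sf := sqnorm_ge0 f.
have pk : 0 <= p * k.+1%:R <= k.+1%:R by rewrite mulr_ge0 //= ler_piMl.
have main : `|qform M f + p * (n%:R * sqnorm (f *m Pi) - k.+1%:R * sqnorm f)| <=
    (K + k.+1%:R + K ^+ 2 / d) * sqnorm f.
  have -> : p * (n%:R * sqnorm (f *m Pi) - k.+1%:R * sqnorm f) =
     d * sqnorm (f *m Pi) - p * k.+1%:R * (sqnorm f - sqnorm (f *m Pi)) by ring.
  set u := sqnorm (f *m Pi) in g g0 g1 *; set v := sqnorm f in g sf g1 lb ub *.
  have h1 : 0 <= p * k.+1%:R * (v - u) <= k.+1%:R * v.
    have /andP[pk0 pk1] := pk.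
    rewrite mulr_ge0 ?subr_ge0 //=; apply: ler_pM => //; first by rewrite subr_ge0.
    by rewrite gerBl.
  have h2 : 0 <= d * u by rewrite mulr_ge0 // ltW.
  have h3 : 0 <= k.+1%:R * v by rewrite mulr_ge0.
  have h4 : 0 <= K ^+ 2 / d * v by apply: mulr_ge0 => //; rewrite divr_ge0 ?sqr_ge0 // ltW.
  case/andP: h1 => h1 h1'; rewrite ler_norml !mulrDl; apply/andP; split; lra.
rewrite -ler_norml; apply: le_trans main _; rewrite -[leRHS]mulrA.
have c0 : 0 <= K + k.+1%:R + K ^+ 2 / d.
  by rewrite !addr_ge0 ?ler0n ?(ltW K0) // divr_ge0 ?sqr_ge0 // ltW.
by rewrite ler_wpM2l // ler_pdivlMl // sqnorm_half_deg_ge.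
Qed.

(** The coboundaries and their weighted orthogonal complement, both transported by [half_deg], after
    which they are orthogonal in the ordinary sense. *)
Local Notation V := (cob^T *m half_deg).
Local Notation W := (kermx (half_deg *m cob)).

Lemma rank_V : \rank V = 'C(n.-1, k).
Proof.
rewrite mxrankMfree ?rank_cob // row_free_unit.
by case: (mulmx1_unit half_degK).
Qed.

Lemma rank_W : \rank W = (N - 'C(n.-1, k))%N.
Proof.
rewrite mxrank_ker; congr (_ - _)%N; rewrite -rank_V -[RHS]mxrank_tr trmx_mul tr_diag_mx.
by rewrite trmxK.
Qed.

Lemma V_kernel (x : 'rV[R]_N) : (x <= V)%MS -> x *m sym_laplacian = 0.
Proof.
case/submxP => y ->; rewrite /sym_laplacian mulmxBr mulmx1 !mulmxA.
rewrite -(mulmxA _ half_deg half_deg_inv) half_degK mulmx1.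
rewrite -(mulmxA y cob^T A) tr_cob_deg -half_deg_sqr !mulmxA.
by rewrite -(mulmxA _ half_deg half_deg_inv) half_degK mulmx1 subrr.
Qed.

Lemma W_bound (x : 'rV[R]_N) : (x <= W)%MS -> `|qform sym_laplacian x - sqnorm x| <= eta * sqnorm x.
Proof.
move=> /sub_kermxP xW.
have xE : x = (x *m half_deg_inv) *m half_deg by rewrite -mulmxA half_deg_invK mulmx1.
rewrite {1 2 3}xE; set f := x *m _; rewrite qform_sym_laplacian addrAC subrr sub0r normrN.
apply: adjacency_small; rewrite -half_deg_sqr /f !mulmxA.
by rewrite -(mulmxA x) half_deg_invK mulmx1 -mulmxA.
Qed.

Lemma VW_ortho (x y : 'rV[R]_N) : (x <= V)%MS -> (y <= W)%MS -> x *m y^T = 0.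
Proof.
case/submxP => z -> /sub_kermxP yW; rewrite -!mulmxA.
have -> : half_deg *m y^T = (y *m half_deg)^T by rewrite trmx_mul tr_diag_mx.
by rewrite -trmx_mul -mulmxA yW trmx0 mulmx0.
Qed.

Lemma VW_full (x : 'rV[R]_N) : exists v w, [/\ (v <= V)%MS, (w <= W)%MS & x = v + w].
Proof.
have cap0 : \rank (V :&: W)%MS = 0%N.
  apply/eqP; rewrite mxrank_eq0; apply/eqP/row_matrixP => i; rewrite row0.
  set z := row i _.
  have zV : (z <= V)%MS by rewrite (submx_trans (row_sub _ _)) // capmxSl.
  have zW : (z <= W)%MS by rewrite (submx_trans (row_sub _ _)) // capmxSr.
  by apply/eqP; rewrite -sqnorm_eq0 /sqnorm VW_ortho // mxE.
have rN : ('C(n.-1, k) <= N)%N by rewrite -(rank_proj kn) rank_leq_row.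
have full : row_full (V + W)%MS.
  by rewrite /row_full -(addn0 (\rank _)) -cap0 mxrank_sum_cap rank_V rank_W subnKC.
have /sub_addsmxP [[a b] /= xE] : (x <= V + W)%MS by rewrite submx_full.
by exists (a *m V), (b *m W); rewrite !submxMl.
Qed.

Lemma qform_VW (v w : 'rV[R]_N) : (v <= V)%MS -> (w <= W)%MS ->
  qform sym_laplacian (v + w) = qform sym_laplacian w /\
  sqnorm (v + w) = sqnorm v + sqnorm w.
Proof.
move=> vV wW; split.
  rewrite qform_add ?sym_laplacian_sym // /bform /qform V_kernel // !mul0mx !mxE; ring.
by rewrite !sqnorm_scalar1 qform_add ?trmx1 // /bform mulmx1 VW_ortho // mxE mulr0 addr0.
Qed.

(** The zeros are exact because the form is nonnegative everywhere and vanishes on [V]: the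
    splitting is applied with [lo = t2 = 0]. *)
Lemma property_ii_spectrum (gD : R) : eta <= gD ->
  exists lam, eigenvalues_asc (up_laplacian_mx S) lam /\
    forall i : 'I_N,
      ((i < 'C(n.-1, k))%N -> lam i = 0) /\
      (~~ (i < 'C(n.-1, k))%N -> 1 - gD <= lam i <= 1 + gD).
Proof.
move=> etaD; have rN : ('C(n.-1, k) <= N)%N by rewrite -(rank_proj kn) rank_leq_row.
have eta0 : 0 <= eta.
  by rewrite divr_ge0 ?(ltW delta0) // !addr_ge0 ?ler0n ?(ltW K0) // divr_ge0 ?sqr_ge0 // ltW.
have [lam [dec cp bnds]] : exists lam : 'I_N -> R,
    [/\ forall i j : 'I_N, (i <= j)%N -> lam j <= lam i,
        char_poly sym_laplacian = \prod_(i < N) ('X - (lam i)%:P)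
      & forall i : 'I_N, ((i < N - 'C(n.-1, k))%N -> 1 - gD <= lam i <= 1 + gD) /\
                         (~~ (i < N - 'C(n.-1, k))%N -> 0 <= lam i <= 0)].
  have Wb x : (x <= W)%MS -> (1 - gD) * sqnorm x <= qform sym_laplacian x <= (1 + gD) * sqnorm x.
    move=> xW; have := W_bound xW; rewrite ler_norml => /andP[lb ub].
    have h : eta * sqnorm x <= gD * sqnorm x by rewrite ler_wpM2r ?sqnorm_ge0.
    by rewrite mulrBl mulrDl mul1r; apply/andP; split; lra.
  apply: (@split_spectrum _ _ _ _ _ sym_laplacian W V).
  - exact: sym_laplacian_sym.
  - by rewrite rank_W.
  - by rewrite rank_V subKn.
  - by move=> x /Wb /andP[].
  - by move=> x /V_kernel xV; rewrite /qform xV mul0mx mxE mul0r.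
  - move=> x; rewrite mul0r sym_laplacian_ge0 /=.
    have [v [w [vV wW ->]]] := VW_full x.
    have [-> ->] := qform_VW vV wW; have /andP[_ ub] := Wb _ wW.
    apply: le_trans ub _; rewrite ler_wpM2l ?lerDr ?sqnorm_ge0 //; lra.
(* [split_spectrum] sorts downwards; reversing the indices gives the ascending order. *)
exists (fun i => lam (rev_ord i)); split; first split.
- by move=> i j ij; apply: dec => /=; lia.
- rewrite up_laplacianE char_poly_conj ?half_deg_invK // cp.
  by rewrite (reindex_inj rev_ord_inj).
move=> i; have [b1 b2] := bnds (rev_ord i); split=> ib.
  apply/eqP; rewrite eq_le andbC; apply: b2; rewrite /= -leqNgt; have := ltn_ord i; lia.
apply: b1 => /=; have := ltn_ord i; lia.
Qed.

(** A cocycle has zero form; its component [w] in [W] then satisfies [|w|^2 <= eta |w|^2], so it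
    vanishes and the cocycle is a coboundary. *)
Lemma cohomology_vanishes : eta < 1 -> cohomology_top_vanishes S.
Proof.
move=> eta1 f df; pose x : 'rV[R]_N := \row_i f (@enum_val (faces n k.+1) predT i).
have ux : up_mx S *m x^T = 0.
  apply/matrixP => h j; rewrite !mxE.
  case: (boolP (@enum_val (faces n k.+2) predT h \in S)) => hS; last first.
    by rewrite big1 // => i _; rewrite !mxE (negbTE hS) mul0r.
  rewrite -[RHS](df _ hS) (big_enum_val (A := {: faces n k.+1})); apply: eq_bigr => i _.
  by rewrite !mxE hS.
have q0 : qform sym_laplacian (x *m half_deg) = 0.
  rewrite qform_sym_laplacian sqnorm_half_deg -qformN -qformD deg_sub_adjacency.
  by rewrite /qform -!mulmxA ux !mulmx0 mxE.
have [v [w [vV wW xE]]] := VW_full (x *m half_deg).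
have [qE _] := qform_VW vV wW; rewrite -xE q0 in qE.
have w0 : w = 0.
  have := W_bound wW; rewrite -qE sub0r normrN ger0_norm ?sqnorm_ge0 // => h.
  apply/eqP; rewrite -sqnorm_eq0; apply/eqP/le_anti; rewrite sqnorm_ge0 andbT.
  have : (1 - eta) * sqnorm w <= 0 by rewrite mulrBl mul1r subr_le0.
  by rewrite pmulr_rle0 // subr_gt0.
have /submxP [y vE] := vV.
have {}xE : x = y *m cob^T.
  have := congr1 (mulmx^~ half_deg_inv) xE; rewrite /= w0 addr0 vE.
  by rewrite -!mulmxA half_degK !mulmx1.
exists (fun G => y 0 (enum_rank G)) => F.
have := congr1 (fun z : 'rV_N => z 0 (enum_rank F)) xE; rewrite !mxE enum_rankK => ->.
rewrite (big_enum_val (A := {: faces n k})); apply: eq_bigr => j _.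
by rewrite !mxE /face enum_rankK enum_valK mulrC.
Qed.

End Deterministic.

Lemma superset_card (T : finType) (F : {set T}) m : (#|F| <= m <= #|T|)%N ->
  exists2 G : {set T}, F \subset G & #|G| = m.
Proof.
move=> /andP[Fm mT].
have : (0 < #|[set B : {set T} | (B \subset ~: F) && (#|B| == m - #|F|)%N]|)%N.
  by rewrite cards_draws bin_gt0; have := cardsC F; lia.
rewrite card_gt0 => /set0Pn [B]; rewrite inE => /andP[BF /eqP cB].
exists (F :|: B); first exact: subsetUl.
rewrite cardsU cB (_ : F :&: B = set0) ?cards0; first by lia.
by apply/eqP; rewrite setI_eq0 disjoint_sym disjoints_subset.
Qed.

(** A face with fewer than [k + 2] vertices extends to a set of [k + 1] vertices, which some top
    face contains. *)
Lemma pure_of_deg n k (S : {set faces n k.+2}) : (k.+1 <= n)%N ->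
  (forall F : {set 'I_n}, #|F| = k.+1 -> (0 < deg S F)%N) -> pure S.
Proof.
move=> kn dS F [[cF|[H _ <-]] maxF]; last exact: eqP (valP H).
have [|G FG cG] := @superset_card _ F k.+1; first by rewrite cF card_ord.
have := dS G cG; rewrite card_gt0 => /set0Pn [H]; rewrite inE => /andP[HS GH].
have HF : val H = F by apply: maxF; [right; exists H|exact: subset_trans GH].
by rewrite -HF; exact: eqP (valP H).
Qed.

(** * Probability of the exceptional events *)

Lemma trace_pow_ge0 (F : rcfType) n L (A : 'M[F]_n) :
  A^T = A -> ~~ odd L -> 0 <= \tr (A ^+ L).
Proof.
move=> symA evL; have [P [D [PP AE]]] := symmetric_spectral symA.
rewrite (trace_pow_diagonalized L PP AE).
by apply: sumr_ge0 => i _; exact: exprn_even_ge0.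
Qed.

Lemma setDUK (T : finType) (X s : {set T}) : [disjoint X & s] -> (X :|: s) :\: s = X.
Proof. by move=> Xs; rewrite setDUl setDv setU0; apply/setDidPl. Qed.

Section LinkTrace.
Variables (n k : nat) (p : R).
Hypothesis kn : (k.+2 <= n)%N.
Hypothesis p0 : 0 < p.
Hypothesis p1 : p <= 1.

Let p01 : 0 <= p <= 1. Proof. by rewrite (ltW p0). Qed.

(** Provides the default face that [insubd] in [link_edge] returns on pairs that do not give a
    face. *)
Lemma faces_inhabited : exists H0 : faces n k.+2, True.
Proof.
have [|G _ cG] := @superset_card 'I_n set0 k.+2; first by rewrite cards0 card_ord.
by exists (Sub G (introT eqP cG)).
Qed.

Section OneLink.
Variable s : {set 'I_n}.
Hypothesis cs : #|s| = k.
Variable H0 : faces n k.+2.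

Definition link_adm (u v : 'I_n) := [&& u != v, u \notin s & v \notin s].
Definition link_edge (u v : 'I_n) : faces n k.+2 := insubd H0 ([set u; v] :|: s).

Lemma link_adm_disjoint u v : link_adm u v -> [disjoint [set u; v] & s].
Proof.
case/and3P => _ us vs; rewrite disjoints_subset; apply/subsetP => w.
by rewrite !inE => /orP[] /eqP ->.
Qed.

Lemma val_link_edge u v : link_adm u v -> val (link_edge u v) = [set u; v] :|: s.
Proof.
move=> uv; rewrite /link_edge val_insubd; case: ifP => // /negP; case.
have /and3P[nuv _ _] := uv.
by rewrite cardsU disjoint_setI0 ?link_adm_disjoint // cards0 subn0 cards2 nuv cs.
Qed.

Lemma link_edge_eq u v u' v' : link_adm u v -> link_adm u' v' ->
  (link_edge u v == link_edge u' v') = ([set u; v] == [set u'; v']).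
Proof.
move=> uv uv'; rewrite -val_eqE !val_link_edge //; apply/eqP/eqP => [E|->] //.
by rewrite -(setDUK (link_adm_disjoint uv)) E setDUK ?link_adm_disjoint.
Qed.

Lemma link_mxE S : link_mx S p s =
  entry_mx (fun b : bool => b%:R - p) link_edge link_adm S.
Proof.
apply/matrixP => u v; rewrite !mxE -/(link_adm u v); case: ifP => // uv.
congr (_%:R - _); congr nat_of_bool; rewrite -val_link_edge //.
apply/exists_inP/idP => [[H HS /eqP/val_inj <-]//|uS]; by exists (link_edge u v).
Qed.

(** The two terms are at most [p (1 - p)] and [(1 - p) p^2] in absolute value, which add up to
    [p - p^3]. *)
Lemma centered_moment_le c : (1 < c)%N ->
  `|moment p (fun b : bool => b%:R - p) c| <= p.
Proof.
case: c => [|[|c]] // _; rewrite /moment /= sub0r.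
have q0 : 0 <= 1 - p by rewrite subr_ge0.
have a1 : `|p * (1 - p) ^+ c.+2| <= p * (1 - p).
  rewrite normrM ger0_norm ?(ltW p0) // ler_wpM2l ?(ltW p0) // ger0_norm ?exprn_ge0 //.
  by rewrite exprS ler_piMr // exprn_ile1 // gerBl ltW.
have a2 : `|(1 - p) * (- p) ^+ c.+2| <= (1 - p) * p ^+ 2.
  rewrite normrM ger0_norm // ler_wpM2l // normrX normrN ger0_norm ?(ltW p0) //.
  by apply: ler_wiXn2l; rewrite ?(ltW p0).
apply: le_trans (ler_normD _ _) _; apply: le_trans (lerD a1 a2) _.
have : 0 <= p * p ^+ 2 by rewrite mulr_ge0 ?sqr_ge0 ?(ltW p0).
rewrite !expr2; lra.
Qed.

Lemma link_trace_bound l : ~~ odd l.+1 -> p * n%:R <= l.+1%:R ->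
  p * expect p (fun S : {set faces n k.+2} => \tr (link_mx S p s ^+ l.+1)) <=
  (2 * l.+1)%:R * (walk_const * Num.sqrt (2 * l.+1)%:R) ^+ l.+1.
Proof.
move=> evL pn; apply: le_trans (sum_good_walks_bound evL).
(* The size [2 L] of the comparison set leaves [2 L - L = L >= p n], as the kernel count
   requires. *)
apply: le_trans (@sum_good_walks_le l.+1 _ 'I_n 'I_(2 * l.+1) p (ltW p0) _ _); last first.
- by rewrite !card_ord; have -> : (2 * l.+1 - l.+1 = l.+1)%N by lia.
- by rewrite card_ord; lia.
rewrite (@eq_expect _ _ _ _ (fun S => \tr (entry_mx (fun b : bool => b%:R - p) link_edge link_adm S ^+ l.+1))); last first.
  by move=> S; rewrite link_mxE.
apply: expect_trace_le => //.
- by move=> u v /and3P[].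
- exact: link_edge_eq.
- by rewrite /moment /=; ring.
- exact: centered_moment_le.
Qed.

Lemma link_mx_sym (S : {set faces n k.+2}) : (link_mx S p s)^T = link_mx S p s.
Proof.
apply/matrixP => u v; rewrite !mxE eq_sym [(v \notin s) && _]andbC.
by rewrite (setUC [set v] [set u]).
Qed.

End OneLink.

Lemma ffact_le_exp m : (n ^_ m <= n ^ m)%N.
Proof. by elim: m => // m IH; rewrite ffactnSr expnSr leq_mul // leq_subr. Qed.

Lemma card_faces_le m : (#|{: faces n m}| <= n ^ m)%N.
Proof.
have -> : #|{: faces n m}| = 'C(n, m) by exact: Nk_binom.
apply: leq_trans (ffact_le_exp m); rewrite -bin_ffact leq_pmulr ?fact_gt0 //.
Qed.

Lemma prob_links l (th : R) : ~~ odd l.+1 -> p * n%:R <= l.+1%:R -> 0 < th ->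
  prob p (fun S : {set faces n k.+2} =>
    [exists s : faces n k, (th ^+ l.+1 <= \tr (link_mx S p (val s) ^+ l.+1))%R]) <=
  n%:R ^+ k * ((2 * l.+1)%:R / p * (walk_const * Num.sqrt (2 * l.+1)%:R / th) ^+ l.+1).
Proof.
move=> evL pn th0; have [H0 _] := faces_inhabited.
set B := _ / p * _.
have one (s : faces n k) : prob p (fun S : {set faces n k.+2} =>
    (th ^+ l.+1 <= \tr (link_mx S p (val s) ^+ l.+1))%R) <= B.
  have cs := eqP (valP s).
  apply: le_trans (prob_markov p01 _ (exprn_gt0 _ th0)) _.
    by move=> S; apply: trace_pow_ge0 => //; exact: link_mx_sym.
  rewrite ler_pdivrMr ?exprn_gt0 // -(ler_pM2l p0).
  apply: le_trans (link_trace_bound cs H0 evL pn) _.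
  rewrite /B [(_ / th) ^+ _]exprMn exprVn le_eqVlt; apply/orP; left; apply/eqP.
  by field; rewrite expf_neq0 ?gt_eqF.
apply: le_trans (prob_exists p01 _) _.
apply: le_trans (ler_sum _ (fun s _ => one s)) _.
rewrite sumr_const -[leLHS]mulr_natl -natrX ler_wpM2r ?ler_nat ?card_faces_le //.
rewrite /B mulr_ge0 ?divr_ge0 ?(ltW p0) ?exprn_ge0 ?mulr_ge0 ?invr_ge0 ?(ltW th0) ?sqrtr_ge0 //.
by rewrite ltW ?expR_gt0.
Qed.

(** * Lower tail of the degrees *)

Lemma card_cofaces (F : {set 'I_n}) : #|F| = k.+1 ->
  #|[set H : faces n k.+2 | F \subset val H]| = (n - k.+1)%N.
Proof.
move=> cF; apply/eqP; rewrite -(eqr_nat R).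
have -> : #|[set H : faces n k.+2 | F \subset val H]| = deg (setT : {set faces n k.+2}) F.
  by apply: eq_card => H; rewrite !inE.
rewrite deg_sum // (eq_bigl xpredT) => [|H]; last by rewrite inE.
by rewrite (sum_faces k.+2 (fun H => incidence H F ^+ 2)) sum_incidence_sqr_up.
Qed.

(** Each of the [n - k - 1] possible cofaces contributes an independent factor [1 - p (1 - exp (-
    t)) <= exp (- p (1 - exp (- t)))]. *)
Lemma expect_exp_deg (F : {set 'I_n}) (t : R) : #|F| = k.+1 ->
  expect p (fun S : {set faces n k.+2} => exp (- t * (deg S F)%:R)) <=
  exp (- (p * (n%:R - k.+1%:R) * (1 - exp (- t)))).
Proof.
move=> cF.
pose g (H : faces n k.+2) (b : bool) : R := if (F \subset val H) && b then exp (- t) else 1.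
have gE (S : {set faces n k.+2}) : exp (- t * (deg S F)%:R) = \prod_H g H (H \in S).
  rewrite expRM_natr /deg -prodr_const big_mkcond /=; apply: eq_bigr => H _.
  by rewrite inE /g andbC.
rewrite (eq_expect _ gE) (expect_prod p g).
have -> : exp (- (p * (n%:R - k.+1%:R) * (1 - exp (- t)))) =
   \prod_(H : faces n k.+2) (if F \subset val H then exp (- (p * (1 - exp (- t)))) else 1).
  rewrite -big_mkcond /= (eq_bigl (mem [set H : faces n k.+2 | F \subset val H])) => [|H]; last by rewrite !inE.
  rewrite prodr_const card_cofaces // -expRM_natr natrB ?(ltnW kn) //; congr exp; ring.
apply: ler_prod => H _; rewrite /g andbT andbF; case: ifP => FH.
  have e0 := expR_gt0 (- t).
  apply/andP; split; first by rewrite addr_ge0 // mulr_ge0 ?(ltW p0) ?(ltW e0) ?subr_ge0.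
  apply: le_trans (expR_ge1Dx _); rewrite le_eqVlt; apply/orP; left; apply/eqP; ring.
by rewrite !mulr1 addrC subrK ler01 lexx.
Qed.

Lemma prob_deg (delta t : R) : 0 <= t ->
  prob p (fun S : {set faces n k.+2} =>
    [exists F : faces n k.+1, ((deg S (val F))%:R < delta)%R]) <=
  n%:R ^+ k.+1 * exp (t * delta - p * (n%:R - k.+1%:R) * (1 - exp (- t))).
Proof.
move=> t0; set B := exp _.
have one (F : faces n k.+1) : prob p (fun S : {set faces n k.+2} =>
    ((deg S (val F))%:R < delta)%R) <= B.
  have cF := eqP (valP F).
  apply: (@le_trans _ _ (prob p (fun S : {set faces n k.+2} =>
     (exp (- t * delta) <= exp (- t * (deg S (val F))%:R))%R))).
    apply: ler_prob => // S /ltW dS; apply: ler_expR; rewrite !mulNr lerN2.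
    by rewrite ler_wpM2l.
  apply: le_trans (prob_markov p01 _ (expR_gt0 _)) _; first by move=> S; rewrite ltW ?expR_gt0.
  rewrite ler_pdivrMr ?expR_gt0 // /B -expRD.
  apply: le_trans (expect_exp_deg t cF) _; apply: ler_expR.
  by rewrite le_eqVlt; apply/orP; left; apply/eqP; ring.
apply: le_trans (prob_exists p01 _) _.
apply: le_trans (ler_sum _ (fun F _ => one F)) _.
rewrite sumr_const -[leLHS]mulr_natl -natrX ler_wpM2r ?ler_nat ?card_faces_le //.
by rewrite ltW ?expR_gt0.
Qed.

End LinkTrace.

(** Translates decidable exceptional events into the propositional events of [LM_prob], by
    inclusion. *)
Lemma LM_prob_ge (n k : nat) (p : R) (E : {set faces n k.+1} -> Prop)
    (bad : pred {set faces n k.+1}) :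
  0 <= p <= 1 -> (forall S, ~~ bad S -> E S) -> 1 - prob p bad <= LM_prob n k p E.
Proof.
move=> p01 badE.
have -> : 1 - prob p bad = prob p (predC bad).
  rewrite [in RHS]probC; congr (_ - _); apply: eq_expect => S /=; by rewrite negbK.
apply: ler_sum => S _; rewrite weightE /=; case: excluded_middle_informative => ES.
  case: (bad S); rewrite ?mulr1 // mulr0; have /andP[p0 p1] := p01.
  by rewrite mulr_ge0 ?exprn_ge0 ?subr_ge0.
case: (boolP (bad S)) => [_|/badE //]; by rewrite mulr0.
Qed.

(** * The theorem *)

Lemma ltr_expR (x y : R) : x < y -> exp x < exp y.
Proof.
move=> xy; rewrite -[y](subrK x) addrC expRD ltr_pMr ?expR_gt0 //.
by apply: lt_le_trans (expR_ge1Dx _); rewrite ltrDl subr_gt0.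
Qed.

Lemma expR_ln (x : R) : 0 < x -> exp (ln x) = x.
Proof. by move=> /RltbP x0; exact: exp_ln. Qed.

Lemma ler_ln_of_exp (X x : R) : exp X <= x -> X <= ln x.
Proof.
move=> Xx; rewrite leNgt; apply/negP => /ltr_expR; rewrite expR_ln.
  by rewrite ltNge Xx.
exact: lt_le_trans (expR_gt0 _) Xx.
Qed.

Lemma R_nat_ge (x : R) : exists m : nat, x <= m%:R.
Proof.
have [x0|x0] := lerP 0 x; last by exists 0%N; exact: ltW.
by have [m /andP[_ /ltW xm]] := R_floor x0; exists m.+1.
Qed.

(** Since [2 L <= 8 p n <= 16 d], this makes [walk_const * sqrt (2 L)] at most [exp (- b)] times
    [link_const b * sqrt d]. *)
Definition link_const (b : R) : R := 4 * walk_const * exp b.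

Lemma link_const_gt0 b : 0 < link_const b.
Proof.
by rewrite /link_const !mulr_gt0 ?expR_gt0 // (lt_le_trans ltr01) // walk_const_ge1.
Qed.

Section Events.
Variables (n k : nat) (p : R).
Hypothesis kn : (k.+2 <= n)%N.
Hypothesis kn2 : (2 * k.+1 <= n)%N.
Hypothesis p0 : 0 < p.
Hypothesis p1 : p <= 1.
Hypothesis pn1 : 1 <= p * n%:R.

Local Notation d := (p * (n%:R - k.+1%:R)).

Lemma d_ge : p * n%:R <= 2 * d.
Proof.
have : 2 * k.+1%:R <= n%:R :> R by rewrite -natrM ler_nat.
move=> h; have : 0 <= p * (n%:R - 2 * k.+1%:R) by rewrite mulr_ge0 ?subr_ge0 // ltW.
rewrite mulrBr; lra.
Qed.

(** [L = 2 (floor (p n) + 1)]; the upper bound uses [1 <= p n]. *)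
Lemma even_length : exists l, [/\ ~~ odd l.+1, p * n%:R <= l.+1%:R & l.+1%:R <= 4 * (p * n%:R)].
Proof.
have pn1' := pn1; have pn0 : 0 <= p * n%:R by rewrite mulr_ge0 // ltW.
have [q /andP[q1 q2]] := R_floor pn0; exists (2 * q).+1.
have E : ((2 * q).+2)%:R = 2 * q.+1%:R :> R by rewrite -natrM; congr _%:R; lia.
rewrite E; move: q2; rewrite -natr1 => q2; split; try lra.
by rewrite -[(2 * q).+2]addn2 oddD oddM.
Qed.

(** The power [exp (- b L)] is at most [exp (- b gamma log n)]; the remaining factors are [n^k] for
    the links and [2 L / p <= 8 n]. *)
Lemma link_event (b gamma : R) : 0 <= b -> gamma * ln n%:R <= p * n%:R ->
  exists bad : pred {set faces n k.+2},
    prob p bad <= 8 * n%:R ^+ k.+1 * exp (- (b * (gamma * ln n%:R))) /\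
    forall S, ~~ bad S -> forall x,
      `|qform (adjacency_mx S - p *: adjacency_mx setT) x| <=
       k.+1%:R * link_const b * Num.sqrt d * sqnorm x.
Proof.
move=> b0 gpn; have dge := d_ge; have pn1' := pn1; have d0 : 0 < d by lra.
pose sd := Num.sqrt d; have sd0 : 0 < sd by rewrite sqrtr_gt0.
have [l [evL pnL L4]] := even_length.
pose th := link_const b * sd; have th0 : 0 < th by rewrite mulr_gt0 ?link_const_gt0.
exists (fun S : {set faces n k.+2} =>
    [exists s : faces n k, (th ^+ l.+1 <= \tr (link_mx S p (val s) ^+ l.+1))%R]); split.
  apply: le_trans (prob_links kn p0 p1 evL pnL th0) _.
  have wc0 : 0 < walk_const by rewrite (lt_le_trans ltr01) // walk_const_ge1.
  have ratio : walk_const * Num.sqrt (2 * l.+1)%:R / th <= exp (- b).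
    rewrite ler_pdivrMr // /th /link_const.
    have -> : exp (- b) * (4 * walk_const * exp b * sd) = walk_const * (4 * sd).
      by rewrite expRN; field; rewrite gt_eqF ?expR_gt0.
    rewrite ler_wpM2l ?(ltW wc0) //.
    have -> : 4 * sd = Num.sqrt (16 * d).
      rewrite sqrtrM // -/sd; congr (_ * _).
      have -> : 16 = 4 ^+ 2 :> R by rewrite -natrX.
      by rewrite sqrtr_sqr ger0_norm.
    by rewrite ler_wsqrtr // natrM; lra.
  have ratio0 : 0 <= walk_const * Num.sqrt (2 * l.+1)%:R / th.
    by rewrite divr_ge0 ?(ltW th0) // mulr_ge0 ?sqrtr_ge0 ?(ltW wc0).
  have powL : (walk_const * Num.sqrt (2 * l.+1)%:R / th) ^+ l.+1 <= exp (- (b * (gamma * ln n%:R))).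
    apply: (@le_trans _ _ (exp (- b) ^+ l.+1)).
      by apply: lerXn2r; rewrite ?nnegrE // ltW ?expR_gt0.
    rewrite -expRM_natr; apply: ler_expR; rewrite mulNr lerN2 ler_wpM2l //; lra.
  have quot : (2 * l.+1)%:R / p <= 8 * n%:R.
    by rewrite ler_pdivrMr // natrM; lra.
  set z := exp (- _) in powL *.
  have -> : 8 * n%:R ^+ k.+1 * z = n%:R ^+ k * (8 * n%:R * z) by rewrite exprSr; ring.
  apply: ler_wpM2l; first by rewrite exprn_ge0.
  apply: ler_pM => //; first by rewrite divr_ge0 // ltW.
  exact: exprn_ge0.
move=> S; rewrite negb_exists => /forallP nb x.
rewrite -[k.+1%:R * _ * _]mulrA; apply: garland_bound => s cs y.
have /= := nb (Sub s (introT eqP cs)); rewrite -ltNge => /ltW tr.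
by apply: qform_le_trace_pow tr => //; [exact: link_mx_sym|exact: ltW].
Qed.

(** With [t = 2 / eta], the product of [t] with the threshold and the loss from
    [exp (- t) <= eta / 2] cost [d eta / 2] each, so the exponent stays at [d (1 - eta)]. *)
Lemma deg_event (eta : R) : 0 < eta ->
  prob p (fun S : {set faces n k.+2} =>
    [exists F : faces n k.+1, ((deg S (val F))%:R < eta ^+ 2 / 4 * d)%R]) <=
  n%:R ^+ k.+1 * exp (- (d * (1 - eta))).
Proof.
move=> eta0; have dge := d_ge; have pn1' := pn1; have d0 : 0 < d by lra.
have t0 : 0 < 2 / eta by rewrite divr_gt0.
apply: le_trans (prob_deg kn p0 p1 _ (ltW t0)) _.
rewrite ler_wpM2l ?exprn_ge0 //; apply: ler_expR.
have et : exp (- (2 / eta)) <= eta / 2.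
  rewrite expRN -[eta / 2]invrK lef_pV2 ?posrE ?expR_gt0 ?invr_gt0 ?divr_gt0 //.
  by rewrite invf_div; apply: le_trans (expR_ge1Dx _); rewrite lerDr.
have -> : 2 / eta * (eta ^+ 2 / 4 * d) = d * (eta / 2).
  by move: d0; set dd := d => d0; field; rewrite gt_eqF.
have : d * exp (- (2 / eta)) <= d * (eta / 2) by rewrite ler_wpM2l // ltW.
set e := exp _; move: d0; set dd := d => d0 h.
rewrite !mulrBr mulr1; lra.
Qed.

End Events.

(** Stated with the MathComp operations and with [k.+1] for the dimension. Positivity of [d] is part
    of the conclusion because the translation of square root and quotient to those of the Stdlib
    relies on it. *)
Theorem spectral_gap_core (k : nat) (c gamma : R) : 0 < c -> c < gamma ->
  exists C : R, 0 < C /\ exists n0 : nat, forall n : nat, (n0 <= n)%N ->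
  forall p : R, 0 <= p <= 1 ->
  let d := p * (n%:R - k.+1%:R) in
  let x := ln n%:R in
  [/\ (0 < n)%N, 0 <= x,
   ((k.+1%:R + gamma) * x <= p * n%:R ->
      0 < d /\ 1 - exp (- (c * x)) <=
      LM_prob n k.+1 p (fun S => property_i S d (C * Num.sqrt d) /\
                                 property_ii S (C / Num.sqrt d)))
 & (gamma * x <= p * n%:R ->
      0 < d /\ 1 - exp (- (c * x)) <= LM_prob n k.+1 p (fun S => property_i S d (C * Num.sqrt d)))].
Proof.
move=> c0 cg; have g0 : 0 < gamma by exact: lt_trans cg.
have k0 : 0 < k.+1%:R :> R by rewrite ltr0n.
(* In [b gamma = (k + 1) + c + 1] the first part cancels [n^(k+1)], the second leaves [n^-c], and
   the extra [1 / n] absorbs the constant 8. *)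
pose b : R := (k.+1%:R + c + 1) / gamma.
have bg : b * gamma = k.+1%:R + c + 1 by rewrite divfK ?gt_eqF.
have b0 : 0 <= b by rewrite divr_ge0 ?(ltW g0) //; lra.
(* Chosen so that [(k + 1 + gamma) (1 - eta)^2 >= k + 1 + (gamma + c) / 2]; one factor [1 - eta] is
   lost in [d] against [p n], the other in the degree bound. *)
pose eta : R := (gamma - c) / (4 * (k.+1%:R + gamma)).
have kg0 : 0 < k.+1%:R + gamma by lra.
have eta0 : 0 < eta by rewrite divr_gt0 ?subr_gt0 ?mulr_gt0.
have etaE : eta * (k.+1%:R + gamma) = (gamma - c) / 4.
  by rewrite /eta; move: kg0; set z := k.+1%:R + gamma => z0; field; rewrite gt_eqF.
have eta1 : eta < 1.
  by rewrite ltr_pdivrMr ?mulr_gt0 // mul1r; lra.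
pose eps : R := eta ^+ 2 / 4; have eps0 : 0 < eps by rewrite divr_gt0 ?exprn_gt0.
pose C1 : R := k.+1%:R * link_const b.
have C10 : 0 < C1 by rewrite mulr_gt0 ?link_const_gt0.
(* [C2 / sqrt d] bounds the relative error of the Laplacian for [K = C1 sqrt d] and [delta = eps d],
   given [1 <= sqrt d]. *)
pose C2 : R := (C1 + k.+1%:R + C1 ^+ 2) / eps.
have C20 : 0 < C2 by rewrite divr_gt0 // !addr_gt0 ?exprn_gt0.
exists (C1 + k.+1%:R + C2); split; first by rewrite !addr_gt0.
(* The first term makes [d > C2^2], which gives the strict inequality behind the vanishing of
   cohomology; the second makes [n^-((gamma - c) / 2) <= 1/2]. *)
pose X : R := 2 * (C2 ^+ 2 + 1) / gamma + 2 / (gamma - c).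
have [m1 hm1] := R_nat_ge (exp X); have [m2 hm2] := R_nat_ge (k.+1%:R / eta).
(* 16 gives [8 / n <= 1/2], [2 * k.+1] gives [p n <= 2 d], [m1] gives [ln n >= X] and [m2] gives
   [k + 1 <= eta n]. *)
exists (16 + 2 * k.+1 + m1 + m2)%N => n nn0 p p01 d x.
have n16 : 16 <= n%:R :> R by rewrite ler_nat; move: nn0; clear; lia.
have n_pos : (0 < n)%N by move: nn0; clear; lia.
have nR0 : 0 < n%:R :> R by rewrite ltr0n.
have kn : (k.+2 <= n)%N by move: nn0; clear; lia.
have kn2 : (2 * k.+1 <= n)%N by move: nn0; clear; lia.
have keta : k.+1%:R <= eta * n%:R.
  rewrite mulrC -ler_pdivrMr //; apply: le_trans hm2 _; rewrite ler_nat; move: nn0; clear; lia.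
have xX : X <= x.
  by apply: ler_ln_of_exp; apply: le_trans hm1 _; rewrite ler_nat; move: nn0; clear; lia.
have nx : exp x = n%:R by rewrite expR_ln.
have gc0 : 0 < gamma - c by rewrite subr_gt0.
have C2sq : 0 < C2 ^+ 2 by rewrite exprn_gt0.
have x1 : 2 * (C2 ^+ 2 + 1) <= gamma * x.
  rewrite [gamma * x]mulrC -ler_pdivrMr //; apply: le_trans xX; rewrite lerDl divr_ge0 // ltW //.
have x2 : 2 <= (gamma - c) * x.
  rewrite [leRHS]mulrC -ler_pdivrMr //; apply: le_trans xX; rewrite lerDr divr_ge0 ?mulr_ge0 ?(ltW g0) //; lra.
have x0 : 0 <= x by rewrite -(pmulr_rge0 _ gc0); lra.
have npow m : n%:R ^+ m = exp (x * m%:R) :> R by rewrite expRM_natr nx.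
have e0 := expR_gt0 (- (c * x)).
pose good1 (S : {set faces n k.+2}) := forall y,
  `|qform (adjacency_mx S - p *: adjacency_mx setT) y| <= C1 * Num.sqrt d * sqnorm y.
have common : gamma * x <= p * n%:R ->
  [/\ 0 < p, C2 ^+ 2 + 1 <= d, 1 <= p * n%:R & exists bad : pred {set faces n k.+2},
    prob p bad <= 2^-1 * exp (- (c * x)) /\ forall S, ~~ bad S -> good1 S].
  move=> gpn; have pn1 : 1 <= p * n%:R by lra.
  have p0 : 0 < p by rewrite -(pmulr_lgt0 _ nR0); lra.
  have /andP[_ p1] := p01; have dge := d_ge kn2 p0.
  split=> //; first by rewrite /d; lra.
  have [bad [Pbad badE]] := link_event kn kn2 p0 p1 pn1 b0 gpn.
  exists bad; split=> //; apply: le_trans Pbad _.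
  rewrite npow mulrA bg -/x -mulrA -expRD.
  have -> : x * k.+1%:R + - ((k.+1%:R + c + 1) * x) = - (c * x) + - x by ring.
  rewrite expRD [exp (- x)]expRN nx.
  have : 8 / n%:R <= 2^-1 :> R by rewrite ler_pdivrMr //; lra.
  move=> h; rewrite [exp _ * _]mulrC mulrA ler_wpM2r // ltW //.
have sqrt_facts : C2 ^+ 2 + 1 <= d -> [/\ 0 < d, 1 <= Num.sqrt d, Num.sqrt d ^+ 2 = d & C2 < Num.sqrt d].
  move=> dC; have d0 : 0 < d by lra.
  have s2 : Num.sqrt d ^+ 2 = d by rewrite sqr_sqrtr // ltW.
  split=> //; first by rewrite -sqrtr1 ler_wsqrtr //; lra.
  rewrite -(@ltr_pXn2r _ 2) ?nnegrE ?sqrtr_ge0 ?(ltW C20) // s2; lra.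
have prop_i S : 0 < p -> C2 ^+ 2 + 1 <= d -> good1 S ->
    property_i S d ((C1 + k.+1%:R + C2) * Num.sqrt d).
  move=> p0 dC gS; have [d0 s1 s2 Cs] := sqrt_facts dC.
  have s0 : 0 < Num.sqrt d by lra.
  apply: (@property_i_bound _ _ _ _ (C1 * Num.sqrt d) (ltnW kn) p01 gS).
  have h1 : k.+1%:R <= k.+1%:R * Num.sqrt d by rewrite ler_peMr // ltW.
  have h2 : 0 <= C2 * Num.sqrt d by rewrite mulr_ge0 // ltW.
  rewrite !mulrDl; lra.
split=> //.
  move=> kpn; have gpn : gamma * x <= p * n%:R.
    have : 0 <= k.+1%:R * x by rewrite mulr_ge0 // ltW.
    move: kpn; rewrite mulrDl; lra.
  have [p0 dC pn1 [bad [Pbad badE]]] := common gpn.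
  have [d0 s1 s2 Cs] := sqrt_facts dC; split=> //.
  have /andP[_ p1] := p01; have s0 : 0 < Num.sqrt d by lra.
  pose bad2 (S : {set faces n k.+2}) := [exists F : faces n k.+1, ((deg S (val F))%:R < eps * d)%R].
  have Pbad2 : prob p bad2 <= 2^-1 * exp (- (c * x)).
    apply: le_trans (deg_event kn kn2 p0 p1 pn1 eta0) _.
    rewrite npow -expRD.
    have dlow : (k.+1%:R + gamma) * x * (1 - eta) <= d.
      have : p * k.+1%:R <= p * (eta * n%:R) by rewrite ler_wpM2l // ltW.
      have : (k.+1%:R + gamma) * x * (1 - eta) <= p * n%:R * (1 - eta).
        by rewrite ler_wpM2r // subr_ge0 ltW.
      rewrite /d !mulrBr; lra.
    have dlow2 : (k.+1%:R + (gamma + c) / 2) * x <= d * (1 - eta).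
      have : (k.+1%:R + gamma) * x * (1 - eta) * (1 - eta) <= d * (1 - eta).
        by rewrite ler_wpM2r // subr_ge0 ltW.
      apply: le_trans.
      have -> : (k.+1%:R + gamma) * x * (1 - eta) * (1 - eta) =
         ((k.+1%:R + gamma) - 2 * (eta * (k.+1%:R + gamma)) + eta * (eta * (k.+1%:R + gamma))) * x by ring.
      rewrite etaE ler_wpM2r //.
      have : 0 <= eta * ((gamma - c) / 4) by rewrite mulr_ge0 ?(ltW eta0) // divr_ge0 // ltW.
      lra.
    apply: (@le_trans _ _ (exp (- (c * x) + - ((gamma - c) / 2 * x)))).
      apply: ler_expR; move: dlow2; set dd := d * (1 - eta) => h.
      have -> : - (c * x) + - ((gamma - c) / 2 * x) = x * k.+1%:R - (k.+1%:R + (gamma + c) / 2) * x by field.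
      by rewrite lerD2l lerN2.
    rewrite expRD mulrC ler_wpM2r ?(ltW e0) // expRN lef_pV2 ?posrE ?expR_gt0 //.
    apply: le_trans (expR_ge1Dx _); lra.
  have P12 : prob p (fun S => bad S || bad2 S) <= exp (- (c * x)).
    apply: le_trans (prob_or p01 _ _) _; lra.
  apply: le_trans (LM_prob_ge (bad := fun S => bad S || bad2 S) p01 _); first by rewrite lerB.
  move=> S /norP[/badE gS]; rewrite negb_exists => /forallP dS.
  split; first exact: prop_i.
  have degS (F : {set 'I_n}) : #|F| = k.+1 -> eps * d <= (deg S F)%:R.
    by move=> cF; have := dS (Sub F (introT eqP cF)); rewrite -leNgt.
  have ed0 : 0 < eps * d by rewrite mulr_gt0.
  have K0 : 0 < C1 * Num.sqrt d by rewrite mulr_gt0.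
  have etale : (C1 * Num.sqrt d + k.+1%:R + (C1 * Num.sqrt d) ^+ 2 / d) / (eps * d) <= C2 / Num.sqrt d.
    have -> : (C1 * Num.sqrt d) ^+ 2 / d = C1 ^+ 2 by rewrite exprMn s2 mulfK // gt_eqF.
    rewrite ler_pdivrMr //.
    have -> : C2 / Num.sqrt d * (eps * d) = (C1 + k.+1%:R + C1 ^+ 2) * Num.sqrt d.
      by rewrite /C2 -[X in eps * X]s2; field; rewrite !gt_eqF.
    have h1 : k.+1%:R <= k.+1%:R * Num.sqrt d by rewrite ler_peMr // ltW.
    have h2 : C1 ^+ 2 <= C1 ^+ 2 * Num.sqrt d by rewrite ler_peMr // sqr_ge0.
    rewrite !mulrDl; lra.
  split; first by apply: pure_of_deg (ltnW kn) _ => F cF; rewrite -(ltr_nat R); exact: lt_le_trans (degS F cF).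
  split.
    apply: (property_ii_spectrum (ltnW kn) p01 K0 gS d0 ed0 degS).
    by apply: le_trans etale _; rewrite ler_wpM2r ?invr_ge0 ?(ltW s0) // lerDr ltW // addr_gt0.
  apply: (cohomology_vanishes (ltnW kn) p01 K0 gS d0 ed0 degS).
  by apply: le_lt_trans etale _; rewrite ltr_pdivrMr // mul1r.
move=> gpn; have [p0 dC pn1 [bad [Pbad badE]]] := common gpn.
have [d0 _ _ _] := sqrt_facts dC; split=> //.
apply: le_trans (LM_prob_ge (bad := bad) p01 _); first by rewrite lerB //; lra.
by move=> S /badE gS; exact: prop_i.
Qed.

Lemma RsqrtE (x : R) : 0 <= x -> R_sqrt.sqrt x = Num.sqrt x.
Proof.
move=> x0; apply/eqP; rewrite -(@eqrXn2 _ 2) ?sqrtr_ge0 ?sqr_sqrtr //.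
  by rewrite expr2; apply/eqP; apply: sqrt_sqrt; apply/RlebP.
by apply/RlebP; exact: sqrt_pos.
Qed.

Lemma RdivE (x y : R) : y != 0 -> Rdiv x y = x / y.
Proof.
move=> y0; suff E : y^-1 = Rinv y by rewrite E.
apply: (mulIf y0); rewrite mulVf //; apply/esym; apply: Rinv_l; exact/eqP.
Qed.

Local Open Scope R_scope.

Theorem theorem1p2 (k : nat) (hk : (2 <= k)%N) (c gamma : R)
    (hc : 0 < c) (hgamma : c < gamma) :
  exists C : R, 0 < C /\
  exists n0 : nat, forall n : nat, (n0 <= n)%N ->
  forall p : R, 0 <= p <= 1 ->
    let d := p * (INR n - INR k) in
    let gA := C * sqrt d in
    let gD := C / sqrt d in
    ((INR k + gamma) * ln (INR n) / INR n <= p ->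
       1 - Rpower (INR n) (- c)
         <= LM_prob n k p (fun S => property_i S d gA /\ property_ii S gD)) /\
    (gamma * ln (INR n) / INR n <= p ->
       1 - Rpower (INR n) (- c) <= LM_prob n k p (fun S => property_i S d gA)).
Proof.
case: k hk => // k _.
have [C [C0 [n0 core]]] := spectral_gap_core k (introT (RltbP _ _) hc) (introT (RltbP _ _) hgamma).
exists C; split; first exact/RltbP.
exists n0 => n nn0 p [/RlebP p0 /RlebP p1] d gA gD.
have p01 : Order.le (IZR 0) p && Order.le p (IZR 1) by apply/andP.
have [n_pos x0 core1 core2] := core n nn0 p p01.
have dE : d = (p * (n%:R - k.+1%:R))%R by rewrite /d !INRE.
have nR0 : INR n <> 0 by apply: not_0_INR => E; rewrite E in n_pos.
have nRpos : 0 < INR n by apply: lt_0_INR; apply/ssrnat.ltP.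
have hyp (a : R) : a * ln (INR n) / INR n <= p -> (a * ln n%:R <= p * n%:R)%R.
  move=> h; apply/RlebP; rewrite -INRE.
  have := Rmult_le_compat_r (INR n) _ _ (Rlt_le _ _ nRpos) h.
  by rewrite /Rdiv Rmult_assoc Rinv_l // Rmult_1_r.
have powE : Rpower (INR n) (- c) = exp (- (c * ln n%:R))%R.
  by rewrite /Rpower INRE; congr exp; exact: mulNr.
have sqE : (0 < d)%R -> gA = (C * Num.sqrt d)%R /\ gD = (C / Num.sqrt d)%R.
  move=> dpos; rewrite /gA /gD RsqrtE ?(ltW dpos) //; split=> //.
  by rewrite RdivE // gt_eqF // sqrtr_gt0.
rewrite powE; split=> /hyp h; apply/RlebP.
  rewrite INRE in h; have [dpos] := core1 h; rewrite -dE in dpos *.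
  by have [-> ->] := sqE dpos.
have [dpos] := core2 h; rewrite -dE in dpos *.
by have [-> _] := sqE dpos.
Qed.
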